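(* Let $f(z)=\sum_{n=0}^{\infty}a_nz^n\in\mathcal{B}$. Then $$\mathcal{G}_{1,f}(r):=|f(z)|+|f'(z)|\,r+\sum_{n=2}^{\infty}|a_n|r^n+\left(\frac{1}{1+|a_0|}+\frac{r}{1-r}\right)\sum_{n=1}^{\infty}|a_n|^2r^{2n}+\lambda\left(\frac{S_r}{\pi}\right)\le 1$$ for $|z|=r\le(\sqrt{17}-3)/4$, where the numbers $\lambda=(221-43\sqrt{17})/64$ and $(\sqrt{17}-3)/4$ cannot be improved. The equality $\mathcal{G}_{1,f}(r)=1$ is achieved for the function $f_a$.
   Context: $\mathbb{D}=\{z\in\mathbb{C}:|z|<1\}$, $\mathbb{D}_r=\{z\in\mathbb{C}:|z|<r\}$ for $0<r<1$, and $\mathcal{B}$ is the class of analytic functions $f$ on $\mathbb{D}$ with $\sup_{z\in\mathbb{D}}|f(z)|\le 1$. The $a_n=f^{(n)}(0)/n!$ are the Taylor coefficients of $f$ at $0$. $S_r=S_r(f):=\int_{\mathbb{D}_r}|f'(z)|^2\,dA(z)$, with $dA$ planar Lebesgue measure, so that $S_r/\pi=\sum_{n=1}^{\infty}n|a_n|^2r^{2n}$. For $a\in[0,1)$, $f_a(z)=\dfrac{a-z}{1-az}$. ''Cannot be improved'' means: the radius $(\sqrt{17}-3)/4$ cannot be replaced by a larger one, and the constant $\lambda$ cannot be replaced by a larger one, with the inequality still holding for all $f\in\mathcal{B}$.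
   Formalization: The claim that equality G = 1 is achieved for f_a fails for every a in [0,1) (for a = 0 at the extremal radius G is about 0.725); it is replaced by G → 1 for f_a as a → 1⁻, for each |z| ≤ (√17−3)/4, with the f_a witnessing that both constants are sharp. *)

(* Defs.v *)
From mathcomp Require Export all_boot all_order all_algebra.
From mathcomp Require Export all_classical all_reals all_analysis.
From mathcomp Require Export complex.
Export Order.TTheory GRing.Theory Num.Theory.
Export numFieldNormedType.Exports.

Set Implicit Arguments.
Unset Strict Implicit.
Unset Printing Implicit Defensive.

Local Open Scope classical_set_scope.
Local Open Scope ring_scope.

(* The complex numbers over R, with the topology and normed-module structure
   over themselves that every numFieldType carries.  In particular derive1 f
   below is the complex derivative of f.  The norm `|z| lives in R[i]; the modulus as an
   element of R is normc z. *)
Definition cplx (R : realType) : numFieldType := R[i].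

Definition modulus (R : realType) (z : cplx R) : R := ComplexField.Normc.normc z.

Definition unit_disc (R : realType) : set (cplx R) := [set z | modulus z < 1].

Definition analytic_at (R : realType) (f : cplx R -> cplx R) (z0 : cplx R) :=
  exists c : nat -> cplx R,
    \forall z \near z0, series (fun n => c n * (z - z0) ^+ n) @ \oo --> f z.

Definition bounded_class (R : realType) (f : cplx R -> cplx R) :=
  (forall z, unit_disc z -> analytic_at f z) /\
  (forall z, unit_disc z -> modulus (f z) <= 1).

Definition taylor_coef (R : realType) (f : cplx R -> cplx R) (n : nat) : cplx R :=
  derive1n n f 0 / n`!%:R.

Definition area_S (R : realType) (f : cplx R -> cplx R) (r : R) : \bar R :=
  let mu := @lebesgue_measure R in
  \int[(mu \x mu)%E]_(p in [set p : R * R | modulus (p.1 +i* p.2)%C < r])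
    (modulus (derive1 f (p.1 +i* p.2)%C) ^+ 2)%:E.

(* Every term is nonnegative when |z| < 1 and lambda >= 0, so G is an
   unconditionally meaningful extended real; G <= 1 includes the convergence
   of the series and of the area integral. *)
Definition bohr_G (R : realType) (lambda : R) (f : cplx R -> cplx R)
    (z : cplx R) : \bar R :=
  let r := modulus z in
  let a := fun n => modulus (taylor_coef f n) in
  ((modulus (f z))%:E + (modulus (derive1 f z) * r)%:E
   + \sum_(2 <= n <oo) (a n * r ^+ n)%:E
   + ((1 + a 0%N)^-1 + r / (1 - r))%:E * \sum_(1 <= n <oo) (a n ^+ 2 * r ^+ (2 * n))%:E
   + lambda%:E * (area_S f r * (pi^-1)%:E))%E.

Definition bohr_inequality (R : realType) (lambda rho : R) :=
  forall f : cplx R -> cplx R, bounded_class f ->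
  forall z, unit_disc z -> modulus z <= rho -> (bohr_G lambda f z <= 1)%E.

Definition bohr_radius (R : realType) : R := (Num.sqrt 17 - 3) / 4.

Definition bohr_lambda (R : realType) : R := (221 - 43 * Num.sqrt 17) / 64.

Definition blaschke (R : realType) (a : R) (z : cplx R) : cplx R :=
  ((a%:C)%C - z) / (1 - (a%:C)%C * z).

(* Main.v *)
Require Import Defs.
From HB Require Import structures.
From mathcomp Require Import zify ring lra measurable_realfun.

(* Write r = |z| and A = |a_0|.  A function f of the class has a single Taylor
   expansion on the whole disc: a compactness argument gives a uniform radius
   of expansion on closed subdiscs, and the coefficients of all recentred
   series are bounded by the maximum of |f|.  Averaging over roots of unity
   yields Parseval's inequality, hence convolution with the Taylor coefficients
   is a contraction on finite sequences.  Testing this contraction gives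
   Carlson's inequalities
     |a_(2l+1)| <= 1 - |a_0|^2 - ... - |a_l|^2,
     |a_(2l)| <= 1 - |a_0|^2 - ... - |a_(l-1)|^2 - |a_l|^2 / (1 + A)
   and the two-point Pick inequality.  Carlson's inequalities bound the two
   series together by (1 - A^2) r^2 / (1 - r), and |a_n| <= 1 - A^2 bounds
   S_r / pi by (1 - A^2)^2 r^2 / (1 - r^2)^2; Schwarz-Pick bounds
   |f(z)| + r |f'(z)|.  What remains is a polynomial inequality in A at the
   radius rho with 2 rho^2 + 3 rho = 1, where (1 - A)^2 factors out.  For f_a at
   z = -r every term can be computed exactly, and letting a -> 1 shows that
   neither constant can be improved. *)

Set Implicit Arguments.
Unset Strict Implicit.
Unset Printing Implicit Defensive.

Local Open Scope classical_set_scope.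
Local Open Scope ring_scope.

(** * Complex modulus *)

Section Modulus.
Variable R : realType.
Implicit Types z w : cplx R.

(** Both constants come from the behaviour of [f_a] at [z = -r] as [a] tends to [1]. There the
    functional is [1], plus [1 - a] times a bracket over [(1 + a r)^2], plus a [lambda] term of
    order [(1 - a)^2]. The bracket at [a = 1] is a positive multiple of [2 r^2 + 3 r - 1], so [rho]
    is the radius at which the first order vanishes, and [lam] is the value at which the second
    order vanishes too. The estimates for a general [f] must therefore be sharp for [f_a] in this
    limit; this is why Carlson's inequalities, and not only [|a_n| <= 1 - A^2], are needed for the
    two series. Analyticity is given by local expansions only, so all function theory is carried by
    [has_ps]. The Pick inequality comes from the same contraction as Carlson's inequalities, applied
    to combinations of geometric sequences. The plane integral [S_r] is evaluated without polar
    coordinates: averaging over rotations by roots of unity removes the cross terms, and the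
    remaining moments follow from the area of discs. The equality clause is stated as a limit for
    [a] tending to [1] from the left. *)

Definition cre z : R := complex.Re z.
Definition cim z : R := complex.Im z.
Definition cmk (x y : R) : cplx R := (x +i* y)%C.
Definition cofr (x : R) : cplx R := (x%:C)%C.
Definition cj z : cplx R := conjc z.

Lemma cofr_is_additive : additive cofr.
Proof. by move=> x y; rewrite /cofr rmorphB. Qed.
Lemma cofr_is_multiplicative : multiplicative cofr.
Proof. by split=> [x y|]; rewrite /cofr ?rmorphM ?rmorph1. Qed.
HB.instance Definition _ := GRing.isAdditive.Build R (cplx R) cofr cofr_is_additive.
HB.instance Definition _ := GRing.isMultiplicative.Build R (cplx R) cofr cofr_is_multiplicative.

Lemma cj_is_additive : additive cj.
Proof. by move=> x y; rewrite /cj; exact: (rmorphB (@conjc R)). Qed.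
Lemma cj_is_multiplicative : multiplicative cj.
Proof. by split=> [x y|]; [exact: (rmorphM (@conjc R))|exact: (rmorph1 (@conjc R))]. Qed.
HB.instance Definition _ := GRing.isAdditive.Build (cplx R) (cplx R) cj cj_is_additive.
HB.instance Definition _ := GRing.isMultiplicative.Build (cplx R) (cplx R) cj cj_is_multiplicative.

Lemma cre_is_additive : additive cre.
Proof. by move=> [a b] [c d]. Qed.
Lemma cim_is_additive : additive cim.
Proof. by move=> [a b] [c d]. Qed.
HB.instance Definition _ := GRing.isAdditive.Build (cplx R) R cre cre_is_additive.
HB.instance Definition _ := GRing.isAdditive.Build (cplx R) R cim cim_is_additive.

Lemma cmkE z : cmk (cre z) (cim z) = z. Proof. by case: z. Qed.

Lemma normE z : `|z| = cofr (modulus z).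
Proof. by []. Qed.

Lemma modulus0 : modulus (0 : cplx R) = 0.
Proof. exact: (@ComplexField.Normc.normc0 R). Qed.
Lemma modulus1 : modulus (1 : cplx R) = 1.
Proof. exact: (@ComplexField.Normc.normc1 R). Qed.
Lemma modulusM z w : modulus (z * w) = modulus z * modulus w.
Proof. exact: ComplexField.Normc.normcM. Qed.
Lemma modulusV z : modulus z^-1 = (modulus z)^-1.
Proof. exact: ComplexField.Normc.normcV. Qed.
Lemma modulusN z : modulus (- z) = modulus z.
Proof. exact: normcN. Qed.
Lemma modulusD z w : modulus (z + w) <= modulus z + modulus w.
Proof. exact: le_normcD. Qed.
Lemma modulus_ge0 z : 0 <= modulus z.
Proof. by case: z => a b; rewrite sqrtr_ge0. Qed.
Lemma modulus_eq0 z : (modulus z == 0) = (z == 0).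
Proof.
apply/eqP/eqP => [|->]; last exact: modulus0.
exact: ComplexField.Normc.eq0_normc.
Qed.
Lemma modulusX z n : modulus (z ^+ n) = modulus z ^+ n.
Proof. by elim: n => [|n IH]; rewrite ?modulus1// !exprS modulusM IH. Qed.
Lemma modulusB z w : modulus (z - w) <= modulus z + modulus w.
Proof. by rewrite (le_trans (modulusD _ _))// modulusN. Qed.
Lemma modulusBC z w : modulus (z - w) = modulus (w - z).
Proof. by rewrite -modulusN opprB. Qed.
Lemma modulus_sum (I : Type) (s : seq I) (P : pred I) (F : I -> cplx R) :
  modulus (\sum_(i <- s | P i) F i) <= \sum_(i <- s | P i) modulus (F i).
Proof.
elim/big_rec2 : _ => [|i x y _ le_xy]; first by rewrite modulus0.
by rewrite (le_trans (modulusD _ _))// lerD2l.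
Qed.
Lemma modulus_cofr x : modulus (cofr x) = `|x|.
Proof. by rewrite /modulus /= expr0n /= addr0 sqrtr_sqr. Qed.
Lemma modulus_cj z : modulus (cj z) = modulus z.
Proof. by case: z => a b; rewrite /modulus /= sqrrN. Qed.
Lemma modulus_sqr z : modulus z ^+ 2 = cre z ^+ 2 + cim z ^+ 2.
Proof. by case: z => a b; rewrite /modulus /= sqr_sqrtr// addr_ge0 ?sqr_ge0. Qed.
Lemma cjK z : cj (cj z) = z.
Proof. exact: conjcK. Qed.
Lemma mulcj z : z * cj z = cofr (modulus z ^+ 2).
Proof.
rewrite modulus_sqr; case: z => a b; apply/eqP; rewrite eq_complex /=.
by apply/andP; split; apply/eqP; rewrite /=; ring.
Qed.
Lemma cre_le z : `|cre z| <= modulus z.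
Proof.
by rewrite -ler_sqr ?nnegrE ?modulus_ge0// real_normK ?num_real// modulus_sqr lerDl sqr_ge0.
Qed.
Lemma cim_le z : `|cim z| <= modulus z.
Proof.
by rewrite -ler_sqr ?nnegrE ?modulus_ge0// real_normK ?num_real// modulus_sqr lerDr sqr_ge0.
Qed.
Lemma modulus_le z : modulus z <= `|cre z| + `|cim z|.
Proof.
rewrite -ler_sqr ?nnegrE ?modulus_ge0 ?addr_ge0// modulus_sqr sqrrD !real_normK ?num_real//.
by rewrite lerD2r lerDl mulrn_wge0// mulr_ge0.
Qed.
Lemma creM z w : cre (z * w) = cre z * cre w - cim z * cim w.
Proof. by case: z => a b; case: w => c d. Qed.
Lemma cimM z w : cim (z * w) = cre z * cim w + cim z * cre w.
Proof. by case: z => a b; case: w => c d. Qed.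

End Modulus.

(** * Power series and recentring *)

Section Convergence.
Variable R : realType.
Implicit Types (z w : cplx R) (u : nat -> cplx R).

Lemma cofr_lt (x y : R) : (cofr x < cofr y) = (x < y).
Proof. exact: ltcR. Qed.

Lemma gt0_cofr (e : cplx R) : 0 < e -> exists2 d : R, 0 < d & e = cofr d.
Proof.
case: e => a b; rewrite ltcE /= => /andP[/eqP -> a0].
by exists a.
Qed.

(** The norm on [cplx R] takes values in [cplx R] itself, so the epsilons of its topology are
    complex. A positive one is real by [gt0_cofr], which lets all later estimates be made in [R]. *)
Lemma cvg_modulusP (T : Type) {F : set_system T} {FF : Filter F} (f : T -> cplx R) (l : cplx R) :
  f @ F --> l <-> (fun t => modulus (f t - l)) @ F --> (0 : R).
Proof.
split=> [/cvgrPdist_lt H|/cvgrPdist_lt H]; apply/cvgrPdist_lt => e e0.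
- have /H : 0 < cofr e :> cplx R by rewrite -(rmorph0 (@cofr R)) cofr_lt.
  apply: filterS => t; rewrite normE cofr_lt sub0r normrN ger0_norm ?modulus_ge0//.
  by rewrite modulusBC.
- have [d d0 ->] := gt0_cofr e0; have := H _ d0.
  apply: filterS => t; rewrite normE cofr_lt sub0r normrN ger0_norm ?modulus_ge0//.
  by rewrite modulusBC.
Qed.

Lemma ge_modulusB z w : `|modulus z - modulus w| <= modulus (z - w).
Proof.
have := modulusD (z - w) w; have := modulusD (w - z) z.
by rewrite !subrK [modulus (w - z)]modulusBC ler_norml => *; apply/andP; split; lra.
Qed.

Lemma cvg_modulus (T : Type) {F : set_system T} {FF : Filter F} (f : T -> cplx R) (l : cplx R) :
  f @ F --> l -> (fun t => modulus (f t)) @ F --> modulus l.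
Proof.
move=> /cvg_modulusP/cvgrPdist_lt H; apply/cvgrPdist_lt => e /H.
apply: filterS => t; rewrite sub0r normrN ger0_norm ?modulus_ge0//.
by apply: le_lt_trans; rewrite distrC ge_modulusB.
Qed.

Lemma cvg_cre (T : Type) {F : set_system T} {FF : Filter F} (f : T -> cplx R) (l : cplx R) :
  f @ F --> l -> (fun t => cre (f t)) @ F --> cre l.
Proof.
move=> /cvg_modulusP/cvgrPdist_lt H; apply/cvgrPdist_lt => e /H.
apply: filterS => t; rewrite sub0r normrN ger0_norm ?modulus_ge0//.
by apply: le_lt_trans; rewrite -raddfB modulusBC cre_le.
Qed.

Lemma cvg_cmk (T : Type) {F : set_system T} {FF : Filter F} (f g : T -> R) l m :
  f @ F --> l -> g @ F --> m -> (fun t => cmk (f t) (g t)) @ F --> cmk l m.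
Proof.
move=> fl gm; apply/cvg_modulusP.
have H : (fun t => `|f t - l| + `|g t - m|) @ F --> (0 : R).
  rewrite -(addr0 0); apply: cvgD.
    by rewrite -(@normr0 _ R) -(subrr l); apply: cvg_norm; apply: cvgB => //; exact: cvg_cst.
  by rewrite -(@normr0 _ R) -(subrr m); apply: cvg_norm; apply: cvgB => //; exact: cvg_cst.
apply: (squeeze_cvgr _ (@cvg_cst _ (0 : R) _ _ _) H).
by apply: nearW => t; rewrite modulus_ge0; exact: (modulus_le (cmk (f t) (g t) - cmk l m)).
Qed.

Lemma cvg_modulus_le (T : Type) {F : set_system T} {FF : ProperFilter F} (f : T -> cplx R) (l : cplx R) M :
  f @ F --> l -> (\forall t \near F, modulus (f t) <= M) -> modulus l <= M.
Proof. by move=> /cvg_modulus fl H; exact: cvgr_to_le fl H. Qed.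

Lemma ccvg_unique (T : Type) {F : set_system T} {FF : ProperFilter F} (f : T -> cplx R) (l m : cplx R) :
  f @ F --> l -> f @ F --> m -> l = m.
Proof. by move=> fl fm; exact: (cvg_unique _ fl fm). Qed.

Lemma ccvg_sum (T : Type) {F : set_system T} {FF : Filter F} I (r : seq I) (P : pred I)
    (f : I -> T -> cplx R) (l : I -> cplx R) :
  (forall i, P i -> f i @ F --> l i) ->
  (fun t => \sum_(i <- r | P i) f i t) @ F --> \sum_(i <- r | P i) l i.
Proof. by move=> H; apply: cvg_big => //; exact: add_continuous. Qed.

Lemma ccvgD (T : Type) {F : set_system T} {FF : Filter F} (f g : T -> cplx R) (l m : cplx R) :
  f @ F --> l -> g @ F --> m -> (fun t => f t + g t) @ F --> l + m.
Proof. exact: cvgD. Qed.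

Lemma ccvgB (T : Type) {F : set_system T} {FF : Filter F} (f g : T -> cplx R) (l m : cplx R) :
  f @ F --> l -> g @ F --> m -> (fun t => f t - g t) @ F --> l - m.
Proof. exact: cvgB. Qed.

Lemma ccvgM (T : Type) {F : set_system T} {FF : Filter F} (f g : T -> cplx R) (l m : cplx R) :
  f @ F --> l -> g @ F --> m -> (fun t => f t * g t) @ F --> l * m.
Proof. exact: cvgM. Qed.

Lemma ccvg_cst (T : Type) {F : set_system T} {FF : Filter F} (l : cplx R) :
  (fun _ : T => l) @ F --> l.
Proof. exact: cvg_cst. Qed.

Arguments ccvg_cst {T F FF} l.

Lemma sum_geo_le (q : R) m n : 0 <= q < 1 -> \sum_(m <= k < n) q ^+ k <= q ^+ m / (1 - q).
Proof.
move=> /andP[q0 q1]; have [mn|nm] := leqP m n; last first.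
  by rewrite big_geq ?(ltnW nm)// divr_ge0 ?exprn_ge0// subr_ge0 ltW.
rewrite ler_pdivlMr ?subr_gt0//.
elim: n mn => [|n IH]; first by rewrite leqn0 => /eqP ->; rewrite big_geq// mul0r exprn_ge0.
rewrite leq_eqVlt => /predU1P[->|]; first by rewrite big_geq// mul0r exprn_ge0.
rewrite ltnS => mn; rewrite big_nat_recr//= mulrDl.
have H : (\sum_(m <= k < n) q ^+ k) * (1 - q) = q ^+ m - q ^+ n.
  rewrite mulrC; elim: n mn {IH} => [|n IH]; first by rewrite leqn0 => /eqP ->; rewrite big_geq// mulr0 subrr.
  rewrite leq_eqVlt => /predU1P[->|]; first by rewrite big_geq// mulr0 subrr.
  by rewrite ltnS => mn; rewrite big_nat_recr//= mulrDr IH// exprS; ring.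
by rewrite H; have := exprn_ge0 n q0; nra.
Qed.

(** Completeness of [R] is enough: the real and imaginary parts converge absolutely by comparison
    with a geometric series. *)
Lemma geometric_cvg (c : nat -> cplx R) (M q : R) : 0 <= q < 1 ->
  (forall n, modulus (c n) <= M * q ^+ n) ->
  exists l : cplx R, series c @ \oo --> l.
Proof.
move=> /andP[q0 q1] H.
have H0 : cvgn (series (geometric M q)) by apply: is_cvg_geometric_series; rewrite ger0_norm.
have M0 : 0 <= M by have := H 0%N; rewrite expr0 mulr1; apply: le_trans; exact: modulus_ge0.
have aux (g : cplx R -> R) : (forall z, `|g z| <= modulus z) -> cvgn (series (g \o c)).
  move=> Hg; apply: normed_cvg; apply: series_le_cvg H0 => n /=.
  - exact: normr_ge0.
  - by rewrite mulr_ge0// exprn_ge0.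
  - exact: le_trans (Hg _) (H n).
have /cvg_ex[a Ha] := aux (@cre R) (@cre_le R).
have /cvg_ex[b Hb] := aux (@cim R) (@cim_le R).
exists (cmk a b).
have -> : series c = (fun n => cmk (series (@cre R \o c) n) (series (@cim R \o c) n)).
  apply/funext => n; rewrite /series /= -[LHS]cmkE.
  by rewrite (raddf_sum (@cre R)) (raddf_sum (@cim R)).
exact: cvg_cmk.
Qed.

Lemma geometric_tail (c : nat -> cplx R) (l : cplx R) (M q : R) K : 0 <= q < 1 ->
  (forall n, modulus (c n) <= M * q ^+ n) ->
  series c @ \oo --> l -> modulus (l - series c K) <= M * q ^+ K / (1 - q).
Proof.
move=> q01 H cl.
have M0 : 0 <= M by have := H 0%N; rewrite expr0 mulr1; apply: le_trans; exact: modulus_ge0.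
apply: (@cvg_modulus_le _ \oo _ (fun n => series c n - series c K)).
  exact: ccvgB cl (ccvg_cst _).
near=> n; have Kn : (K <= n)%N by near: n; exact: nbhs_infty_ge.
rewrite sub_series_geq// (le_trans (modulus_sum _ _ _))//.
rewrite (le_trans (ler_sum _ (fun i _ => H i)))//.
by rewrite -mulr_sumr -mulrA ler_wpM2l// sum_geo_le.
Unshelve. all: by end_near. Qed.

End Convergence.
Arguments ccvg_cst {R T F FF} l.

Section PowerSeries.
Variable R : realType.
Implicit Types (z w h c d : cplx R) (b : nat -> cplx R) (f g : cplx R -> cplx R) (s t : R).

(** [s] is any radius on which the expansion is known, not the exact radius of convergence. The
    discs are open, so the predicate passes to suprema of radii; for [s <= 0] it is vacuous. *)
Definition has_ps f c s b :=
  forall h, modulus h < s -> series (fun n => b n * h ^+ n) @ \oo --> f (c + h).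

Lemma has_ps_bound f c s b t : has_ps f c s b -> 0 <= t < s ->
  exists2 M : R, 0 <= M & forall n, modulus (b n) * t ^+ n <= M.
Proof.
move=> fb /andP[t0 ts]; have mt : modulus (cofr t) = t by rewrite modulus_cofr ger0_norm.
have /fb H : modulus (cofr t) < s by rewrite mt.
have : (fun n => b n * cofr t ^+ n) @ \oo --> (0 : cplx R).
  by apply: cvg_series_cvg_0; apply/cvg_ex; eexists; exact: H.
move=> /cvg_modulus; rewrite modulus0 => H0.
have := cvg_seq_bounded (cvgP _ H0) => -[M [Mr HM]].
exists (`|M| + 1); first by rewrite addr_ge0.
move=> n; have HM1 : M < `|M| + 1 by rewrite ltr_pwDr// ler_norm.
have /= := HM _ HM1 n I.
by rewrite modulusM modulusX mt ger0_norm// mulr_ge0 ?modulus_ge0// exprn_ge0.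
Qed.

Lemma geometric_dom b (M t x : R) n : 0 < t -> modulus (b n) * t ^+ n <= M -> 0 <= x ->
  modulus (b n) * x ^+ n <= M * (x / t) ^+ n.
Proof.
move=> t0 H x0; have tn0 : t != 0 by rewrite gt_eqF.
rewrite -[in leLHS](divfK tn0 x) exprMn mulrCA mulrC ler_wpM2r//.
by rewrite exprn_ge0// divr_ge0// ltW.
Qed.

(** The terms are bounded at the midpoint [t] of [x] and [s], which gives the ratio [q = x / t]. *)
Lemma has_ps_dom f c s b x : has_ps f c s b -> 0 <= x < s ->
  exists M q : R, [/\ 0 <= M, 0 <= q < 1 & forall n, modulus (b n) * x ^+ n <= M * q ^+ n].
Proof.
move=> fb /andP[x0 xs]; pose t := (x + s) / 2.
have t0 : 0 < t by rewrite /t; lra.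
have [|M M0 HM] := @has_ps_bound f c s b t fb; first by rewrite /t; lra.
exists M, (x / t); split=> //.
  by rewrite divr_ge0 ?(ltW t0)//= ltr_pdivrMr// mul1r /t; lra.
by move=> n; exact: geometric_dom.
Qed.

Lemma has_psW f c s t b : t <= s -> has_ps f c s b -> has_ps f c t b.
Proof. by move=> ts H h ht; apply: H; exact: lt_le_trans ts. Qed.

(** The [k]-th Taylor coefficient once the centre has moved by [d]. For [n < k] the subtraction
    truncates to [0], but then the binomial coefficient vanishes. *)
Definition recentre b d k : cplx R :=
  lim (series (fun n => 'C(n, k)%:R * b n * d ^+ (n - k)) @ \oo).

Lemma bin_term_le (x y : R) n k : 0 <= x -> 0 <= y ->
  'C(n, k)%:R * x ^+ (n - k) * y ^+ k <= (x + y) ^+ n.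
Proof.
move=> x0 y0; have [kn|nk] := leqP k n; last first.
  by rewrite bin_small// !mul0r exprn_ge0 ?addr_ge0.
rewrite exprDn (bigD1 (Ordinal (kn : (k < n.+1)%N)))//= -mulrA mulr_natl lerDl.
by apply: sumr_ge0 => i _; rewrite mulrn_wge0// mulr_ge0 ?exprn_ge0.
Qed.

(** Let [y] be half the distance left to the boundary. Multiplied by [y ^+ k], each binomial term
    becomes part of the expansion of [(modulus d + y) ^+ n], and [modulus d + y] is still less than
    [s]. *)
Lemma recentre_cvg f c s b d k : has_ps f c s b -> modulus d < s ->
  series (fun n => 'C(n, k)%:R * b n * d ^+ (n - k)) @ \oo --> recentre b d k.
Proof.
move=> fb ds; pose y := (s - modulus d) / 2.
have y0 : 0 < y by rewrite /y; lra.
have d0 := modulus_ge0 d.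
have [|M [q [M0 q01 HM]]] := @has_ps_dom f c s b (modulus d + y) fb; first by rewrite /y; lra.
have [l Hl] : exists l : cplx R, series (fun n => 'C(n, k)%:R * b n * d ^+ (n - k)) @ \oo --> l.
  apply: (@geometric_cvg _ _ (M / y ^+ k) q q01) => n.
  rewrite !modulusM modulusX -(rmorph_nat (@cofr R)) modulus_cofr ger0_norm//.
  rewrite [leRHS]mulrAC ler_pdivlMr ?exprn_gt0//; apply: le_trans (HM n).
  rewrite [_ * modulus (b n)]mulrC -2!mulrA ler_wpM2l ?modulus_ge0// mulrA.
  by apply: bin_term_le => //; exact: ltW.
by apply: (cvgP _ Hl).
Qed.

Lemma expr_bin_tail d h n K :
  modulus ((d + h) ^+ n - \sum_(k < K) 'C(n, k)%:R * d ^+ (n - k) * h ^+ k)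
  <= if (n < K)%N then 0 else (modulus d + modulus h) ^+ n.
Proof.
have E (T : comPzRingType) (x y : T) : (x + y) ^+ n = \sum_(0 <= k < n.+1) 'C(n, k)%:R * x ^+ (n - k) * y ^+ k.
  by rewrite exprDn big_mkord; apply: eq_bigr => i _; rewrite -mulrA mulr_natl.
rewrite E -(big_mkord xpredT (fun k => 'C(n, k)%:R * d ^+ (n - k) * h ^+ k)); case: ltnP => nK.
  rewrite (big_cat_nat (n := n.+1) (p := K))//= opprD addrA subrr sub0r modulusN.
  rewrite big_nat_cond big1 ?modulus0// => i /andP[/andP[ni _] _].
  by rewrite bin_small// !mul0r.
rewrite (big_cat_nat (n := K))//=; last exact: leqW.
rewrite addrAC subrr add0r (le_trans (modulus_sum _ _ _))// E [leRHS](big_cat_nat (n := K))//=; last exact: leqW.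
rewrite -[leLHS]add0r lerD//; last first.
  apply: ler_sum => i _; rewrite !modulusM !modulusX -(rmorph_nat (@cofr R)) modulus_cofr ger0_norm//.
by apply: sumr_ge0 => i _; rewrite !mulr_ge0 ?exprn_ge0 ?modulus_ge0.
Qed.

(** The double series is never rearranged as a whole. Cutting the sum over [k] at [K] leaves an
    exchange of finite sums, and the error involves only the indices [n >= K], whatever the cut [N]
    in [n]. *)
Lemma has_ps_recentre f c s b d : has_ps f c s b -> modulus d < s ->
  has_ps f (c + d) (s - modulus d) (recentre b d).
Proof.
move=> fb ds h hs.
have [|M [q [M0 q01 HM]]] := @has_ps_dom f c s b (modulus d + modulus h) fb.
  by rewrite addr_ge0 ?modulus_ge0//=; lra.
have q1 : 0 < 1 - q by move: q01 => /andP[]; lra.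
have key K : modulus (f (c + d + h) - series (fun n => recentre b d n * h ^+ n) K) <= M * q ^+ K / (1 - q).
  apply: (@cvg_modulus_le _ _ \oo _ (fun N => series (fun n => b n * (d + h) ^+ n) N -
     \sum_(0 <= k < K) series (fun n => 'C(n, k)%:R * b n * d ^+ (n - k)) N * h ^+ k)).
    apply: ccvgB.
      by rewrite -addrA; apply: fb; rewrite (le_lt_trans (modulusD _ _))//; lra.
    apply: ccvg_sum => k _; apply: ccvgM (ccvg_cst _); exact: recentre_cvg fb ds.
  apply: nearW => N; rewrite /series /=.
  under [X in _ - X]eq_bigr do rewrite mulr_suml.
  rewrite exchange_big /= -sumrB (le_trans (modulus_sum _ _ _))//.
  have -> : M * q ^+ K / (1 - q) = M * (q ^+ K / (1 - q)) by rewrite mulrA.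
  apply: (@le_trans _ _ (\sum_(0 <= n < N | (K <= n)%N) M * q ^+ n)); last first.
    rewrite -mulr_sumr ler_wpM2l//; apply: le_trans (sum_geo_le K N q01).
    by rewrite (@big_nat_widenl _ _ _ K 0).
  rewrite [leRHS]big_mkcond /=; apply: ler_sum => n _.
  have -> : b n * (d + h) ^+ n - \sum_(0 <= k < K) 'C(n, k)%:R * b n * d ^+ (n - k) * h ^+ k =
     b n * ((d + h) ^+ n - \sum_(k < K) 'C(n, k)%:R * d ^+ (n - k) * h ^+ k).
    rewrite mulrBr mulr_sumr big_mkord; congr (_ - _); apply: eq_bigr => k _.
    by rewrite !mulrA [b n * _]mulrC.
  rewrite modulusM (le_trans (ler_wpM2l (modulus_ge0 _) (expr_bin_tail _ _ _ _)))//.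
  by case: ltnP => _; rewrite ?mulr0.
apply/cvg_modulusP.
apply: (@squeeze_cvgr _ _ _ _ (fun=> 0) (fun K => M * q ^+ K / (1 - q))).
- by apply: nearW => K; rewrite modulus_ge0/= modulusBC.
- exact: cvg_cst.
- rewrite -[X in _ --> X](mul0r (1 - q)^-1); apply: cvgMr_tmp.
  by apply: (cvg_geometric M); rewrite ger0_norm; case/andP: q01.
Qed.

End PowerSeries.

(** * Parseval's inequality *)

Section Parseval.
Variable R : realType.
Implicit Types (z w h c d : cplx R) (b : nat -> cplx R) (f g : cplx R -> cplx R) (s t : R).

Lemma exists_root_N1 m : exists w : cplx R, w ^+ (2 ^ m) = -1.
Proof.
elim: m => [|m [w Hw]]; first by exists (-1); rewrite expn0 expr1.
exists (sqrtc w); rewrite expnS exprM -Hw; congr (_ ^+ _).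
exact: sqr_sqrtc.
Qed.

Lemma exists_prim_root m : exists z : cplx R, modulus z = 1 /\ (2 ^ m.+1).-primitive_root z.
Proof.
have [w Hw] := exists_root_N1 m.
have w1 : w ^+ (2 ^ m.+1) = 1 by rewrite expnS mulnC exprM Hw sqrrN expr1n.
exists w; split.
  apply/eqP; rewrite -(@pexpr_eq1 _ _ (2 ^ m.+1)) ?expn_gt0 ?modulus_ge0//.
  by rewrite -modulusX w1 modulus1.
(* The order of [w] divides a power of two, so it is [2 ^ k]; [k <= m] would give
   [w ^+ (2 ^ m) = 1], whereas this power is [-1]. *)
have [d prim_d] := prim_order_exists (expn_gt0 2 m.+1 : (0 < _)%N) w1.
move=> /dvdn_pfactor-/(_ isT)[k km dE].
have -> : m.+1 = k; last by rewrite -dE.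
apply/eqP; rewrite eqn_leq km andbT leqNgt ltnS; apply/negP => kM.
have : w ^+ (2 ^ m) = 1.
  by rewrite -(subnK kM) expnD mulnC exprM -dE (prim_expr_order prim_d) expr1n.
rewrite Hw => /eqP; rewrite eq_sym -subr_eq0 opprK -mulr2n.
by rewrite (pnatr_eq0 (cplx R) 2).
Qed.

Lemma sum_unity (N : nat) (x : cplx R) : x ^+ N = 1 -> x != 1 -> \sum_(k < N) x ^+ k = 0.
Proof.
move=> xN x1; have := subrX1 x N; rewrite xN subrr => /esym/eqP.
by rewrite mulf_eq0 subr_eq0 (negPf x1) => /eqP.
Qed.

Lemma cofrI : injective (@cofr R). Proof. exact: complexI. Qed.

(** In the expanded square, the pair [i], [j] contributes a geometric sum of ratio
    [z ^+ i * cj z ^+ j]. This ratio is an [N]-th root of unity and, since [K <= N], equals [1] only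
    for [i = j]. *)
Lemma discrete_parseval N z K (c : nat -> cplx R) x :
  N.-primitive_root z -> modulus z = 1 -> (K <= N)%N ->
  \sum_(k < N) modulus (\sum_(j < K) c j * (z ^+ k * x) ^+ j) ^+ 2 =
  N%:R * \sum_(j < K) modulus (c j) ^+ 2 * modulus x ^+ (2 * j).
Proof.
move=> zN z1 KN; apply: cofrI; rewrite rmorphM rmorph_nat !rmorph_sum /=.
have zc : z * cj z = 1 by rewrite mulcj z1 expr1n rmorph1.
transitivity (\sum_(k < N) \sum_(i < K) \sum_(j < K)
   (c i * x ^+ i * cj (c j * x ^+ j)) * (z ^+ i * cj z ^+ j) ^+ k).
  apply: eq_bigr => k _; rewrite -mulcj rmorph_sum mulr_suml /=; apply: eq_bigr => i _.
  rewrite mulr_sumr; apply: eq_bigr => j _.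
  rewrite !rmorphM !rmorphXn rmorphM rmorphXn /= !exprMn -!exprM ![(k * _)%N]mulnC; ring.
rewrite exchange_big mulr_sumr; apply: eq_bigr => i _ /=.
rewrite exchange_big (bigD1 i)//= [X in _ + X]big1 ?addr0 => [|j ji].
  rewrite -mulr_sumr -exprMn zc expr1n.
  under eq_bigr do rewrite expr1n.
  rewrite sumr_const card_ord mulcj modulusM exprMn modulusX -exprM mulnC.
  by rewrite mulrC.
rewrite -mulr_sumr sum_unity ?mulr0//.
  rewrite exprMn -!exprM !(mulnC _ N) exprM (prim_expr_order zN) expr1n mul1r.
  by rewrite exprM -rmorphXn (prim_expr_order zN) rmorph1 expr1n.
apply/negP => /eqP zij.
have : z ^+ i == z ^+ j.
  rewrite -[z ^+ i]mulr1 -(expr1n _ j) -zc mulrC exprMn -mulrA [_ ^+ j * z ^+ i]mulrC zij mulr1.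
  by [].
rewrite (eq_prim_root_expr zN) !modn_small ?(leq_trans (ltn_ord _) KN)//.
by move=> /eqP/val_inj/eqP; rewrite eq_sym (negPf ji).
Qed.

Lemma cvg_geo0 (A q : R) : 0 <= q < 1 -> (fun n => A * q ^+ n) @ \oo --> (0 : R).
Proof. by move=> /andP[q0 q1]; apply: (cvg_geometric A); rewrite ger0_norm. Qed.

(* Averaging over roots of unity of order a power of two, which square roots
   alone provide, replaces integration over circles. *)
Lemma parseval_le g c s b L (p : nat -> cplx R) (rho : R) K :
  has_ps g c s b -> 0 <= rho < s ->
  (forall u, modulus u = rho -> modulus (g (c + u)) <= modulus (\sum_(j < L) p j * u ^+ j)) ->
  \sum_(k < K) modulus (b k) ^+ 2 * rho ^+ (2 * k) <=
  \sum_(j < L) modulus (p j) ^+ 2 * rho ^+ (2 * j).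
Proof.
move=> gb rhos gp; have [M [q [M0 q01 HM]]] := has_ps_dom gb rhos.
have rho0 : 0 <= rho by case/andP: rhos.
have q1 : 0 < 1 - q by move: q01 => /andP[]; lra.
pose eps n := M * q ^+ n / (1 - q).
have eps0 n : 0 <= eps n by rewrite /eps divr_ge0 ?mulr_ge0 ?exprn_ge0//; [case/andP: q01|lra].
have epscv : eps @ \oo --> (0 : R).
  by rewrite -[X in _ --> X](mul0r (1 - q)^-1); apply: cvgMr_tmp; exact: cvg_geo0.
pose B := M / (1 - q).
(* Truncating [g] after [n] terms costs [eps n] pointwise. The values of [g] are at most [B] in
   modulus, so after squaring the cost is at most [(2 * B + 3 * eps n) * eps n]. *)
have key n : \sum_(k < n) modulus (b k) ^+ 2 * rho ^+ (2 * k) <=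
  \sum_(j < L) modulus (p j) ^+ 2 * rho ^+ (2 * j) + (2 * B + 3 * eps n) * eps n.
  pose m := maxn n L; have [z [z1 zN]] := exists_prim_root m.
  set N := (2 ^ m.+1)%N in zN.
  have mN : (m <= N)%N by rewrite ltnW// (leq_trans (ltnSn _))// ltnW// ltn_expl.
  have N0 : 0 < N%:R :> R by rewrite ltr0n expn_gt0.
  have mr : modulus (cofr rho) = rho by rewrite modulus_cofr ger0_norm.
  have zr k : modulus (z ^+ k * cofr rho) = rho by rewrite modulusM modulusX z1 expr1n mul1r.
  have := discrete_parseval b (cofr rho) zN z1 (leq_trans (leq_maxl n L) mN).
  have := discrete_parseval p (cofr rho) zN z1 (leq_trans (leq_maxr n L) mN).
  rewrite mr => Ep Eb; rewrite -(ler_pM2l N0) mulrDr -Ep -Eb.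
  rewrite [N%:R * (_ * _)](_ : _ = \sum_(k < N) (2 * B + 3 * eps n) * eps n); last first.
    by rewrite sumr_const card_ord mulr_natl.
  rewrite -big_split /=; apply: ler_sum => k _.
  set u := z ^+ k * cofr rho; have ur : modulus u = rho := zr k.
  have Hg := gp u ur.
  set P := modulus (\sum_(j < L) _) in Hg *.
  have dom i : modulus (b i * u ^+ i) <= M * q ^+ i by rewrite modulusM modulusX ur.
  have us : modulus u < s by rewrite ur; case/andP: rhos.
  have Hn := geometric_tail n q01 dom (gb u us).
  have H0 := geometric_tail 0 q01 dom (gb u us).
  rewrite /series /= big_geq// subr0 expr0 mulr1 -/B in H0.
  rewrite /series /= big_mkord -/(eps n) in Hn.
  set S := \sum_(i < n) _ in Hn *.
  have HS : modulus S <= modulus (g (c + u)) + eps n.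
    have := modulusB (g (c + u)) (g (c + u) - S).
    by rewrite opprB addrC subrK; lra.
  have S0 := modulus_ge0 S; have g0 := modulus_ge0 (g (c + u)); have e0 := eps0 n.
  have P0 : 0 <= P := modulus_ge0 _.
  have : modulus S ^+ 2 <= (modulus (g (c + u)) + eps n) ^+ 2.
    by rewrite ler_sqr ?nnegrE ?addr_ge0.
  have : modulus (g (c + u)) ^+ 2 <= P ^+ 2 by rewrite ler_sqr ?nnegrE.
  have : 0 <= (B - modulus (g (c + u))) * eps n by rewrite mulr_ge0//; lra.
  have : 0 <= eps n ^+ 2 by rewrite sqr_ge0.
  nra.
have lim_rhs : (fun n => \sum_(j < L) modulus (p j) ^+ 2 * rho ^+ (2 * j) + (2 * B + 3 * eps n) * eps n)
    @ \oo --> \sum_(j < L) modulus (p j) ^+ 2 * rho ^+ (2 * j).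
  rewrite -[X in _ --> X]addr0; apply: cvgD; first exact: cvg_cst.
  rewrite -[X in _ --> X](mulr0 (2 * B + 3 * 0)); apply: cvgM => //.
  by apply: cvgD; [exact: cvg_cst|apply: cvgM => //; exact: cvg_cst].
apply: (cvgr_to_ge lim_rhs); near=> n; apply: le_trans (key n).
have Kn : (K <= n)%N by near: n; exact: nbhs_infty_ge.
rewrite -!(big_mkord xpredT (fun k => modulus (b k) ^+ 2 * rho ^+ (2 * k))).
rewrite [leRHS](big_cat_nat (n := K))//= lerDl sumr_ge0// => i _.
by rewrite mulr_ge0 ?exprn_ge0// modulus_ge0.
Unshelve. all: by end_near. Qed.

(** Cauchy's estimate, as a single term of Parseval's inequality against the constant polynomial
    [M]. *)
Lemma coef_le_lt g c s b M (rho : R) n : has_ps g c s b -> 0 <= rho < s ->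
  (forall u, modulus u < s -> modulus (g (c + u)) <= M) -> modulus (b n) * rho ^+ n <= M.
Proof.
move=> gb rhos gM; have s0 : 0 < s by case/andP: rhos => ? ?; lra.
have M0 : 0 <= M by apply: le_trans (gM 0 _); rewrite ?modulus0// modulus_ge0.
have rho0 : 0 <= rho by case/andP: rhos.
have gM1 u : modulus u = rho ->
    modulus (g (c + u)) <= modulus (\sum_(j < 1) cofr M * u ^+ j).
  move=> ur; rewrite big_ord1 expr0 mulr1 modulus_cofr ger0_norm//.
  by apply: gM; rewrite ur; case/andP: rhos.
have := @parseval_le g c s b 1 (fun=> cofr M) rho n.+1 gb rhos gM1.
rewrite big_ord1 muln0 expr0 mulr1 modulus_cofr (ger0_norm M0) big_ord_recr /= => H.
rewrite -ler_sqr ?nnegrE// ?mulr_ge0 ?modulus_ge0 ?exprn_ge0//.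
rewrite exprMn -exprM mulnC; apply: le_trans H; rewrite lerDr sumr_ge0// => i _.
by rewrite mulr_ge0 ?exprn_ge0// modulus_ge0.
Qed.

Lemma ler_exprn_lim (C M s : R) n : 0 < s ->
  (forall rho, 0 <= rho < s -> C * rho ^+ n <= M) -> C * s ^+ n <= M.
Proof.
move=> s0 H; have lim_lhs : (fun x => C * x ^+ n) @ s^'- --> C * s ^+ n.
  apply: cvg_at_left_filter; apply: cvgM; first exact: cvg_cst.
  exact: exprn_continuous.
apply: (cvgr_to_le lim_lhs); near=> x; apply: H; apply/andP; split; last by near: x; exact: nbhs_left_lt.
by near: x; exact: nbhs_left_ge.
Unshelve. all: by end_near. Qed.

Lemma coef_le g c s b M n : 0 < s -> has_ps g c s b ->
  (forall u, modulus u < s -> modulus (g (c + u)) <= M) -> modulus (b n) * s ^+ n <= M.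
Proof. by move=> s0 gb gM; apply: ler_exprn_lim => // rho rhos; exact: coef_le_lt gb rhos gM. Qed.

Lemma has_psB f g c s b b' : has_ps f c s b -> has_ps g c s b' ->
  has_ps (fun z => f z - g z) c s (fun n => b n - b' n).
Proof.
move=> fb gb' h hs.
rewrite (_ : series _ = (fun n => series (fun n => b n * h ^+ n) n - series (fun n => b' n * h ^+ n) n)).
  exact: ccvgB (fb h hs) (gb' h hs).
apply/funext => n; rewrite /series /= -sumrB.
by apply: eq_bigr => i _; rewrite mulrBl.
Qed.

Lemma has_ps_eq f g c s b : (forall h, modulus h < s -> f (c + h) = g (c + h)) ->
  has_ps f c s b -> has_ps g c s b.
Proof. by move=> fg fb h hs; rewrite -fg//; exact: fb. Qed.

(** Cauchy's estimate with bound [0], applied to the difference of the two expansions on the smaller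
    disc. *)
Lemma has_ps_unique f c s s' b b' : 0 < s -> 0 < s' ->
  has_ps f c s b -> has_ps f c s' b' -> b =1 b'.
Proof.
move=> s0 s'0 fb fb' n; pose t := Num.min s s'.
have t0 : 0 < t by rewrite lt_min s0.
have := has_psB (has_psW _ fb : has_ps f c t b) (has_psW _ fb' : has_ps f c t b').
rewrite /t ge_min lexx => /(_ isT); rewrite ge_min lexx orbT => /(_ isT) H.
have : modulus (b n - b' n) * t ^+ n <= 0.
  by apply: (coef_le n t0 H) => u _; rewrite subrr modulus0.
rewrite pmulr_lle0 ?exprn_gt0// => H0; apply/eqP; rewrite -subr_eq0 -modulus_eq0.
by rewrite eq_le H0 modulus_ge0.
Qed.

End Parseval.

(** * Extension of the Taylor series to the disc *)

Section Extension.
Variable R : realType.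
Implicit Types (z w h c d : cplx R) (b : nat -> cplx R) (f g : cplx R -> cplx R) (s t : R).

Lemma bernoulli_le (x : R) n : 0 <= x -> 1 + n%:R * x <= (1 + x) ^+ n.
Proof.
move=> x0; elim: n => [|n IH]; first by rewrite mul0r addr0 expr0.
rewrite exprS; apply: (@le_trans _ _ ((1 + x) * (1 + n%:R * x))).
  rewrite -natr1; have : 0 <= n%:R * x * x :> R by rewrite !mulr_ge0.
  lra.
by rewrite ler_wpM2l// addr_ge0.
Qed.

(** The linear factor is absorbed by a slightly larger ratio: Bernoulli bounds [(1 + x) ^+ n] from
    below by [1 + n x], and [x] is half of [1 - q], so that [q * (1 + x)] stays below [1]. *)
Lemma linear_geometric (q : R) : 0 <= q < 1 ->
  exists M q' : R, 0 <= q' < 1 /\ forall n, n.+1%:R * q ^+ n <= M * q' ^+ n.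
Proof.
move=> /andP[q0 q1]; pose x := (1 - q) / 2; have x0 : 0 < x by rewrite /x; lra.
exists x^-1, (q * (1 + x)); split.
  have : q * x <= 1 * x by rewrite ler_wpM2r//; lra.
  have : 0 <= q * x by rewrite mulr_ge0// ltW.
  have xE : x = (1 - q) / 2 by [].
  by rewrite mulrDr mulr1 => *; apply/andP; split; lra.
move=> n; rewrite exprMn mulrCA mulrC ler_wpM2l ?exprn_ge0//.
rewrite ler_pdivlMl//; apply: le_trans (bernoulli_le n (ltW x0)).
by rewrite -natr1 mulrDr mulr1 mulrC addrC lerD2r /x; lra.
Qed.

Lemma has_ps_bounded_coef (a : nat -> cplx R) s (M : R) : 0 < s ->
  (forall n, modulus (a n) * s ^+ n <= n.+1%:R * M) ->
  exists f, has_ps f 0 s a.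
Proof.
move=> s0 H; exists (fun z => lim (series (fun n => a n * z ^+ n) @ \oo)) => h hs.
rewrite add0r; have M0 : 0 <= M.
  by have := H 0%N; rewrite expr0 mulr1 mul1r; apply: le_trans; exact: modulus_ge0.
have q01 : 0 <= modulus h / s < 1.
  by rewrite divr_ge0 ?modulus_ge0 ?ltW//= ltr_pdivrMr// mul1r.
have [M' [q' [q'01 H']]] := linear_geometric q01.
have [l Hl] : exists l : cplx R, series (fun n => a n * h ^+ n) @ \oo --> l.
  apply: (@geometric_cvg _ _ (M * M') q' q'01) => n.
  rewrite modulusM modulusX.
  apply: le_trans (geometric_dom s0 (H n) (modulus_ge0 h)) _.
  by rewrite mulrAC mulrC -mulrA ler_wpM2l.
by apply: (cvgP _ Hl).
Qed.

(** This is the series of [recentre_cvg] read as a series in [d]: its first [n] terms vanish and the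
    others are shifted by [n]. *)
Lemma recentre_has_ps f s a n : has_ps f 0 s a ->
  has_ps (fun d => recentre a d n) 0 s (fun m => 'C(m + n, n)%:R * a (m + n)%N).
Proof.
move=> fa d ds; rewrite add0r; have := @recentre_cvg _ f 0 s a d n fa ds.
rewrite -(cvg_shiftn n).
rewrite (_ : [sequence _]_m = series (fun m => 'C(m + n, n)%:R * a (m + n)%N * d ^+ m))//.
apply/funext => m; rewrite /series /= addnC (big_cat_nat (n := n))//= ?leq_addr//.
rewrite big_nat_cond big1 ?add0r; last first.
  by move=> i /andP[/andP[_ ni] _]; rewrite bin_small// !mul0r.
rewrite -[X in \sum_(X <= _ < _) _](add0n n) big_addn addKn.
by apply: eq_bigr => i _; rewrite addnK.
Qed.

(* For fixed [n] the [n]-th recentred coefficient is itself a power series in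
   the centre, bounded by [delta ^- n]; summing the resulting bounds on [a m]
   against [delta ^+ n] gives [modulus (a m) * (rho + delta) ^+ m <= m + 1]. *)
Lemma has_ps_extend f a rho delta : 0 < rho -> 0 < delta -> has_ps f 0 rho a ->
  (forall c, modulus c < rho -> exists b, has_ps f c delta b) ->
  (forall z, modulus z < rho + delta -> modulus (f z) <= 1) ->
  has_ps f 0 (rho + delta) a.
Proof.
move=> r0 d0 fa loc f1.
have fc c : modulus c < rho -> has_ps f c delta (recentre a c).
  move=> cr; have [b fb] := loc c cr.
  have H := has_ps_recentre fa cr; rewrite add0r in H.
  have E : b =1 recentre a c by apply: has_ps_unique d0 _ fb H; rewrite subr_gt0.
  by rewrite (_ : recentre a c = b)//; apply/funext => n; rewrite E.
have coef c n : modulus c < rho -> modulus (recentre a c n) <= (delta ^+ n)^-1.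
  move=> cr; rewrite -[leRHS]mul1r ler_pdivlMr ?exprn_gt0//.
  apply: coef_le d0 (fc c cr) _ => u ud; apply: f1.
  by rewrite (le_lt_trans (modulusD _ _))// ltrD.
have coef2 n m : 'C(m + n, n)%:R * modulus (a (m + n)%N) * rho ^+ m <= (delta ^+ n)^-1.
  have := @coef_le _ (fun d => recentre a d n) 0 rho _ (delta ^+ n)^-1 m r0 (@recentre_has_ps f rho a n fa).
  rewrite modulusM -(rmorph_nat (@cofr R)) modulus_cofr ger0_norm//; apply.
  by move=> u ur; rewrite add0r; exact: coef.
have coef3 m : modulus (a m) * (rho + delta) ^+ m <= m.+1%:R * 1.
  rewrite exprDn mulr_sumr; apply: (@le_trans _ _ (\sum_(i < m.+1) 1)); last first.
    by rewrite sumr_const card_ord mulr1.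
  apply: ler_sum => i _; have im : (i <= m)%N by rewrite -ltnS.
  have := coef2 i (m - i)%N; rewrite subnK// -[leRHS]mul1r ler_pdivlMr ?exprn_gt0//.
  apply: le_trans; rewrite -mulr_natl [leLHS](_ : _ = 'C(m, i)%:R * modulus (a m) * rho ^+ (m - i) * delta ^+ i)//.
  ring.
have [S Sa] := has_ps_bounded_coef (addr_gt0 r0 d0) coef3.
move=> z zs; rewrite add0r; have := Sa z zs; rewrite add0r.
suff -> : S z = f z by [].
(* To see that the sum [S] agrees with [f] beyond [rho], the point [z] is split proportionally into
   a centre [c] in the disc of radius [rho] and an increment [h] smaller than [delta]. Around [c]
   both functions have the coefficients [recentre a c]. *)
pose t := rho / (rho + delta).
have rd0 : 0 < rho + delta by rewrite addr_gt0.
have tE : 1 - t = delta / (rho + delta) by rewrite /t; field; rewrite gt_eqF.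
have t0 : 0 < t by rewrite divr_gt0.
pose c := cofr t * z; pose h := cofr (1 - t) * z.
have zE : z = c + h by rewrite /c /h -mulrDl -rmorphD addrCA subrr addr0 rmorph1 mul1r.
have mz0 := modulus_ge0 z.
have cm : modulus c = t * modulus z by rewrite modulusM modulus_cofr ger0_norm ?ltW.
have hm : modulus h = (1 - t) * modulus z.
  by rewrite modulusM modulus_cofr ger0_norm// tE divr_ge0// ltW.
have cr : modulus c < rho by rewrite cm /t mulrAC ltr_pdivrMr// ltr_pM2l.
have hd : modulus h < delta by rewrite hm tE mulrAC ltr_pdivrMr// ltr_pM2l.
have cs : modulus c < rho + delta by rewrite (lt_trans cr)// ltrDl.
have := has_ps_recentre Sa cs; rewrite add0r => /(_ h) H.
rewrite zE; apply: ccvg_unique (H _) (fc c cr h hd).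
by rewrite cm hm; lra.
Qed.

Lemma analytic_has_ps f z0 : analytic_at f z0 -> exists s b, 0 < s /\ has_ps f z0 s b.
Proof.
move=> [b /nbhs_normP[e /gt0_cofr[d d0 ->] H]]; exists d, b; split=> // h hd.
have := H (z0 + h); rewrite [z0 + h - z0]addrC addKr; apply.
by rewrite /ball_ /= opprD addNKr normrN normE cofr_lt.
Qed.

Lemma has_ps_analytic f z0 s b : 0 < s -> has_ps f z0 s b -> analytic_at f z0.
Proof.
move=> s0 H; exists b; apply/nbhs_normP; exists (cofr s).
  by rewrite /= -(rmorph0 (@cofr R)) cofr_lt.
move=> z /=; rewrite -normrN opprB normE cofr_lt => zs.
by have := H _ zs; rewrite [z0 + _]addrC subrK.
Qed.

(** The compact set is the square [[-1, 1] x [-1, 1]], which contains every centre concerned; near a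
    point off the closed disc of radius [rho], the property [P] is vacuous. *)
Lemma uniform_radius f rho : rho < 1 -> (forall z, unit_disc z -> analytic_at f z) ->
  exists2 delta : R, 0 < delta & forall c, modulus c <= rho -> exists b, has_ps f c delta b.
Proof.
move=> r1 fan.
have cpt : compact (`[-1, 1]%classic `*` `[-1, 1]%classic : set (R * R)).
  by apply: compact_setX; exact: segment_compact.
move: cpt => /compact_near_coveringP.
pose P (delta : R) (p : R * R) := modulus (cmk p.1 p.2) <= rho ->
  exists b, has_ps f (cmk p.1 p.2) delta b.
move=> /(_ R (0^'+) P _) cover.
have cmk_cvg (p : R * R) : (fun p' : R * R => cmk p'.1 p'.2) @ p --> cmk p.1 p.2.
  by apply: cvg_cmk; [exact: cvg_fst|exact: cvg_snd].
have loc (p : R * R) (e : R) : 0 < e -> \forall p' \near p, modulus (cmk p'.1 p'.2 - cmk p.1 p.2) < e.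
  by move=> e0; have /cvg_modulusP/cvgr_lt := cmk_cvg p; exact.
have {}cover : \forall delta \near 0^'+, (`[-1, 1]%classic `*` `[-1, 1]%classic : set (R * R)) `<=` P delta.
  apply: cover => p _; have [pr|rp] := leP (modulus (cmk p.1 p.2)) rho.
    have [s [b [s0 Hb]]] := analytic_has_ps (fan _ (le_lt_trans pr r1)).
    (* The centre moves by less than [s / 2], so recentring leaves a radius of at least [s / 2]. *)
    have s20 : 0 < s / 2 by rewrite divr_gt0.
    exists ([set p' | modulus (cmk p'.1 p'.2 - cmk p.1 p.2) < s / 2], [set e | e < s / 2]).
      by split; [exact: loc|exact: nbhs_right_lt].
    move=> [p' e] /= [Hp' He] _.
    have {}Hp' : modulus (cmk p'.1 p'.2 - cmk p.1 p.2) < s / 2 := Hp'.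
    have {}He : e < s / 2 := He.
    have Hs : modulus (cmk p'.1 p'.2 - cmk p.1 p.2) < s by lra.
    have := has_ps_recentre Hb Hs; rewrite subrKC => H.
    by eexists; apply: has_psW H; lra.
  exists ([set p' | modulus (cmk p'.1 p'.2 - cmk p.1 p.2) < modulus (cmk p.1 p.2) - rho], setT).
    by split; [apply: loc; rewrite subr_gt0|exact: filterT].
  move=> [p' e] /= [Hp' _] Hr; exfalso.
  have {}Hp' : modulus (cmk p'.1 p'.2 - cmk p.1 p.2) < modulus (cmk p.1 p.2) - rho := Hp'.
  have := ge_modulusB (cmk p'.1 p'.2) (cmk p.1 p.2).
  by rewrite ler_norml => /andP[]; lra.
have {}cover : \forall delta \near 0^'+, 0 < delta /\ forall c, modulus c <= rho -> exists b, has_ps f c delta b.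
  near=> delta; split; first by near: delta; exact: nbhs_right_gt.
  move=> c cr; rewrite -(cmkE c).
  have Hd : (`[-1, 1]%classic `*` `[-1, 1]%classic : set (R * R)) `<=` P delta by near: delta.
  apply: (Hd (cre c, cim c)); last by move: cr; rewrite -{1}(cmkE c).
  have := cre_le c; have := cim_le c; rewrite !ler_norml => /andP[? ?] /andP[? ?].
  by split => /=; rewrite in_itv /=; apply/andP; split; lra.
have [delta [d0 Hd]] := filter_ex cover.
by exists delta.
Unshelve. all: by end_near. Qed.

(** The supremum of the set [E] of admissible radii is itself admissible, the discs being open. If
    it were below [1], the uniform radius on the closed disc of radius [sup E] would extend the
    expansion strictly beyond it. *)
Lemma bounded_class_has_ps f : bounded_class f -> exists a, has_ps f 0 1 a.
Proof.
move=> [fan f1].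
have [s [a [s0 fa]]] : exists s b, 0 < s /\ has_ps f 0 s b.
  by apply: analytic_has_ps; apply: fan; rewrite /unit_disc /mkset modulus0.
exists a; pose E := [set x | 0 < x <= 1 /\ has_ps f 0 x a].
have E0 : E !=set0.
  exists (Num.min s 1); split; first by rewrite lt_min s0 ltr01 ge_min lexx orbT.
  by apply: has_psW fa; rewrite ge_min lexx.
have Eub : ubound E 1 by move=> x [/andP[]].
have Esup : has_sup E by split => //; exists 1.
have sup1 : sup E <= 1 by apply: ge_sup.
have sup0 : 0 < sup E.
  have [x Ex] := E0; have := ub_le_sup Esup.2 Ex.
  by apply: lt_le_trans; case: Ex => /andP[].
have Hsup : has_ps f 0 (sup E) a.
  by move=> h hE; have [x [_ Hx] hx] := sup_gt E0 hE; exact: Hx.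
have [E1|supN] := eqVneq (sup E) 1; first by move: Hsup; rewrite E1.
have sup_lt1 : sup E < 1 by rewrite lt_neqAle supN.
have [delta d0 Hd] := uniform_radius sup_lt1 fan.
pose e := Num.min delta (1 - sup E).
have e0 : 0 < e by rewrite lt_min d0 subr_gt0.
have : E (sup E + e).
  split.
    rewrite addr_gt0//=; have : e <= 1 - sup E by rewrite /e ge_min lexx orbT.
    lra.
  apply: has_ps_extend => //.
    move=> c cr; have [b Hb] := Hd c (ltW cr); exists b.
    by apply: has_psW Hb; rewrite /e ge_min lexx.
  move=> z zs; apply: f1; rewrite /unit_disc /mkset; apply: lt_le_trans zs _.
  have : e <= 1 - sup E by rewrite /e ge_min lexx orbT.
  lra.
move=> /(ub_le_sup Esup.2); lra.
Qed.

End Extension.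

(** * Carlson's coefficient inequalities *)

Section Contraction.
Variable R : realType.
Implicit Types (z w h c d : cplx R) (a b q : nat -> cplx R) (f g : cplx R -> cplx R) (s t : R).

Definition conv a q k : cplx R := \sum_(j < k.+1) a (k - j)%N * q j.

Lemma has_ps_sum n (F : 'I_n -> cplx R -> cplx R) c s (B : 'I_n -> nat -> cplx R) :
  (forall i, has_ps (F i) c s (B i)) ->
  has_ps (fun z => \sum_i F i z) c s (fun k => \sum_i B i k).
Proof.
move=> H h hs.
rewrite (_ : series _ = (fun n => \sum_i series (fun k => B i k * h ^+ k) n)).
  by apply: ccvg_sum => i _; exact: H.
apply/funext => m; rewrite /series /= exchange_big /=.
by apply: eq_bigr => k _; rewrite mulr_suml.
Qed.

Lemma has_ps_mulXn f s a l x : has_ps f 0 s a ->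
  has_ps (fun z => x * z ^+ l * f z) 0 s (fun k => if (l <= k)%N then a (k - l)%N * x else 0).
Proof.
move=> fa h hs; rewrite add0r.
have H : (fun n => x * h ^+ l * series (fun n => a n * h ^+ n) n) @ \oo --> x * h ^+ l * f h.
  by apply: ccvgM; [exact: ccvg_cst|have := fa h hs; rewrite add0r].
rewrite -(cvg_shiftn l) (_ : [sequence _]_k = (fun n => x * h ^+ l * series (fun n => a n * h ^+ n) n)); first exact: H.
apply/funext => m; rewrite /series /= addnC (big_cat_nat (n := l))//= ?leq_addr//.
rewrite big_nat_cond big1 ?add0r; last first.
  by move=> i /andP[/andP[_ il] _]; rewrite leqNgt il mul0r.
rewrite -[X in \sum_(X <= _ < _) _](add0n l) big_addn addKn mulr_sumr.
by apply: eq_bigr => i _; rewrite leq_addl addnK exprD; ring.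
Qed.

(** Let [Q] be the polynomial with coefficients [q]. On circles of radius [rho < 1] one has
    [|f Q| <= |Q|]; Parseval's inequality applies to this product, and then [rho] tends to [1]. *)
Lemma contraction f a q K : has_ps f 0 1 a ->
  (forall z, unit_disc z -> modulus (f z) <= 1) ->
  \sum_(k < K) modulus (conv a q k) ^+ 2 <= \sum_(k < K) modulus (q k) ^+ 2.
Proof.
move=> fa f1.
have H := @has_ps_sum K _ 0 1 _ (fun i => @has_ps_mulXn f 1 a i (q i) fa).
have key (rho : R) : 0 <= rho < 1 ->
    \sum_(k < K) modulus (conv a q k) ^+ 2 * rho ^+ (2 * k) <= \sum_(k < K) modulus (q k) ^+ 2.
  move=> rho1; have H1 u : modulus u = rho ->
      modulus (\sum_(i < K) q i * (0 + u) ^+ i * f (0 + u)) <= modulus (\sum_(j < K) q j * u ^+ j).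
    move=> ur; rewrite add0r -mulr_suml modulusM ler_piMr ?modulus_ge0//.
    by apply: f1; rewrite /unit_disc /mkset ur; case/andP: rho1.
  have convK (k : 'I_K) : \sum_(i < K) (if (i <= k)%N then a (k - i)%N * q i else 0) = conv a q k.
    by rewrite -big_mkcond /conv (big_ord_widen K (fun j => a (k - j)%N * q j) (ltn_ord k)).
  have := parseval_le K H rho1 H1.
  under eq_bigr => k _ do rewrite convK.
  move/le_trans; apply; apply: ler_sum => k _.
  rewrite ler_piMr ?exprn_ge0 ?modulus_ge0// exprn_ile1//; first by case/andP: rho1.
  by case/andP: rho1 => _ /ltW.
have lim_lhs : (fun rho : R => \sum_(k < K) modulus (conv a q k) ^+ 2 * rho ^+ (2 * k)) @ 1^'-
    --> \sum_(k < K) modulus (conv a q k) ^+ 2.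
  rewrite [X in _ --> X](_ : _ = \sum_(k < K) modulus (conv a q k) ^+ 2 * 1 ^+ (2 * k)); last first.
    by apply: eq_bigr => k _; rewrite expr1n mulr1.
  apply: cvg_at_left_filter; apply: cvg_big => [|k _]; first exact: add_continuous.
  apply: cvgM; [exact: cvg_cst|exact: exprn_continuous].
apply: (cvgr_to_le lim_lhs); near=> rho; apply: key; apply/andP; split.
  by near: rho; exact: nbhs_left_ge.
by near: rho; exact: nbhs_left_lt.
Unshelve. all: by end_near. Qed.

Lemma sum_delta (F : nat -> R) n l : (l < n)%N ->
  \sum_(k < n) (if k == l :> nat then F k else 0) = F l.
Proof.
move=> ln; rewrite (bigD1 (Ordinal ln))//= eqxx big1 ?addr0// => i.
by rewrite -val_eqE /= => /negPf ->.
Qed.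

(* Test sequence: [1] at [0], [y] at [l], and a multiple [s] of the reversed
   conjugated coefficients above [l], which align in the [N]-th convolution. *)
Lemma contraction_test a (y s : cplx R) l N (Q : R) :
  Q = \sum_(k < N - l) modulus (a k) ^+ 2 ->
  (forall q K, \sum_(k < K) modulus (conv a q k) ^+ 2 <= \sum_(k < K) modulus (q k) ^+ 2) ->
  (l < N)%N -> (l = 0%N -> y = 0) ->
  \sum_(k < l) modulus (a k) ^+ 2 + modulus (a l + a 0%N * y) ^+ 2
   + modulus (a N + a (N - l)%N * y + s * cofr Q) ^+ 2
  <= 1 + modulus y ^+ 2 + modulus s ^+ 2 * Q.
Proof.
move=> defQ contr lN yl.
pose q i : cplx R := (if i == 0%N then 1 else 0) + (if i == l then y else 0)
  + (if (l < i)%N then s * cj (a (N - i)%N) else 0).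
have QE : \sum_(k < N.+1) (if (l < k)%N then modulus (a (N - k)%N) ^+ 2 else 0) = Q.
  rewrite -(big_mkord xpredT (fun k => if (l < k)%N then modulus (a (N - k)%N) ^+ 2 else 0)).
  have lN1 : (l.+1 <= N.+1)%N by rewrite ltnS ltnW.
  rewrite (big_cat_nat (leq0n l.+1) lN1)/= big_nat_cond big1 ?add0r; last first.
    by move=> i /andP[/andP[_ il] _]; rewrite ltnNge -ltnS il.
  rewrite big_nat_rev /= defQ -(big_mkord xpredT (fun k => modulus (a k) ^+ 2)).
  rewrite -{1}(add0n l.+1) big_addn subSS big_nat_cond [RHS]big_nat_cond; apply: eq_bigr => i.
  rewrite andbT /= => iN.
  have -> : (l.+1 + N.+1 - (i + l.+1).+1 = N - i)%N by lia.
  have -> : (l < N - i)%N by lia.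
  by rewrite subKn//; lia.
have := contr q N.+1.
have -> : \sum_(k < N.+1) modulus (q k) ^+ 2 = 1 + modulus y ^+ 2 + modulus s ^+ 2 * Q.
  rewrite -QE mulr_sumr -(@sum_delta (fun=> 1) N.+1 0)//.
  rewrite -(@sum_delta (fun=> modulus y ^+ 2) N.+1 l) ?ltnS ?(ltnW lN)// -!big_split /=.
  apply: eq_bigr => k _; rewrite /q.
  have [lk|kl] := ltnP l k.
    by rewrite !gtn_eqF ?(leq_trans _ lk)// !add0r modulusM modulus_cj exprMn.
  rewrite mulr0 !addr0; have [k0|k0] := eqVneq (k : nat) 0%N.
    have [kl0|_] := eqVneq (k : nat) l; last by rewrite !addr0 modulus1 expr1n.
    by rewrite yl -?kl0// !addr0 modulus1 modulus0 expr0n/= expr1n addr0.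
  by rewrite !add0r; case: ifP; rewrite ?modulus0 ?expr0n.
apply: le_trans.
have convE k : conv a q k = a k + (if (l <= k)%N then a (k - l)%N * y else 0)
   + \sum_(j < k.+1) (if (l < j)%N then a (k - j)%N * (s * cj (a (N - j)%N)) else 0).
  rewrite /conv /q; under eq_bigr do rewrite mulrDr mulrDr.
  rewrite !big_split /=; congr (_ + _ + _).
  - rewrite big_ord_recl /= subn0 mulr1 big1 ?addr0// => i _.
    by rewrite /= mulr0.
  - case: leqP => lk.
      rewrite (bigD1 (Ordinal (lk : (l < k.+1)%N)))//= eqxx big1 ?addr0// => i.
      by rewrite -val_eqE /= => /negPf ->; rewrite mulr0.
    rewrite big1// => i _; rewrite ltn_eqF ?mulr0//.
    by rewrite (leq_ltn_trans _ lk)// -ltnS.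
  - by apply: eq_bigr => i _; case: ifP => //; rewrite mulr0.
have conv_le k : (k <= l)%N -> conv a q k = a k + (if (l <= k)%N then a (k - l)%N * y else 0).
  move=> kl; rewrite convE [X in _ + X]big1 ?addr0// => i _.
  by rewrite ltnNge (leq_trans _ kl)// -ltnS.
have convN : conv a q N = a N + a (N - l)%N * y + s * cofr Q.
  rewrite convE (ltnW lN) -QE rmorph_sum mulr_sumr /=; congr (_ + _); apply: eq_bigr => i _.
  case: ifP => _; last by rewrite rmorph0 mulr0.
  by rewrite -mulcj; ring.
rewrite big_ord_recr /= convN lerD2r.
rewrite -(big_mkord xpredT (fun k => modulus (a k) ^+ 2)).
rewrite -(big_mkord xpredT (fun k => modulus (conv a q k) ^+ 2)).
(* The outputs kept are those up to index [l] and the one at [N]; the squared moduli strictly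
   between are nonnegative. *)
rewrite [leRHS](big_cat_nat (leq0n l.+1) lN)/= big_nat_recr//= -[leLHS]addr0 lerD//.
  rewrite conv_le// leqnn subnn lerD2r [leLHS]big_nat_cond [leRHS]big_nat_cond.
  apply: ler_sum => i; rewrite andbT /= => il.
  by rewrite conv_le ?(ltnW il)// leqNgt il addr0.
by apply: sumr_ge0 => i _; rewrite exprn_ge0 ?modulus_ge0.
Qed.

(* The optimal choice is [t = 1 / (1 - Q)]. *)
Lemma contractive_scalar (X Q : R) : 0 <= X -> 0 <= Q ->
  (forall t, 0 <= t -> X ^+ 2 * ((1 + t * Q) ^+ 2 - t ^+ 2 * Q) <= 1 - Q) -> X <= 1 - Q.
Proof.
move=> X0 Q0 H; have H0 := H 0 (lexx 0).
rewrite !mul0r addr0 expr1n expr0n /= mul0r subr0 mulr1 in H0.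
have Q1 : Q <= 1 by have := sqr_ge0 X; lra.
have [Q1'|Q1'] := eqVneq Q 1; first by rewrite Q1' in H0 *; have := sqr_ge0 X; nra.
have D0 : 0 < 1 - Q by rewrite subr_gt0 lt_neqAle Q1'.
have := H (1 - Q)^-1 (ltW _); rewrite invr_gt0 => /(_ D0).
have -> : (1 + (1 - Q)^-1 * Q) ^+ 2 - (1 - Q)^-1 ^+ 2 * Q = (1 - Q)^-1.
  by field; rewrite gt_eqF.
by rewrite ler_pdivrMr// -expr2 ler_sqr ?nnegrE// ltW.
Qed.

(** With [s = t X] the [N]-th output is [X (1 + t Q)]. The last condition on [y] trades the
    low-order outputs and [|y|^2] for [- Q], which leaves the hypothesis of [contractive_scalar]. *)
Lemma carlson_aux a (y : cplx R) l N :
  (forall q K, \sum_(k < K) modulus (conv a q k) ^+ 2 <= \sum_(k < K) modulus (q k) ^+ 2) ->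
  (l < N)%N -> (l = 0%N -> y = 0) ->
  \sum_(k < N - l) modulus (a k) ^+ 2 + modulus y ^+ 2 <=
    \sum_(k < l) modulus (a k) ^+ 2 + modulus (a l + a 0%N * y) ^+ 2 ->
  modulus (a N + a (N - l)%N * y) <= 1 - \sum_(k < N - l) modulus (a k) ^+ 2.
Proof.
move=> contr lN yl Hy; set X := a N + _; set Q := \sum_(k < _) _ in Hy *.
have Q0 : 0 <= Q by apply: sumr_ge0 => i _; rewrite exprn_ge0 ?modulus_ge0.
apply: contractive_scalar => //; first exact: modulus_ge0.
move=> t t0; have := contraction_test (cofr t * X) (erefl Q) contr lN yl; rewrite -/X.
have -> : X + cofr t * X * cofr Q = X * cofr (1 + t * Q).
  by rewrite rmorphD rmorphM rmorph1; ring.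
rewrite !modulusM !modulus_cofr (ger0_norm t0) ger0_norm ?addr_ge0 ?mulr_ge0// !exprMn.
by move: Hy; nra.
Qed.

(** The case [y = 0], [N = 2 l + 1] of [carlson_aux]: since [N - l = l + 1], its side condition is
    an equality. *)
Lemma carlson_odd a l :
  (forall q K, \sum_(k < K) modulus (conv a q k) ^+ 2 <= \sum_(k < K) modulus (q k) ^+ 2) ->
  modulus (a l.*2.+1) <= 1 - \sum_(k < l.+1) modulus (a k) ^+ 2.
Proof.
move=> contr; have lN : (l < l.*2.+1)%N by lia.
have := carlson_aux (y := 0) contr lN (fun=> erefl).
rewrite !mulr0 !addr0 modulus0 expr0n /= addr0 (_ : (l.*2.+1 - l = l.+1)%N); last lia.
by apply; rewrite big_ord_recr.
Qed.

Lemma carlson_even a l : (0 < l)%N ->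
  (forall q K, \sum_(k < K) modulus (conv a q k) ^+ 2 <= \sum_(k < K) modulus (q k) ^+ 2) ->
  modulus (a l.*2) <= 1 - \sum_(k < l) modulus (a k) ^+ 2 - modulus (a l) ^+ 2 / (1 + modulus (a 0%N)).
Proof.
move=> l0 contr; have lN : (l < l.*2)%N by lia.
have [u [u1 uE]] : exists u, modulus u = 1 /\ a l.*2 = u * cofr (modulus (a l.*2)).
  have [->|aN] := eqVneq (a l.*2) 0; first by exists 1; rewrite modulus1 modulus0 rmorph0 mulr0.
  have maN : modulus (a l.*2) != 0 by rewrite modulus_eq0.
  exists (a l.*2 * cofr (modulus (a l.*2))^-1); split.
    by rewrite modulusM modulus_cofr ger0_norm ?invr_ge0 ?modulus_ge0// mulfV.
  by rewrite -mulrA -rmorphM mulVf// rmorph1 mulr1.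
set A := modulus (a 0%N); have A0 : 0 <= A := modulus_ge0 _.
have A1 : 0 < 1 + A by lra.
(* The factor [cj (a l) * u] gives [a l * y] the phase of [a l.*2], so the two moduli add up. The
   factor [(1 + A)^-1] solves [|a l| - A |y| = |y|], which yields the side condition by the triangle
   inequality. *)
pose y := cj (a l) * u * cofr (1 + A)^-1.
have yE : modulus y = modulus (a l) / (1 + A).
  by rewrite !modulusM u1 mulr1 modulus_cj modulus_cofr ger0_norm// invr_ge0 ltW.
have := @carlson_aux a y l l.*2 contr lN.
have -> : (l.*2 - l = l)%N by lia.
have -> : a l.*2 + a l * y = u * cofr (modulus (a l.*2) + modulus (a l) ^+ 2 / (1 + A)).
  by rewrite {1}uE /y rmorphD rmorphM /= -mulcj; ring.
rewrite modulusM u1 mul1r modulus_cofr ger0_norm; last first.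
  by rewrite addr_ge0 ?modulus_ge0// divr_ge0 ?exprn_ge0 ?modulus_ge0// ltW.
move=> H; suff : modulus (a l.*2) + modulus (a l) ^+ 2 / (1 + A) <= 1 - \sum_(k < l) modulus (a k) ^+ 2 by lra.
apply: H.
  by move=> l00; rewrite l00 in l0.
rewrite lerD2l ler_sqr ?nnegrE ?modulus_ge0//.
have := modulusB (a l + a 0%N * y) (a 0%N * y); rewrite addrK modulusM -/A yE => H.
have : modulus (a l) = modulus (a l) / (1 + A) + A * (modulus (a l) / (1 + A)) by field; rewrite gt_eqF.
lra.
Qed.

Lemma ler_sum_nat_ge0 (F : nat -> R) l m n : (m <= n)%N -> (forall i, 0 <= F i) ->
  \sum_(l <= i < m) F i <= \sum_(l <= i < n) F i.
Proof.
move=> mn F0; have [lm|ml] := leqP l m; last first.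
  by rewrite big_geq ?(ltnW ml)// sumr_ge0.
by rewrite [leRHS](big_cat_nat lm mn)/= lerDl sumr_ge0.
Qed.

(** * Weighted coefficient sums under Carlson's inequalities *)

Section CoefficientSums.
Variables (x : nat -> R) (r : R).
Hypotheses (x0 : forall n, 0 <= x n) (r01 : 0 <= r < 1).
Hypothesis x_odd : forall l, x l.*2.+1 <= 1 - \sum_(k < l.+1) x k ^+ 2.
Hypothesis x_even : forall l, (0 < l)%N ->
  x l.*2 <= 1 - \sum_(k < l) x k ^+ 2 - x l ^+ 2 / (1 + x 0%N).

Lemma sum_sqr_le1 n : \sum_(k < n) x k ^+ 2 <= 1.
Proof.
case: n => [|n]; first by rewrite big_ord0.
by have := x_odd n; have := x0 n.*2.+1; lra.
Qed.

Lemma coef_le_onem n : (0 < n)%N -> x n <= 1 - x 0%N ^+ 2.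
Proof.
move=> n0; rewrite -(odd_double_half n) in n0 *.
have sq0 k : 0 <= x k ^+ 2 by rewrite sqr_ge0.
case: (odd n) n0 => /=; rewrite ?add0n ?add1n.
  move=> _; apply: le_trans (x_odd _) _; rewrite lerD2l lerN2 big_ord_recl lerDl.
  exact: sumr_ge0.
rewrite double_gt0 => n0; apply: le_trans (x_even n0) _.
case: (n./2) n0 => // m _; rewrite big_ord_recl /=.
have : 0 <= \sum_(i < m) x (bump 0 i) ^+ 2 by apply: sumr_ge0.
have : 0 <= x m.+1 ^+ 2 / (1 + x 0%N) by rewrite divr_ge0// addr_ge0.
lra.
Qed.

(** A step of the induction adds [x] at the indices [2 L + 2] and [2 L + 3], and the square of
    [x (L + 1)]. In the total weight of this square, [(1 + x 0)^-1] cancels the correction in the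
    even inequality, and what survives is [r ^+ (2 L + 4) / (1 - r)], its share of the last term of
    the new bound. Apart from Carlson's two inequalities the step is an identity. *)
Lemma coef_sum_le_aux L :
  \sum_(2 <= n < L.*2.+2) x n * r ^+ n +
    ((1 + x 0%N)^-1 + r / (1 - r)) * \sum_(1 <= k < L.+1) x k ^+ 2 * r ^+ (2 * k) <=
  (1 - x 0%N ^+ 2) * (r ^+ 2 - r ^+ (L.*2.+2)) / (1 - r) +
   (\sum_(1 <= k < L.+1) x k ^+ 2) * r ^+ L.*2.+2 / (1 - r).
Proof.
have [rr0 rr1] := andP r01; have D0 : 0 < 1 - r by rewrite subr_gt0.
have A0 : 0 < 1 + x 0%N by rewrite ltr_pwDl.
elim: L => [|L IH]; first by rewrite !big_geq// !mulr0 !mul0r addr0 subrr mulr0 mul0r addr0.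
rewrite doubleS !(big_nat_recr L.+1)//= big_nat_recr//= big_nat_recr//=.
have Ho := x_odd L.+1; have He := x_even (ltn0Sn L).
rewrite doubleS in Ho He.
rewrite big_ord_recr /= in Ho.
have E : \sum_(k < L.+1) x k ^+ 2 = x 0%N ^+ 2 + \sum_(1 <= k < L.+1) x k ^+ 2.
  by rewrite -(big_mkord xpredT (fun k => x k ^+ 2)) big_ltn.
rewrite E in Ho He.
have -> : (2 * L.+1 = L.*2.+2)%N by lia.
set S := \sum_(1 <= k < L.+1) x k ^+ 2 in IH Ho He *.
set T := \sum_(1 <= k < L.+1) _ in IH *.
set P := \sum_(2 <= n < _) _ in IH *.
rewrite ![r ^+ L.*2.+4]exprS ![r ^+ L.*2.+3]exprS.
set p := r ^+ L.*2.+2 in IH *.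
have p0 : 0 <= p by rewrite exprn_ge0.
have pr0 : 0 <= r * p by rewrite mulr_ge0.
have := ler_wpM2r p0 He; have := ler_wpM2r pr0 Ho; move: IH.
set u := x L.*2.+2; set v := x L.*2.+3; set X := x L.+1 ^+ 2; set A := x 0%N ^+ 2.
move=> IH Hv Hu.
apply: (@le_trans _ _ ((1 - A) * (r ^+ 2 - p) / (1 - r) + S * p / (1 - r)
   + (1 - (A + S) - X / (1 + x 0%N)) * p + (1 - (A + S + X)) * (r * p)
   + ((1 + x 0%N)^-1 + r / (1 - r)) * (X * p))); first by move: IH Hu Hv; lra.
rewrite le_eqVlt; apply/orP; left; apply/eqP.
by field; rewrite !gt_eqF.
Qed.

(** Both sums are enlarged to a common [L]. The leftover term of [coef_sum_le_aux] is absorbed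
    because the squares beyond [x 0] add up to at most [1 - x 0 ^+ 2]. *)
Lemma coef_sum_le M N :
  \sum_(2 <= n < M) x n * r ^+ n +
    ((1 + x 0%N)^-1 + r / (1 - r)) * \sum_(1 <= k < N) x k ^+ 2 * r ^+ (2 * k) <=
  (1 - x 0%N ^+ 2) * r ^+ 2 / (1 - r).
Proof.
have [rr0 rr1] := andP r01; have D0 : 0 < 1 - r by rewrite subr_gt0.
have A0 : 0 < 1 + x 0%N by rewrite ltr_pwDl.
pose L := maxn M N; have ML : (M <= L.*2.+2)%N by rewrite /L; lia.
have NL : (N <= L.+1)%N by rewrite /L; lia.
apply: (@le_trans _ _ (\sum_(2 <= n < L.*2.+2) x n * r ^+ n +
    ((1 + x 0%N)^-1 + r / (1 - r)) * \sum_(1 <= k < L.+1) x k ^+ 2 * r ^+ (2 * k))).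
  apply: lerD.
    by apply: ler_sum_nat_ge0 => // i; rewrite mulr_ge0 ?exprn_ge0.
  apply: ler_wpM2l; first by rewrite addr_ge0 ?divr_ge0 ?invr_ge0 ?(ltW A0) ?(ltW D0).
  by apply: ler_sum_nat_ge0 => // i; rewrite mulr_ge0 ?exprn_ge0.
apply: le_trans (coef_sum_le_aux L) _.
rewrite -mulrDl ler_wpM2r ?invr_ge0 ?(ltW D0)//.
have HS : \sum_(1 <= k < L.+1) x k ^+ 2 <= 1 - x 0%N ^+ 2.
  have := sum_sqr_le1 L.+1; rewrite -(big_mkord xpredT (fun k => x k ^+ 2)) big_ltn//.
  by lra.
have := ler_wpM2r (exprn_ge0 L.*2.+2 rr0) HS.
by lra.
Qed.

End CoefficientSums.

End Contraction.

(** * Derivatives and the Pick inequality *)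

Section SchwarzPick.
Variable R : realType.
Implicit Types (z w h c d u v : cplx R) (a b q : nat -> cplx R) (f g : cplx R -> cplx R) (s t : R).

Lemma has_ps_at f c s b : 0 < s -> has_ps f c s b -> f c = b 0%N.
Proof.
move=> s0 fb; have := fb 0; rewrite modulus0 addr0 => /(_ s0) H.
apply: ccvg_unique H _; rewrite -cvg_shiftS.
rewrite (_ : [sequence _]_n = fun=> b 0%N); first exact: ccvg_cst.
apply/funext => n; rewrite /series /= big_nat_recl//= expr0 mulr1 big1 ?addr0// => i _.
by rewrite exprS mul0r mulr0.
Qed.

(** The tail from degree two on is quadratic in [h]: for [modulus h < t / 2] the quotient is within
    [2 * M / t ^+ 2 * modulus h] of [b 1]. *)
Lemma has_ps_diff_quotient f c s b : 0 < s -> has_ps f c s b ->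
  h^-1 *: (f (h + c) - f c) @[h --> 0^'] --> b 1%N.
Proof.
move=> s0 fb; pose t := s / 2; have t0 : 0 < t by rewrite divr_gt0.
have ts : 0 <= t < s by rewrite /t; apply/andP; split; lra.
have [M M0 HM] := has_ps_bound fb ts.
apply/cvg_modulusP.
have mod0 : modulus h @[h --> (0 : cplx R)^'] --> (0 : R).
  rewrite -(modulus0 R); apply: cvg_modulus; apply: cvg_within_filter; exact: cvg_id.
have lim0 : (2 * M / t ^+ 2) * modulus h @[h --> (0 : cplx R)^'] --> (0 : R).
  by rewrite -(mulr0 (2 * M / t ^+ 2)); apply: cvgM => //; exact: cvg_cst.
apply: (squeeze_cvgr _ (@cvg_cst _ (0 : R) _ _ _) lim0).
have hsmall : \forall h \near (0 : cplx R)^', modulus h < t / 2.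
  by apply: (cvgr_lt _ mod0); rewrite divr_gt0.
have hnz : \forall h \near (0 : cplx R)^', h != 0 by exact: nbhs_dnbhs_neq.
near=> h; rewrite modulus_ge0 /=.
have h0 : h != 0 by near: h.
have ht : modulus h < t / 2 by near: h.
have mh0 : 0 < modulus h by rewrite lt_neqAle modulus_ge0 andbT eq_sym modulus_eq0.
have hs : modulus h < s by rewrite /t in ht; lra.
pose r := modulus h / t.
have r2 : r <= 2^-1 by rewrite /r ler_pdivrMr//; lra.
have r0 : 0 <= r by rewrite divr_ge0// ltW.
have r01 : 0 <= r < 1 by rewrite r0/=; lra.
have dom n : modulus (b n * h ^+ n) <= M * r ^+ n.
  by rewrite modulusM modulusX; exact: geometric_dom t0 (HM n) (modulus_ge0 h).
have := geometric_tail 2 r01 dom (fb h hs).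
rewrite /series /= !big_nat_recl// big_geq//= addr0 expr0 expr1 mulr1 -(has_ps_at s0 fb) => H.
have -> : h^-1 *: (f (h + c) - f c) - b 1%N = h^-1 * (f (c + h) - (f c + b 1%N * h)).
  rewrite [h + c]addrC -[_ *: _]/(_ * _); field; exact: h0.
rewrite modulusM modulusV mulrC ler_pdivrMr//; apply: le_trans H _.
have -> : 2 * M / t ^+ 2 * modulus h * modulus h = 2 * (M * r ^+ 2).
  by rewrite /r; field; rewrite gt_eqF.
rewrite ler_pdivrMr; last lra.
have : 0 <= M * r ^+ 2 by rewrite mulr_ge0 ?exprn_ge0.
set X := M * _; nra.
Unshelve. all: by end_near. Qed.

Lemma has_ps_derive1 f c s b : 0 < s -> has_ps f c s b -> derive1 f c = b 1%N.
Proof.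
move=> s0 fb; rewrite /derive1; apply: cvg_lim; first exact: norm_hausdorff.
exact: has_ps_diff_quotient fb.
Qed.

Lemma has_ps_eq_coef f c s b b' : b =1 b' -> has_ps f c s b -> has_ps f c s b'.
Proof. by move=> /funext ->. Qed.

(** The derivative at a point is the first recentred coefficient there, and recentred coefficients
    are power series in the centre. *)
Lemma has_ps_derive f s b : has_ps f 0 s b ->
  has_ps (derive1 f) 0 s (fun m => m.+1%:R * b m.+1).
Proof.
move=> fb.
apply: (@has_ps_eq _ (fun d => recentre b d 1)).
  move=> h hs; rewrite add0r.
  have H := has_ps_recentre fb hs; rewrite add0r in H.
  by rewrite (has_ps_derive1 _ H)// subr_gt0.
by apply: has_ps_eq_coef (recentre_has_ps (n := 1) fb) => m; rewrite bin1 addn1.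
Qed.

Lemma has_ps_derive1n f s b n : has_ps f 0 s b ->
  has_ps (derive1n n f) 0 s (fun m => ((m + n) ^_ n)%:R * b (m + n)%N).
Proof.
elim: n => [|n IH] fb.
  by apply: has_ps_eq_coef fb => m; rewrite addn0 ffactn0 mul1r.
rewrite derive1nS; apply: has_ps_eq_coef (has_ps_derive (IH fb)) => m.
rewrite mulrA -natrM addSnnS; congr (_%:R * _).
by rewrite ffactnSr mulnC; congr (_ * _)%N; lia.
Qed.

Lemma taylor_coefE f s b n : 0 < s -> has_ps f 0 s b -> taylor_coef f n = b n.
Proof.
move=> s0 fb; rewrite /taylor_coef (has_ps_at s0 (has_ps_derive1n (n := n) fb)) add0n ffactnn.
by rewrite mulrC mulKf// pnatr_eq0 -lt0n fact_gt0.
Qed.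

Lemma cvg_geometric_cplx (x : cplx R) : modulus x < 1 ->
  series (fun k => x ^+ k) @ \oo --> (1 - x)^-1.
Proof.
move=> x1; have x1' : 1 - x != 0.
  by apply/negP => /eqP/subr0_eq E; rewrite -E modulus1 ltxx in x1.
have -> : series (fun k => x ^+ k) = (fun n => (1 - x ^+ n) * (1 - x)^-1).
  apply/funext => n; rewrite /series /= big_mkord.
  by rewrite -[1 - x ^+ n]opprB subrX1 -mulNr opprB mulrAC mulfV// mul1r.
rewrite -[X in _ --> X]mul1r; apply: ccvgM (ccvg_cst _).
rewrite -[X in _ --> X]subr0; apply: ccvgB (ccvg_cst _) _.
apply/cvg_modulusP; rewrite (_ : (fun k : nat => _) = (fun n : nat => modulus x ^+ n)).
  by apply: cvg_expr; rewrite ger0_norm ?modulus_ge0.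
by apply/funext => n; rewrite subr0 modulusX.
Qed.

(** A Cauchy product with the Szego kernel. The recurrence [rec] expresses its partial sums through
    those of [f], up to a boundary term that tends to [0] because the convolutions are bounded by
    [1 / (1 - |v|)]. *)
Lemma cvg_conv_geometric f a v w : has_ps f 0 1 a -> (forall n, modulus (a n) <= 1) ->
  modulus v < 1 -> modulus w < 1 ->
  series (fun k => conv a (fun j => v ^+ j) k * w ^+ k) @ \oo --> f w / (1 - v * w).
Proof.
move=> fa a1 v1 w1; have vw1 : 1 - v * w != 0.
  apply/negP => /eqP/subr0_eq E; have := modulusM v w; rewrite -E modulus1.
  by have := modulus_ge0 v; have := modulus_ge0 w; nra.
set C := series _; pose cc k := conv a (fun j => v ^+ j) k * w ^+ k.
have rec k : conv a (fun j => v ^+ j) k.+1 = a k.+1 + v * conv a (fun j => v ^+ j) k.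
  rewrite /conv big_ord_recl /= subn0 mulr1 mulr_sumr; congr (_ + _); apply: eq_bigr => i _.
  by rewrite /bump /= add1n subSS exprS mulrCA.
have CE n : C n.+1 = series (fun n => a n * w ^+ n) n.+1 + v * w * C n.
  rewrite /C /series /= big_nat_recl// [in RHS]big_nat_recl//=.
  rewrite /conv big_ord1 subnn mulr1 -addrA; congr (_ + _).
  rewrite mulr_sumr -big_split /=; apply: eq_bigr => i _.
  by rewrite -/(conv a _ _) -/(conv a _ _) rec exprS; ring.
have CE' n : C n = (series (fun n => a n * w ^+ n) n.+1 - cc n) / (1 - v * w).
  apply: (mulIf vw1); rewrite divfK// -[series _ n.+1](addrK (v * w * C n)) -CE.
  by rewrite /C /series /= big_nat_recr//= -/(cc n); ring.
have -> : C = (fun n => (series (fun n => a n * w ^+ n) n.+1 - cc n) / (1 - v * w)) by apply/funext.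
apply: ccvgM (ccvg_cst _); rewrite -[f w]subr0; apply: ccvgB.
  by rewrite (cvg_shiftS (series (fun n => a n * w ^+ n))); have := fa w w1; rewrite add0r.
apply/cvg_modulusP.
have lim0 : (fun n => (1 - modulus v)^-1 * modulus w ^+ n) @ \oo --> (0 : R).
  by apply: cvg_geo0; rewrite modulus_ge0.
apply: (squeeze_cvgr _ (@cvg_cst _ (0 : R) _ _ _) lim0).
apply: nearW => n; rewrite modulus_ge0/= subr0 modulusM modulusX ler_wpM2r ?exprn_ge0 ?modulus_ge0//.
rewrite (le_trans (modulus_sum _ _ _))//.
apply: (@le_trans _ _ (\sum_(0 <= j < n.+1) modulus v ^+ j)).
  rewrite big_mkord; apply: ler_sum => i _; rewrite modulusM modulusX ler_piMl ?exprn_ge0 ?modulus_ge0//.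
by have := @sum_geo_le _ (modulus v) 0 n.+1; rewrite expr0 mul1r modulus_ge0; apply.
Qed.

Lemma cre_sqr z : cre (z * cj z) = modulus z ^+ 2.
Proof. by rewrite mulcj. Qed.

Lemma creJ z : cre (cj z) = cre z.
Proof. by case: z. Qed.

(* With [g k = \sum_i al i * cj (f (w i)) * cj (w i) ^+ k] and
   [c k = \sum_i al i * cj (w i) ^+ k], the form is the limit of the sum of
   [|g|^2 - 2 Re (conv a g * cj c) + |c|^2], which by contraction is at least
   the sum of [|conv a g - c|^2]. *)
Lemma pick_ge0 f a n (w al : 'I_n -> cplx R) : has_ps f 0 1 a ->
  (forall z, unit_disc z -> modulus (f z) <= 1) -> (forall i, modulus (w i) < 1) ->
  0 <= cre (\sum_i \sum_j al i * cj (al j) * ((1 - cj (f (w i)) * f (w j)) / (1 - cj (w i) * w j))).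
Proof.
move=> fa f1 w1.
have a1 k : modulus (a k) <= 1.
  have := @coef_le R f 0 1 a 1 k ltr01 fa; rewrite expr1n mulr1; apply => u u1.
  by rewrite add0r; exact: f1.
have contr q K := contraction q K fa f1.
pose F i := f (w i).
pose g k := \sum_i al i * cj (F i) * cj (w i) ^+ k.
pose c k := \sum_i al i * cj (w i) ^+ k.
pose G i j := series (fun k => (cj (w i) * w j) ^+ k).
have [cv cvE] : exists cv : 'I_n -> nat -> cplx R,
    forall i, conv a (fun l => cj (w i) ^+ l) = cv i by exists (fun i => conv a (fun l => cj (w i) ^+ l)).
pose V i j := series (fun k => cv i k * w j ^+ k).
(* The cross term is doubled instead of being added to its conjugate. The real part is the same, and
   in the limit the three terms combine to [1 - cj (F i) * F j] over the common denominator. *)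
pose U K := \sum_i \sum_j al i * cj (al j) *
  (cj (F i) * F j * G i j K - 2 * cj (F i) * V i j K + G i j K).
have UE K : U K = \sum_(k < K) (g k * cj (g k) - 2 * (conv a g k * cj (c k)) + c k * cj (c k)).
  have convg k : conv a g k = \sum_i al i * cj (F i) * cv i k.
    under [RHS]eq_bigr do rewrite -cvE.
    rewrite /conv /g; under eq_bigr do rewrite mulr_sumr.
    rewrite exchange_big; apply: eq_bigr => i _; rewrite mulr_sumr /=; apply: eq_bigr => j _.
    by rewrite mulrCA.
  rewrite /U /G /V /series /=.
  under eq_bigr => i _.
    under eq_bigr => j _.
      rewrite !big_mkord !mulr_sumr -sumrB -big_split mulr_sumr /=; over.
    rewrite exchange_big /=; over.
  rewrite exchange_big /=; apply: eq_bigr => k _.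
  rewrite convg /g /c !rmorph_sum /= !mulr_suml mulr_sumr -sumrB -big_split /=.
  apply: eq_bigr => i _.
  rewrite !mulr_sumr -sumrB -big_split /=; apply: eq_bigr => j _.
  by rewrite !rmorphM !rmorphXn /= !exprMn !cjK; ring.
have limU : U @ \oo --> \sum_i \sum_j al i * cj (al j) * ((1 - cj (F i) * F j) / (1 - cj (w i) * w j)).
  apply: ccvg_sum => i _; apply: ccvg_sum => j _; apply: ccvgM; first exact: ccvg_cst.
  have wij : modulus (cj (w i) * w j) < 1.
    rewrite modulusM modulus_cj; have := w1 i; have := w1 j.
    by have := modulus_ge0 (w i); have := modulus_ge0 (w j); nra.
  have HG := cvg_geometric_cplx wij.
  have wi1 : modulus (cj (w i)) < 1 by rewrite modulus_cj.
  have HV := cvg_conv_geometric fa a1 wi1 (w1 j); rewrite cvE in HV.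
  have -> : (1 - cj (F i) * F j) / (1 - cj (w i) * w j) =
    cj (F i) * F j * (1 - cj (w i) * w j)^-1 - 2 * cj (F i) * (F j / (1 - cj (w i) * w j))
    + (1 - cj (w i) * w j)^-1 by ring.
  apply: (ccvgD _ HG); apply: ccvgB; first exact: ccvgM (ccvg_cst _) HG.
  exact: ccvgM (ccvg_cst _) HV.
apply: (cvgr_to_ge (cvg_cre limU)); apply: nearW => K.
rewrite UE raddf_sum /=.
apply: (@le_trans _ _ (\sum_(k < K) (modulus (g k) ^+ 2 - modulus (conv a g k) ^+ 2))).
  by rewrite sumrB subr_ge0.
apply: ler_sum => k _; rewrite raddfD raddfB /= !cre_sqr.
have := sqr_ge0 (modulus (conv a g k - c k)); rewrite -[X in 0 <= X]cre_sqr.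
have -> : (conv a g k - c k) * cj (conv a g k - c k) =
  conv a g k * cj (conv a g k) - conv a g k * cj (c k) - cj (conv a g k * cj (c k)) + c k * cj (c k).
  by rewrite rmorphB rmorphM /= cjK; ring.
have -> : 2 * (conv a g k * cj (c k)) = conv a g k * cj (c k) + conv a g k * cj (c k) by ring.
rewrite !raddfD !raddfN /= !cre_sqr.
rewrite creJ; lra.
Qed.

End SchwarzPick.

(** * The two-point Pick inequality and the Schwarz-Pick bounds *)

Section TwoPoint.
Variable R : realType.
Implicit Types (z w h c d u v : cplx R) (a b q : nat -> cplx R) (f g : cplx R -> cplx R).

Lemma rcvgM (T : Type) {F : set_system T} {FF : Filter F} (f g : T -> R) (l m : R) :
  f @ F --> l -> g @ F --> m -> (fun x => f x * g x) @ F --> l * m.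
Proof. exact: cvgM. Qed.

Lemma rcvgX2 (T : Type) {F : set_system T} {FF : Filter F} (f : T -> R) (l : R) :
  f @ F --> l -> (fun x => f x ^+ 2) @ F --> l ^+ 2.
Proof. by move=> fl; exact: rcvgM. Qed.

Lemma rcvg1B (T : Type) {F : set_system T} {FF : Filter F} (f : T -> R) (l : R) :
  f @ F --> l -> (fun x => 1 - f x) @ F --> 1 - l.
Proof. by move=> fl; exact: (cvgB (@cvg_cst _ (1 : R) _ F _) fl). Qed.

Lemma rcvg_cst (T : Type) {F : set_system T} {FF : Filter F} (l : R) :
  (fun _ : T => l) @ F --> l.
Proof. exact: cvg_cst. Qed.

Arguments rcvg_cst {T F FF} l.

(** This links the Pick kernel to the pseudo-hyperbolic distance. It clears the denominators of the
    Pick determinant and later computes [1 - |f_a|^2]. *)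
Lemma modulus_pick u v :
  modulus (1 - cj u * v) ^+ 2 = modulus (u - v) ^+ 2 + (1 - modulus u ^+ 2) * (1 - modulus v ^+ 2).
Proof.
rewrite !modulus_sqr; case: u => u1 u2; case: v => v1 v2 /=.
by ring.
Qed.

(** The determinant condition for a two by two Hermitian form, tested on the vectors [(1, - t P)]
    with [b = |P|^2]. The optimal choice is [t = 1 / C]; if [C = 0], the choice [t = (A + 1) / b]
    would make the form negative. *)
Lemma quadratic_ge0 (A C b : R) : 0 <= A -> 0 <= C -> 0 <= b ->
  (forall t, 0 <= A - 2 * t * b + t ^+ 2 * b * C) -> b <= A * C.
Proof.
move=> A0 C0 b0 H; have [C1|C1] := eqVneq C 0.
  rewrite C1 mulr0 leNgt; apply/negP => bp.
  have := H ((A + 1) / b); rewrite C1 mulr0 addr0 -mulrA divfK ?gt_eqF//.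
  by lra.
have Cp : 0 < C by rewrite lt_neqAle eq_sym C1.
have := H C^-1.
have -> : A - 2 * C^-1 * b + C^-1 ^+ 2 * b * C = A - b / C by field.
by rewrite subr_ge0 ler_pdivrMr.
Qed.

Lemma pick_form (p : cplx R) (A C t b : R) : cofr b = p * cj p ->
  1 * cj 1 * cofr A + 1 * cj (- cofr t * p) * p +
     (- cofr t * p * cj 1 * cj p + - cofr t * p * cj (- cofr t * p) * cofr C)
     = cofr (A - 2 * t * b + t ^+ 2 * b * C).
Proof.
move=> bE.
have cj1 : cj 1 = 1 :> cplx R by exact: rmorph1.
have -> : cj (- cofr t * p) = - cofr t * cj p.
  have -> : - cofr t * p = cofr (- t) * p by rewrite rmorphN.
  have -> : - cofr t * cj p = cofr (- t) * cj p by rewrite rmorphN.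
  have -> : cj (cofr (- t) * p) = cj (cofr (- t)) * cj p by exact: rmorphM.
  by congr (_ * _); exact: conjc_real.
rewrite cj1; transitivity (cofr A - 2 * cofr t * (p * cj p) + cofr t * cofr t * (p * cj p) * cofr C).
  by ring.
by rewrite -bE rmorphD rmorphB !rmorphM rmorph_nat.
Qed.

(** The determinant of the Pick matrix at [u], [v] is nonnegative. Expanding both kernels by
    [modulus_pick], for [(u, v)] and for [(f u, f v)], makes the same product of four factors cancel
    on the two sides. *)
Lemma pick_two_points f a u v : has_ps f 0 1 a ->
  (forall z, unit_disc z -> modulus (f z) <= 1) -> modulus u < 1 -> modulus v < 1 ->
  modulus (f u - f v) ^+ 2 * ((1 - modulus u ^+ 2) * (1 - modulus v ^+ 2)) <=
  (1 - modulus (f u) ^+ 2) * (1 - modulus (f v) ^+ 2) * modulus (u - v) ^+ 2.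
Proof.
move=> fa f1 u1 v1.
have sq1 z : modulus z < 1 -> 0 < 1 - modulus z ^+ 2.
  by move=> z1; rewrite subr_gt0 expr_lt1// modulus_ge0.
have U0 := sq1 u u1; have V0 := sq1 v v1.
have sq1' z : modulus z <= 1 -> 0 <= 1 - modulus z ^+ 2.
  by move=> z1; rewrite subr_ge0 exprn_ile1// modulus_ge0.
have FU0 := sq1' _ (f1 u u1); have FV0 := sq1' _ (f1 v v1).
have D0 : 0 < modulus (1 - cj u * v) ^+ 2.
  by rewrite modulus_pick ltr_wpDl ?sqr_ge0// mulr_gt0.
pose P z w := (1 - cj (f z) * f w) / (1 - cj z * w).
have [b bdef] : exists b : R, b = modulus (P u v) ^+ 2 by eexists.
have Pd z : P z z = cofr ((1 - modulus (f z) ^+ 2) / (1 - modulus z ^+ 2)).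
  rewrite /P ![cj _ * _]mulrC !mulcj -(rmorph1 (@cofr R)) -!rmorphB.
  by rewrite rmorphM fmorphV /=.
have PJ z w : P w z = cj (P z w).
  by rewrite /P rmorphM fmorphV !rmorphB !rmorphM rmorph1 /= !cjK ![cj _ * _]mulrC.
have bE : b <= (1 - modulus (f u) ^+ 2) / (1 - modulus u ^+ 2) * ((1 - modulus (f v) ^+ 2) / (1 - modulus v ^+ 2)).
  apply: quadratic_ge0; rewrite ?divr_ge0 ?(ltW U0) ?(ltW V0)//; first by rewrite bdef sqr_ge0.
  move=> t.
  pose al (i : 'I_2) : cplx R := if i == 0 then 1 else - cofr t * P u v.
  pose w (i : 'I_2) := if i == 0 then u else v.
  have w1 i : modulus (w i) < 1 by rewrite /w; case: ifP.
  have := pick_ge0 al fa f1 w1.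
  rewrite !big_ord_recl !big_ord0 /= !addr0.
  rewrite /al /w /= -/(P u u) -/(P u v) -/(P v u) -/(P v v) (PJ u v) !Pd.
  set A := (1 - _ ^+ 2) / _; set C := (1 - modulus (f v) ^+ 2) / _.
  have -> : 1 * cj 1 * cofr A + 1 * cj (- cofr t * P u v) * P u v +
     (- cofr t * P u v * cj 1 * cj (P u v) + - cofr t * P u v * cj (- cofr t * P u v) * cofr C)
     = cofr (A - 2 * t * b + t ^+ 2 * b * C).
    by apply: pick_form; rewrite bdef mulcj.
  by [].
have bE2 : b = modulus (1 - cj (f u) * f v) ^+ 2 / modulus (1 - cj u * v) ^+ 2.
  by rewrite bdef /P modulusM modulusV exprMn exprVn.
move: bE; rewrite bE2 ler_pdivrMr// mulf_div mulrAC ler_pdivlMr ?mulr_gt0// !modulus_pick.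
by set X := modulus (u - v) ^+ 2; set Y := modulus (f u - f v) ^+ 2; lra.
Qed.

Lemma schwarz_pick_value f a z : has_ps f 0 1 a ->
  (forall z, unit_disc z -> modulus (f z) <= 1) -> modulus z < 1 ->
  modulus (f z) <= (modulus z + modulus (a 0%N)) / (1 + modulus (a 0%N) * modulus z).
Proof.
move=> fa f1 z1; have f0 := has_ps_at ltr01 fa.
have mod01 : modulus (0 : cplx R) < 1 by rewrite modulus0.
have := pick_two_points fa f1 z1 mod01.
have a1 : modulus (f 0) <= 1 by exact: f1.
have x1 : modulus (f z) <= 1 by exact: f1.
rewrite subr0 modulus0 expr0n subr0 mulr1 /= -f0.
move: a1 x1; set A := modulus (f 0); set X := modulus (f z); set r := modulus z => a1 x1 H.
have A0 : 0 <= A := modulus_ge0 _; have X0 : 0 <= X := modulus_ge0 _.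
have r0 : 0 <= r := modulus_ge0 _.
rewrite ler_pdivlMr ?ltr_pwDl ?mulr_ge0//.
have [XA|AX] := leP X A.
  have : X * A * r <= r by rewrite ler_piMl// mulr_ile1.
  by rewrite mulrDr mulr1 mulrA; lra.
have : (X - A) ^+ 2 <= modulus (f z - f 0) ^+ 2.
  rewrite ler_sqr ?nnegrE ?modulus_ge0 ?subr_ge0 ?(ltW AX)//.
  by apply: le_trans (ge_modulusB _ _); rewrite ler_norm.
have r2 : 0 <= 1 - r ^+ 2 by rewrite subr_ge0 exprn_ile1// ltW.
move=> /(ler_wpM2r r2) H2; have := le_trans H2 H => H3.
(* By [(1 - A X)^2 = (X - A)^2 + (1 - A^2) (1 - X^2)], the inequality [H3] rearranges to a
   comparison of squares. *)
have : (X - A) ^+ 2 <= (r * (1 - A * X)) ^+ 2 by nra.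
rewrite ler_sqr ?nnegrE ?subr_ge0 ?(ltW AX)//; last by rewrite mulr_ge0// subr_ge0; nra.
by lra.
Qed.

(** The limit of [pick_two_points] at [z + h] and [z], divided by the square of [modulus h]; in the
    limit both sides are squares. *)
Lemma schwarz_pick_deriv f a z : has_ps f 0 1 a ->
  (forall z, unit_disc z -> modulus (f z) <= 1) -> modulus z < 1 ->
  modulus (derive1 f z) * (1 - modulus z ^+ 2) <= 1 - modulus (f z) ^+ 2.
Proof.
move=> fa f1 z1.
have z2 : 0 < 1 - modulus z ^+ 2 by rewrite subr_gt0 expr_lt1// modulus_ge0.
have := has_ps_recentre fa z1; rewrite add0r => fz.
have s0 : 0 < 1 - modulus z by rewrite subr_gt0.
have Q : (fun h => h^-1 * (f (h + z) - f z)) @ (0 : cplx R)^' --> derive1 f z.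
  rewrite (has_ps_derive1 s0 fz); exact: has_ps_diff_quotient s0 fz.
have id0 : (fun h => h) @ (0 : cplx R)^' --> (0 : cplx R) by apply: cvg_within_filter; exact: cvg_id.
have hnz : \forall h \near (0 : cplx R)^', h != 0 by exact: nbhs_dnbhs_neq.
have hz : (fun h => modulus (h + z)) @ (0 : cplx R)^' --> modulus z.
  by apply: cvg_modulus; rewrite -[X in _ --> X]add0r; apply: ccvgD id0 (ccvg_cst _).
have fcont : (fun h => modulus (f (h + z))) @ (0 : cplx R)^' --> modulus (f z).
  apply: cvg_modulus.
  have H : (fun h => h * (h^-1 * (f (h + z) - f z)) + f z) @ (0 : cplx R)^' --> 0 * derive1 f z + f z.
    exact: ccvgD (ccvgM id0 Q) (ccvg_cst (f z)).
  rewrite mul0r add0r in H; apply: cvg_trans H; apply: near_eq_cvg.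
  apply: filterS hnz => h h0; by rewrite mulrA mulfV// mul1r subrK.
have small : \forall h \near (0 : cplx R)^', modulus (h + z) < 1 by exact: (cvgr_lt _ hz).
have L : (fun h => modulus (h^-1 * (f (h + z) - f z)) ^+ 2 * ((1 - modulus (h + z) ^+ 2) * (1 - modulus z ^+ 2)))
  @ (0 : cplx R)^' --> modulus (derive1 f z) ^+ 2 * ((1 - modulus z ^+ 2) * (1 - modulus z ^+ 2)).
  apply: rcvgM; first exact: rcvgX2 (cvg_modulus Q).
  exact: rcvgM (rcvg1B (rcvgX2 hz)) (rcvg_cst _).
have L2 : (fun h => (1 - modulus (f (h + z)) ^+ 2) * (1 - modulus (f z) ^+ 2)) @ (0 : cplx R)^' -->
   (1 - modulus (f z) ^+ 2) * (1 - modulus (f z) ^+ 2).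
  exact: rcvgM (rcvg1B (rcvgX2 fcont)) (rcvg_cst _).
have : modulus (derive1 f z) ^+ 2 * ((1 - modulus z ^+ 2) * (1 - modulus z ^+ 2)) <=
   (1 - modulus (f z) ^+ 2) * (1 - modulus (f z) ^+ 2).
  apply: ler_cvg_to L L2 _; near=> h.
  have h0 : h != 0 by near: h.
  have hs : modulus (h + z) < 1 by near: h.
  have := pick_two_points fa f1 hs z1; rewrite addrK => H.
  have mh0 : 0 < modulus h ^+ 2.
    by rewrite exprn_gt0// lt_neqAle modulus_ge0 andbT eq_sym modulus_eq0.
  rewrite -(ler_pM2r mh0); apply: le_trans H; rewrite modulusM modulusV.
  rewrite le_eqVlt; apply/orP; left; apply/eqP; field.
  by rewrite modulus_eq0.
have f2 : 0 <= 1 - modulus (f z) ^+ 2 by rewrite subr_ge0 exprn_ile1 ?modulus_ge0 ?f1.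
rewrite -!expr2 -exprMn ler_sqr ?nnegrE//.
by rewrite mulr_ge0 ?modulus_ge0// ltW.
Unshelve. all: by end_near. Qed.

End TwoPoint.

(** * Rotation invariance of plane measure *)

Section PlaneMeasure.
Variable R : realType.
Local Notation mu := (@lebesgue_measure R).
Local Notation T := (measurableTypeR R * measurableTypeR R)%type.
Implicit Types (F : T -> \bar R) (g : T -> R).

Lemma measurable_shift (c : R) : measurable_fun setT (fun x : measurableTypeR R => x + c : measurableTypeR R).
Proof. by apply: measurable_funD => //; exact: measurable_cst. Qed.

Lemma lebesgue_measure_shift (c : R) (A : set R) : measurable A ->
  pushforward mu (fun x : measurableTypeR R => x + c : measurableTypeR R) A = mu A.
Proof.
have ms := measurable_shift c.
move=> mA; apply/esym/lebesgue_measure_unique => //= _ [[a b]] _ <-.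
rewrite /pushforward.
have -> : (fun x : R => x + c) @^-1` `]a, b]%classic = `](a - c), (b - c)]%classic.
  by apply/seteqP; split => x /=; rewrite !in_itv /= ltrBlDr lerBrDr.
rewrite !lebesgue_measure_itv/= !lte_fin ltrD2r; case: ifP => // _.
by rewrite -!EFinB; congr EFin; ring.
Qed.

Lemma integral_shift (c : R) (f : R -> \bar R) : measurable_fun setT f ->
  (forall x, 0 <= f x)%E -> (\int[mu]_x f (x + c)%R = \int[mu]_x f x)%E.
Proof.
move=> mf f0; have ms := measurable_shift c.
rewrite -[RHS](@eq_measure_integral _ _ _ _ _ (pushforward mu (fun x : measurableTypeR R => x + c : measurableTypeR R))).
  by rewrite ge0_integral_pushforward.
by move=> A mA _; exact: lebesgue_measure_shift.
Qed.

Lemma measurable_lin (a b c d : R) :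
  measurable_fun setT (fun p : T => (a * p.1 + b * p.2, c * p.1 + d * p.2) : T).
Proof.
have ml (x y : R) : measurable_fun setT (fun p : T => x * p.1 + y * p.2 : measurableTypeR R).
  by apply: measurable_funD; apply: measurable_funM => //.
exact: measurable_fun_pair.
Qed.

(** By Tonelli's theorem: on each horizontal line the shear is a translation. *)
Lemma integral_shear1 (t : R) F : measurable_fun setT F -> (forall p, 0 <= F p)%E ->
  (\int[(mu \x mu)%E]_p F ((p.1 + t * p.2)%R, p.2) = \int[(mu \x mu)%E]_p F p)%E.
Proof.
move=> mF F0.
have mS : measurable_fun setT (fun p : T => F ((p.1 + t * p.2)%R, p.2)).
  have /= := measurableT_comp mF (measurable_lin 1 t 0 1).
  by under [X in measurable_fun _ X -> _]eq_fun => p do rewrite /= !mul1r mul0r add0r.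
etransitivity; first exact: (fubini_tonelli2 _ mS (fun p => F0 _)).
etransitivity; last exact/esym/(fubini_tonelli2 _ mF F0).
apply: eq_integral => y _; rewrite /fubini_G /=.
rewrite (integral_shift (t * y) (f := fun x => F (x, y)))//.
exact: measurable_fun_pair1.
Qed.

Lemma integral_shear2 (t : R) F : measurable_fun setT F -> (forall p, 0 <= F p)%E ->
  (\int[(mu \x mu)%E]_p F (p.1, (p.2 + t * p.1)%R) = \int[(mu \x mu)%E]_p F p)%E.
Proof.
move=> mF F0.
have mS : measurable_fun setT (fun p : T => F (p.1, (p.2 + t * p.1)%R)).
  have /= := measurableT_comp mF (measurable_lin 1 0 t 1).
  by under [X in measurable_fun _ X -> _]eq_fun => p do rewrite /= !mul1r mul0r addr0 addrC.
etransitivity; first exact: (fubini_tonelli1 _ mS (fun p => F0 _)).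
etransitivity; last exact/esym/(fubini_tonelli1 _ mF F0).
apply: eq_integral => x _; rewrite /fubini_F /=.
rewrite (integral_shift (t * x) (f := fun y => F (x, y)))//.
exact: measurable_fun_pair2.
Qed.

(* A rotation other than the half-turn is a product of three shears. *)
Lemma integral_rotation_half (u v : R) F : u ^+ 2 + v ^+ 2 = 1 -> 1 + u != 0 ->
  measurable_fun setT F -> (forall p, 0 <= F p)%E ->
  (\int[(mu \x mu)%E]_p F ((u * p.1 - v * p.2)%R, (v * p.1 + u * p.2)%R) =
   \int[(mu \x mu)%E]_p F p)%E.
Proof.
(* [t] is the tangent of half the angle: the vertical shear by [v] between two horizontal shears by
   [- t] is the rotation. *)
move=> uv u1 mF F0; pose t := v / (1 + u).
rewrite -(integral_shear1 (- t) mF F0).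
pose F1 p := F ((p.1 + - t * p.2)%R, p.2).
have mF1 : measurable_fun setT F1.
  have /= := measurableT_comp mF (measurable_lin 1 (- t) 0 1).
  by under [X in measurable_fun _ X -> _]eq_fun => p do rewrite /= !mul1r mul0r add0r.
have F10 p : (0 <= F1 p)%E by exact: F0.
rewrite -[RHS](integral_shear2 v mF1 F10).
pose F2 p := F1 (p.1, (p.2 + v * p.1)%R).
have mF2 : measurable_fun setT F2.
  have /= := measurableT_comp mF1 (measurable_lin 1 0 v 1).
  by under [X in measurable_fun _ X -> _]eq_fun => p do rewrite /= !mul1r mul0r addr0 addrC.
have F20 p : (0 <= F2 p)%E by exact: F10.
rewrite -[RHS](integral_shear1 (- t) mF2 F20).
have v2 : v ^+ 2 = 1 - u ^+ 2 by rewrite -uv; ring.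
have uE : u = 1 - t * v.
  apply: (mulfI u1); have -> : (1 + u) * (1 - t * v) = 1 + u - v ^+ 2 by rewrite /t; field.
  by rewrite v2; ring.
have vE : v = t * (1 + u) by rewrite /t divfK.
apply: eq_integral => p _; rewrite /F2 /F1 /=; congr (F (_, _)); last first.
  by transitivity (v * p.1 + (1 - t * v) * p.2); [rewrite -uE|ring].
by transitivity ((1 - t * v) * p.1 - t * (1 + (1 - t * v)) * p.2); [rewrite -uE -vE|ring].
Qed.

End PlaneMeasure.

(** * Moments of the disc *)

Section Moments.
Variable R : realType.
Local Notation mu := (@lebesgue_measure R).
Local Notation T := (measurableTypeR R * measurableTypeR R)%type.

Definition sqn (p : T) : R := p.1 ^+ 2 + p.2 ^+ 2.
(** The index is the squared radius, which makes the area linear and the moments monomial in [t]. *)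
Definition sqdisc (t : R) : set T := [set p | sqn p < t].

Lemma sqn_ge0 p : 0 <= sqn p.
Proof. by rewrite addr_ge0 ?sqr_ge0. Qed.

Lemma measurable_sqn : measurable_fun setT sqn.
Proof. by apply: measurable_funD; exact: measurable_funX. Qed.

Lemma measurable_sqdisc t : measurable (sqdisc t).
Proof.
rewrite (_ : sqdisc t = setT `&` sqn @^-1` `]-oo, t[%classic).
  exact: (measurable_sqn measurableT (measurable_itv _)).
by rewrite setTI; apply/seteqP; split => p /=; rewrite in_itv.
Qed.

(** The substitution [x = r sin t] turns the integrand into [2 r^2 cos^2 t], with primitive
    [r^2 (t + sin t cos t)]. *)
Lemma integral_semicircle (r : R) : 0 < r ->
  (\int[mu]_(x in `[(- r)%R, r]) (2 * Num.sqrt (r ^+ 2 - x ^+ 2))%:E = (pi * r ^+ 2)%:E)%E.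
Proof.
move=> r0; pose F (t : R) := r * sin t.
have pi2 : (- (pi / 2) : R) < pi / 2 by have := pi_gt0 R; lra.
have dF (t : R) : is_derive t 1 F (r * cos t).
  have : is_derive t 1 (r \*: @sin R) (r *: cos t) by exact: is_deriveZ.
  by [].
have F'E : F^`()%classic = fun t => r * cos t.
  by apply/funext => t; rewrite derive1E; apply: derive_val.
have cF : continuous F.
  by move=> t; apply: differentiable_continuous; apply/derivable1_diffP; apply: ex_derive.
have Fb : F (pi / 2) = r by rewrite /F sin_pihalf mulr1.
have Fa : F (- (pi / 2)) = - r by rewrite /F sinN sin_pihalf mulrN1.
have ccos : continuous (fun t : R => r * cos t).
  by move=> t; apply: cvgM; [exact: cvg_cst|exact: continuous_cos].
have := @integration_by_substitution_increasing R F (fun x => 2 * Num.sqrt (r ^+ 2 - x ^+ 2)) (- (pi / 2)) (pi / 2) (ltW pi2).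
rewrite Fa Fb => ->; last first.
- apply: continuous_subspaceT => x; apply: cvgM; first exact: cvg_cst.
  apply: continuous_comp; last exact: sqrt_continuous.
  by apply: cvgB; [exact: cvg_cst|exact: exprn_continuous].
- split.
  + by move=> t _; exact: ex_derive.
  + by apply: cvg_at_right_filter; exact: cF.
  + by apply: cvg_at_left_filter; exact: cF.
- rewrite F'E; apply/cvg_ex; exists (r * cos (pi / 2)).
  by apply: cvg_at_left_filter; exact: ccos.
- rewrite F'E; apply/cvg_ex; exists (r * cos (- (pi / 2))).
  by apply: cvg_at_right_filter; exact: ccos.
- by rewrite F'E => t _; exact: ccos.
- by move=> x y xI yI xy; rewrite /F ltr_pM2l// ltr_sin.
rewrite F'E.
pose H (t : R) := r ^+ 2 * (t + sin t * cos t).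
have dH (t : R) : is_derive t 1 H (2 * r ^+ 2 * cos t ^+ 2).
  have : is_derive t 1 (r ^+ 2 \*: (@id R + (@sin R * @cos R))) (r ^+ 2 *: (1 + (sin t *: (- sin t) + cos t *: cos t))).
    exact: (is_deriveZ _ (is_deriveD (is_derive_id _ _) (is_deriveM (is_derive_sin t) (is_derive_cos t)))).
  rewrite /GRing.scale /= (_ : r ^+ 2 * _ = 2 * r ^+ 2 * cos t ^+ 2)//.
  have := cos2Dsin2 t => E; have -> : sin t * - sin t = cos t ^+ 2 - 1 by rewrite -E; ring.
  ring.
transitivity (\int[mu]_(t in `[(- (pi / 2))%R, (pi / 2)%R]) (2 * r ^+ 2 * cos t ^+ 2)%:E)%E.
  apply: eq_integral => t; rewrite inE /= in_itv /= => tI; congr EFin.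
  rewrite -[LHS]/(2 * Num.sqrt (r ^+ 2 - F t ^+ 2) * (r * cos t)).
  have -> : r ^+ 2 - F t ^+ 2 = (r * cos t) ^+ 2.
    by rewrite /F !exprMn cos2sin2; ring.
  rewrite sqrtr_sqr ger0_norm; first by ring.
  by rewrite mulr_ge0 ?(ltW r0)// cos_ge0_pihalf.
rewrite (@continuous_FTC2 _ _ H)//.
- rewrite /H sinN cosN sin_pihalf cos_pihalf !mulr0 !addr0 -EFinB; congr EFin; lra.
- apply: continuous_subspaceT => t; apply: cvgM; first exact: cvg_cst.
  by apply: cvgM; exact: continuous_cos.
- have cH : continuous H.
    by move=> t; apply: differentiable_continuous; apply/derivable1_diffP; apply: ex_derive.
  split.
  + by move=> t _; exact: ex_derive.
  + by apply: cvg_at_right_filter; exact: cH.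
  + by apply: cvg_at_left_filter; exact: cH.
- by move=> t _; rewrite derive1E; apply: derive_val.
Qed.

(** Where [t <= x ^+ 2] the square root is [0] and the interval is empty, so one formula covers
    every [x]. *)
Lemma xsection_sqdisc (t x : R) : xsection (sqdisc t) x =
  `](- Num.sqrt (t - x ^+ 2)), (Num.sqrt (t - x ^+ 2))[%classic.
Proof.
apply/seteqP; split => y.
  move/xsectionP; rewrite /sqdisc /sqn /= in_itv /= => H.
  by rewrite -ltr_norml -sqrtr_sqr ltr_sqrt; have := sqr_ge0 y; lra.
rewrite /= in_itv /= -ltr_norml => H; apply/xsectionP; rewrite /sqdisc /sqn /=.
have t0 : 0 < t - x ^+ 2 by rewrite -sqrtr_gt0; apply: le_lt_trans H.
by move: H; rewrite -sqrtr_sqr ltr_sqrt//; lra.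
Qed.

Lemma sqdisc_area (t : R) : 0 <= t -> (mu \x mu)%E (sqdisc t) = (pi * t)%:E.
Proof.
rewrite le_eqVlt => /predU1P[<-|t0].
  rewrite mulr0 (_ : sqdisc 0 = set0) ?measure0//.
  by apply/seteqP; split => p //; rewrite /sqdisc /= ltNge sqn_ge0.
have r0 : 0 < Num.sqrt t by rewrite sqrtr_gt0.
have := integral_semicircle r0; rewrite sqr_sqrtr ?(ltW t0)// => <-.
rewrite integral_mkcond /product_measure1 /=; apply: eq_integral => x _.
rewrite /= xsection_sqdisc lebesgue_measure_itv /= lte_fin patchE.
have s0 := sqrtr_ge0 (t - x ^+ 2).
have -> : (if - Num.sqrt (t - x ^+ 2) < Num.sqrt (t - x ^+ 2) then
  ((Num.sqrt (t - x ^+ 2))%:E - (- Num.sqrt (t - x ^+ 2))%:E)%E else 0%E) = (2 * Num.sqrt (t - x ^+ 2))%:E.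
  case: ltP => H; first by rewrite -EFinB; congr EFin; ring.
  have -> : Num.sqrt (t - x ^+ 2) = 0 by lra.
  by rewrite mulr0.
case: ifPn => //; rewrite notin_setE /= in_itv /= => /negP.
rewrite -ler_norml -ltNge => H; rewrite ler0_sqrtr ?mulr0//.
rewrite subr_le0 -(sqr_sqrtr (ltW t0)) -[leRHS]real_normK ?num_real//.
by rewrite ler_sqr ?nnegrE ?(ltW r0)// ltW.
Qed.

(** Over [m + 1] equal steps the bounds telescope to [(h t - h 0) * t / (m + 1)], which is
    arbitrarily small. *)
Lemma constant_of_small_increments (D h : R -> R) (t : R) : 0 <= t ->
  (forall x y, 0 <= x -> x <= y -> y <= t -> `|D y - D x| <= (h y - h x) * (y - x)) -> D t = D 0.
Proof.
move=> t0 H.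
have key m : `|D t - D 0| * m.+1%:R <= (h t - h 0) * t.
  pose d := t / m.+1%:R; have d0 : 0 <= d by rewrite divr_ge0.
  have m0 : (m.+1%:R : R) != 0 by rewrite pnatr_eq0.
  have dm : m.+1%:R * d = t by rewrite /d mulrC divfK.
  have tel (G : R -> R) : G t - G 0 = \sum_(0 <= i < m.+1) (G (i.+1%:R * d) - G (i%:R * d)).
    by rewrite (telescope_sumr (fun i => G (i%:R * d)))// dm mul0r.
  have {3}-> : t = d * m.+1%:R by rewrite mulrC.
  rewrite mulrA ler_wpM2r// !tel mulr_suml.
  apply: le_trans (ler_norm_sum _ _ _) _; rewrite [leLHS]big_nat_cond [leRHS]big_nat_cond.
  apply: ler_sum => i; rewrite andbT /= => im.
  rewrite [X in _ <= _ * X](_ : d = i.+1%:R * d - i%:R * d); last first.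
    by rewrite -mulrBl -natr1 addrAC subrr add0r mul1r.
  apply: H.
  - by rewrite mulr_ge0.
  - by rewrite ler_wpM2r// ler_nat.
  - by rewrite -dm ler_wpM2r// ler_nat.
apply/eqP; rewrite -subr_eq0 -normr_le0 leNgt; apply/negP => D0.
set N := `|D t - D 0| in key D0.
have A0 : 0 <= (h t - h 0) * t / N.
  by rewrite divr_ge0 ?(ltW D0)// (le_trans _ (key 0%N))// mulr1 ltW.
have := archi_boundP A0; set m := Num.Def.archi_bound _.
rewrite ltr_pdivrMr// => Hm; have := key m; rewrite mulrC -natr1.
by move: Hm D0; lra.
Qed.

Lemma exprn_increment_bounds (x y : R) n : 0 <= x <= y ->
  n.+1%:R * x ^+ n * (y - x) <= y ^+ n.+1 - x ^+ n.+1 <= n.+1%:R * y ^+ n * (y - x).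
Proof.
move=> /andP[x0 xy]; have y0 : 0 <= y by apply: le_trans xy.
have yx : 0 <= y - x by rewrite subr_ge0.
rewrite subrXX ![_ * (y - x)]mulrC; apply/andP; split; apply: ler_wpM2l => //.
  rewrite -[X in X%:R]card_ord mulr_natl -sumr_const; apply: ler_sum => i _.
  have -> : x ^+ n = x ^+ (n.+1.-1 - i) * x ^+ i by rewrite -exprD subnK// -ltnS.
  by rewrite ler_wpM2r ?exprn_ge0// lerXn2r.
rewrite -[X in X%:R]card_ord mulr_natl -sumr_const; apply: ler_sum => i _.
have -> : y ^+ n = y ^+ (n.+1.-1 - i) * y ^+ i by rewrite -exprD subnK// -ltnS.
by rewrite ler_wpM2l ?exprn_ge0// lerXn2r.
Qed.

(** The integral over an annulus lies between the extreme values of the integrand times the area,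
    and the increment of the claimed formula lies between the same bounds. The difference of the two
    therefore satisfies [constant_of_small_increments] with [h s = pi * s ^+ n]. *)
Lemma sqdisc_moment n (t : R) : 0 <= t ->
  (\int[(mu \x mu)%E]_(p in sqdisc t) (sqn p ^+ n)%:E = (pi * t ^+ n.+1 / n.+1%:R)%:E)%E.
Proof.
move=> t0; pose J (s : R) := (\int[(mu \x mu)%E]_(p in sqdisc s) (sqn p ^+ n)%:E)%E.
have mg D : measurable_fun D (fun p => (sqn p ^+ n)%:E).
  by apply: measurable_funTS; apply/measurable_EFinP; exact: (measurable_funX _ measurable_sqn).
have g0 p : (0 <= (sqn p ^+ n)%:E)%E by rewrite lee_fin exprn_ge0// sqn_ge0.
have mD := measurable_sqdisc.
have J0 s : (0 <= J s)%E by apply: integral_ge0.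
have ann s u : 0 <= s <= u -> ((s ^+ n * (pi * (u - s)))%:E + J s <= J u <= (u ^+ n * (pi * (u - s)))%:E + J s)%E.
  move=> /andP[s0 su]; have u0 : 0 <= u by apply: le_trans su.
  have sub : sqdisc s `<=` sqdisc u by move=> p; rewrite /sqdisc /=; move/lt_le_trans; apply.
  have mA : measurable (sqdisc u `\` sqdisc s) by apply: measurableD.
  have JE : (J u = \int[(mu \x mu)%E]_(p in sqdisc u `\` sqdisc s) (sqn p ^+ n)%:E + J s)%E.
    rewrite /J -ge0_integral_setU//; last first.
      by rewrite disj_set2E setDE -setIA setICl setI0.
    by rewrite setDKU.
  have area : (mu \x mu)%E (sqdisc u `\` sqdisc s) = (pi * (u - s))%:E.
    have ltoo : ((mu \x mu)%E (sqdisc u) < +oo)%E by rewrite sqdisc_area// ltry.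
    etransitivity; first exact: (measureD (mD u) (mD s) ltoo).
    rewrite setIidr//; etransitivity.
      exact: (congr2 (fun a b => a - b)%E (sqdisc_area u0) (sqdisc_area s0)).
    by rewrite -EFinB -mulrBr.
  rewrite JE; apply/andP; split; apply: leeD2r; rewrite EFinM -area -integral_cst//; apply: ge0_le_integral => //.
  - by move=> p _; rewrite lee_fin exprn_ge0.
  - move=> p [_ /negP]; rewrite -leNgt => sp.
    by rewrite lee_fin lerXn2r// nnegrE ?sqn_ge0.
  - move=> p [pu _]; rewrite lee_fin lerXn2r ?nnegrE ?sqn_ge0//.
    exact: ltW.
have J00 : J 0 = 0%E.
  rewrite /J (_ : sqdisc 0 = set0) ?integral_set0//.
  by apply/seteqP; split => p //; rewrite /sqdisc /= ltNge sqn_ge0.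
have Jfin s : 0 <= s -> J s \is a fin_num.
  move=> s0; have := ann 0 s; rewrite lexx s0 J00 adde0 adde0 => /(_ isT)/andP[_ H].
  by rewrite ge0_fin_numE// (le_lt_trans H)// ltry.
pose D s := fine (J s) - pi * s ^+ n.+1 / n.+1%:R.
have n0 : (n.+1%:R : R) != 0 by rewrite pnatr_eq0.
have : D t = D 0.
  apply: (@constant_of_small_increments D (fun s => pi * s ^+ n)) => // x y x0 xy yt.
  have y0 : 0 <= y by apply: le_trans xy.
  have := ann x y; rewrite x0 xy => /(_ isT).
  rewrite -(fineK (Jfin x x0)) -(fineK (Jfin y y0)) -!EFinD !lee_fin => /andP[H1 H2].
  have := @exprn_increment_bounds x y n; rewrite x0 xy => /(_ isT)/andP[H3 H4].
  have pi0 : 0 <= pi / n.+1%:R :> R by rewrite divr_ge0// pi_ge0.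
  have := ler_wpM2l pi0 H3; have := ler_wpM2l pi0 H4.
  have -> : pi / n.+1%:R * (n.+1%:R * y ^+ n * (y - x)) = y ^+ n * (pi * (y - x)) by field.
  have -> : pi / n.+1%:R * (n.+1%:R * x ^+ n * (y - x)) = x ^+ n * (pi * (y - x)) by field.
  have -> : D y - D x = (fine (J y) - fine (J x)) - pi / n.+1%:R * (y ^+ n.+1 - x ^+ n.+1) by rewrite /D; ring.
  set Q := pi / n.+1%:R * _; move: H1 H2.
  set A := x ^+ n * (pi * _); set B := y ^+ n * (pi * _).
  have -> : (pi * y ^+ n - pi * x ^+ n) * (y - x) = B - A by rewrite /A /B; ring.
  by rewrite ler_norml => *; apply/andP; split; lra.
rewrite {2}/D J00 /= expr0n /= mulr0 mul0r subr0 => /subr0_eq H.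
by rewrite -H fineK// Jfin.
Qed.

End Moments.

(** * Area of the image of a disc *)

Section AreaFormula.
Variable R : realType.
Local Notation mu := (@lebesgue_measure R).
Local Notation T := (measurableTypeR R * measurableTypeR R)%type.
Implicit Types (F : cplx R -> \bar R) (G : T -> cplx R).

Definition pt (p : T) : cplx R := cmk p.1 p.2.

Lemma modulus_pt p : modulus (pt p) ^+ 2 = sqn p.
Proof. by rewrite modulus_sqr. Qed.

Definition cmeasurable G := measurable_fun setT (@cre R \o G) /\ measurable_fun setT (@cim R \o G).

Lemma cmeasurable_pt : cmeasurable pt.
Proof. by split; [exact: measurable_fst|exact: measurable_snd]. Qed.

Lemma cmeasurable_cst c : cmeasurable (fun=> c).
Proof. by split; exact: measurable_cst. Qed.

Lemma cmeasurableD G1 G2 : cmeasurable G1 -> cmeasurable G2 -> cmeasurable (fun p => G1 p + G2 p).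
Proof.
move=> [r1 i1] [r2 i2]; split.
  rewrite (_ : _ \o _ = (@cre R \o G1) \+ (@cre R \o G2)); first exact: measurable_funD.
  by apply/funext => p; rewrite /= raddfD.
rewrite (_ : _ \o _ = (@cim R \o G1) \+ (@cim R \o G2)); first exact: measurable_funD.
by apply/funext => p; rewrite /= raddfD.
Qed.

Lemma cmeasurableM G1 G2 : cmeasurable G1 -> cmeasurable G2 -> cmeasurable (fun p => G1 p * G2 p).
Proof.
move=> [r1 i1] [r2 i2]; split.
  rewrite (_ : _ \o _ = ((@cre R \o G1) \* (@cre R \o G2)) \- ((@cim R \o G1) \* (@cim R \o G2))).
    by apply: measurable_funB; exact: measurable_funM.
  by apply/funext => p; rewrite /= creM.
rewrite (_ : _ \o _ = ((@cre R \o G1) \* (@cim R \o G2)) \+ ((@cim R \o G1) \* (@cre R \o G2))).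
  by apply: measurable_funD; exact: measurable_funM.
by apply/funext => p; rewrite /= cimM.
Qed.

Lemma cmeasurableX G n : cmeasurable G -> cmeasurable (fun p => G p ^+ n).
Proof.
move=> mG; elim: n => [|n IH].
  rewrite (_ : (fun p => _) = fun=> 1); first exact: cmeasurable_cst.
  by apply/funext => p; rewrite expr0.
rewrite (_ : (fun p => _) = fun p => G p * G p ^+ n); first exact: cmeasurableM.
by apply/funext => p; rewrite exprS.
Qed.

Lemma cmeasurable_sum n (G : nat -> T -> cplx R) : (forall i, cmeasurable (G i)) ->
  cmeasurable (fun p => \sum_(i < n) G i p).
Proof.
move=> mG; elim: n => [|n IH].
  rewrite (_ : (fun p => _) = fun=> 0); first exact: cmeasurable_cst.
  by apply/funext => p; rewrite big_ord0.
rewrite (_ : (fun p => _) = fun p => \sum_(i < n) G i p + G n p); first exact: cmeasurableD.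
by apply/funext => p; rewrite big_ord_recr.
Qed.

Lemma measurable_modulus_sqr G : cmeasurable G -> measurable_fun setT (fun p => modulus (G p) ^+ 2).
Proof.
move=> [mr mi].
rewrite (_ : (fun p => _) = (fun p => (@cre R \o G) p ^+ 2) \+ (fun p => (@cim R \o G) p ^+ 2)).
  by apply: measurable_funD; exact: measurable_funX.
by apply/funext => p; rewrite modulus_sqr.
Qed.

(** Three shears handle every angle but the half-turn, which is the quarter-turn [i] applied
    twice. *)
Lemma integral_sqdisc_rotation (w : cplx R) F t : modulus w = 1 ->
  measurable_fun setT (F \o pt) -> (forall z, 0 <= F z)%E ->
  (\int[(mu \x mu)%E]_(p in sqdisc t) F (w * pt p)%R = \int[(mu \x mu)%E]_(p in sqdisc t) F (pt p))%E.
Proof.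
have half u F' : modulus u = 1 -> 1 + cre u != 0 -> measurable_fun setT (F' \o pt) ->
    (forall z, 0 <= F' z)%E ->
    (\int[(mu \x mu)%E]_(p in sqdisc t) F' (u * pt p)%R = \int[(mu \x mu)%E]_(p in sqdisc t) F' (pt p))%E.
  move=> u1 cu mF F0; rewrite integral_mkcond [RHS]integral_mkcond.
  have u2 : cre u ^+ 2 + cim u ^+ 2 = 1 by rewrite -modulus_sqr u1 expr1n.
  pose H : T -> \bar R := (F' \o pt) \_ (sqdisc t).
  have mH : measurable_fun setT H.
    exact: ((measurable_restrictT _ (measurable_sqdisc t)).1 (measurable_funTS mF)).
  have H0 p : (0 <= H p)%E by rewrite /H patchE; case: ifP => _; [exact: F0|exact: lexx].
  rewrite -[RHS](integral_rotation_half u2 cu mH H0); apply: eq_integral => p _.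
  rewrite /H !patchE /=.
  have ptE : pt (cre u * p.1 - cim u * p.2, cim u * p.1 + cre u * p.2) = u * pt p.
    rewrite -[in RHS](cmkE u) /pt /cmk; apply/eqP; rewrite eq_complex /=.
    by rewrite [_ + cre u * p.2]addrC !eqxx.
  have mE : ((cre u * p.1 - cim u * p.2, cim u * p.1 + cre u * p.2) \in sqdisc t) = (p \in sqdisc t).
    by rewrite /sqdisc !mem_setE -!topredE /= /in_set /= -!modulus_pt ptE modulusM u1 mul1r.
  by rewrite ptE mE.
move=> w1 mF F0; have [w0|] := eqVneq (1 + cre w) 0; last by move=> w0; exact: half.
pose i : cplx R := cmk 0 1.
have i1 : modulus i = 1 by apply/eqP; rewrite -(@pexpr_eq1 _ _ 2) ?modulus_ge0// modulus_sqr /= expr0n expr1n add0r.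
have ci : 1 + cre i != 0 by rewrite /= addr0 oner_eq0.
have wE : w = i * i.
  have H : cre w = -1 by apply/eqP; rewrite -addr_eq0 addrC w0.
  have : cim w ^+ 2 = 0.
    have := modulus_sqr w; rewrite w1 H sqrrN !expr1n; lra.
  move=> /eqP; rewrite sqrf_eq0 => /eqP Hi; rewrite -(cmkE w) H Hi /i /cmk.
  by apply/eqP; rewrite eq_complex /= !mul0r !mulr0 !mul1r sub0r addr0 !eqxx.
have mFi : measurable_fun setT ((fun z => F (i * z)) \o pt).
  have E : (fun z => F (i * z)) \o pt =
      (F \o pt) \o (fun p : T => (0 * p.1 + (-1) * p.2, 1 * p.1 + 0 * p.2)).
    apply/funext => p /=; congr (F _); rewrite /pt /i /cmk /=.
    by apply/eqP; rewrite eq_complex /=; apply/andP; split; apply/eqP; ring.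
  rewrite E; exact: measurableT_comp mF (measurable_lin 0 (-1) 1 0).
rewrite -(half i F)// -[RHS](half i (fun z => F (i * z)))//.
by apply: eq_integral => p _; rewrite wE mulrA.
Qed.

(** By rotation invariance, [N] times the integral is the sum over the rotations by powers of [z].
    Under the integral, [discrete_parseval] removes the cross terms pointwise, and the moments of
    the disc remain. *)
Lemma integral_sqdisc_poly K (c : nat -> cplx R) t : 0 <= t ->
  (\int[(mu \x mu)%E]_(p in sqdisc t) (modulus (\sum_(j < K) c j * pt p ^+ j) ^+ 2)%:E =
   (\sum_(j < K) modulus (c j) ^+ 2 * (pi * t ^+ j.+1 / j.+1%:R))%:E)%E.
Proof.
move=> t0; have [z [z1 zN]] := exists_prim_root R K.
set N := (2 ^ K.+1)%N in zN.
have KN : (K <= N)%N by rewrite ltnW// (leq_trans (ltnSn _))// ltnW// ltn_expl.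
have N0 : N%:R != 0 :> R by rewrite pnatr_eq0 -lt0n expn_gt0.
pose F w := (modulus (\sum_(j < K) c j * w ^+ j) ^+ 2)%:E.
have cm w : cmeasurable (fun p => \sum_(j < K) c j * (w * pt p) ^+ j).
  apply: (@cmeasurable_sum K (fun j p => c j * (w * pt p) ^+ j)) => j.
  apply: cmeasurableM; first exact: cmeasurable_cst.
  apply: cmeasurableX; apply: cmeasurableM; [exact: cmeasurable_cst|exact: cmeasurable_pt].
have mF w : measurable_fun setT (fun p => F (w * pt p)).
  by apply/measurable_EFinP; exact: measurable_modulus_sqr.
have mF1 : measurable_fun setT (F \o pt).
  by have := mF 1; under [X in measurable_fun _ X -> _]eq_fun => p do rewrite mul1r.
have F0 w : (0 <= F w)%E by rewrite lee_fin sqr_ge0.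
have mD := @measurable_sqdisc R t.
set I := (LHS).
have inj (a b : \bar R) : (N%:R%:E * a = N%:R%:E * b -> a = b)%E.
  move=> /(congr1 (fun x => (N%:R^-1)%:E * x)%E).
  by rewrite !muleA -EFinM mulVf// !mul1e.
apply: inj.
transitivity (\sum_(k < N) (\int[(mu \x mu)%E]_(p in sqdisc t) F (z ^+ k * pt p)%R))%E.
  have -> : (N%:R%:E = \sum_(k < N) 1 :> \bar R)%E by rewrite sumEFin sumr_const card_ord.
  rewrite ge0_sume_distrl//; apply: eq_bigr => k _; rewrite mul1e.
  by apply/esym/integral_sqdisc_rotation => //; rewrite modulusX z1 expr1n.
etransitivity.
  exact/esym/(@ge0_integral_sum _ _ _ _ _ mD _ (fun (k : 'I_N) p => F (z ^+ k * pt p))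
    (fun k => measurable_funTS (mF _)) (fun k p _ => F0 _)).
transitivity (\int[(mu \x mu)%E]_(p in sqdisc t) \sum_(j < K) ((N%:R * modulus (c j) ^+ 2)%:E * (sqn p ^+ j)%:E))%E.
  apply: eq_integral => p _; rewrite /F sumEFin (discrete_parseval _ _ zN z1 KN) mulr_sumr -sumEFin.
  apply: eq_bigr => j _; rewrite -EFinM; congr EFin.
  by rewrite exprM modulus_pt mulrA.
have mg j : measurable_fun (sqdisc t) (fun p => (sqn p ^+ j)%:E).
  by apply: measurable_funTS; apply/measurable_EFinP; exact: (measurable_funX _ (@measurable_sqn R)).
have g0 j p : (0 <= (sqn p ^+ j)%:E)%E by rewrite lee_fin exprn_ge0// sqn_ge0.
rewrite ge0_integral_sum//.
- rewrite -EFinM mulr_sumr -sumEFin; apply: eq_bigr => j _.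
  rewrite ge0_integralZl_EFin//; last by rewrite mulr_ge0// exprn_ge0 ?modulus_ge0.
  by rewrite sqdisc_moment// -EFinM; congr EFin; rewrite -!mulrA.
- by move=> j; apply: measurable_funeM; exact: mg.
- by move=> j p _; rewrite mule_ge0// lee_fin mulr_ge0// exprn_ge0 ?modulus_ge0.
Qed.

(** Dominated convergence from the polynomial case: since [r < s], the partial sums have a geometric
    majorant on the disc and are bounded by [B]. *)
Lemma integral_sqdisc_ps g (d : nat -> cplx R) s r : 0 <= r < s -> has_ps g 0 s d ->
  (fun K => (\sum_(j < K) modulus (d j) ^+ 2 * (pi * (r ^+ 2) ^+ j.+1 / j.+1%:R))%:E) @ \oo -->
  (\int[(mu \x mu)%E]_(p in sqdisc (r ^+ 2)) (modulus (g (pt p)) ^+ 2)%:E)%E.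
Proof.
move=> rs gd; have [M [q [M0 q01 HM]]] := has_ps_dom gd rs.
have r0 : 0 <= r by case/andP: rs.
have r20 : 0 <= r ^+ 2 by rewrite exprn_ge0.
pose f (K : nat) (p : T) := (modulus (\sum_(j < K) d j * pt p ^+ j) ^+ 2)%:E.
pose B := M / (1 - q).
have mD := @measurable_sqdisc R (r ^+ 2).
have inD p : sqdisc (r ^+ 2) p -> modulus (pt p) < r.
  by rewrite /sqdisc /= -modulus_pt ltr_sqr ?nnegrE ?modulus_ge0.
have mf K : measurable_fun (sqdisc (r ^+ 2)) (f K).
  apply: measurable_funTS; apply/measurable_EFinP; apply: measurable_modulus_sqr.
  apply: (@cmeasurable_sum K (fun j p => d j * pt p ^+ j)) => j.
  apply: cmeasurableM; first exact: cmeasurable_cst.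
  by apply: cmeasurableX; exact: cmeasurable_pt.
have cvf p : sqdisc (r ^+ 2) p -> f ^~ p @ \oo --> (modulus (g (pt p)) ^+ 2)%:E.
  move=> /inD pr; apply: cvg_EFin; first exact: nearW.
  have : (fun K => modulus (series (fun n => d n * pt p ^+ n) K)) @ \oo --> modulus (g (0 + pt p)).
    by apply: cvg_modulus; apply: gd; apply: lt_trans pr _; case/andP: rs.
  rewrite add0r => H; have H2 := cvgM H H.
  rewrite (_ : fine \o _ = (fun K => modulus (series (fun n => d n * pt p ^+ n) K)) \*
     (fun K => modulus (series (fun n => d n * pt p ^+ n) K))); first exact: H2.
  by apply/funext => K; rewrite /f /series /= big_mkord.
have bf K p : sqdisc (r ^+ 2) p -> modulus (\sum_(j < K) d j * pt p ^+ j) <= B.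
  move=> /inD pr; apply: le_trans (modulus_sum _ _ _) _.
  apply: (@le_trans _ _ (\sum_(0 <= j < K) M * q ^+ j)).
    rewrite big_mkord; apply: ler_sum => j _; rewrite modulusM modulusX; apply: le_trans (HM j).
    by rewrite ler_wpM2l ?modulus_ge0// lerXn2r// ?nnegrE ?modulus_ge0// ltW.
  rewrite -mulr_sumr /B ler_wpM2l//; have := @sum_geo_le _ q 0 K q01.
  by rewrite expr0 mul1r.
have mlim := emeasurable_fun_cvg _ _ mf cvf.
have intB : (mu \x mu)%E.-integrable (sqdisc (r ^+ 2)) (cst (B ^+ 2)%:E).
  apply/integrableP; split; first exact: measurable_cst.
  rewrite (_ : (fun p => `|cst (B ^+ 2)%:E p|%E) = cst (B ^+ 2)%:E); last first.
    by apply/funext => p /=; rewrite ger0_norm// sqr_ge0.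
  have -> : (\int[(mu \x mu)%E]_(p in sqdisc (r ^+ 2)) cst (B ^+ 2)%:E p = (B ^+ 2)%:E * (pi * r ^+ 2)%:E)%E.
    by etransitivity; [exact: integral_cst|congr (_ * _)%E; exact: sqdisc_area].
  by rewrite -EFinM ltry.
have aecv : {ae (mu \x mu)%E, forall p, sqdisc (r ^+ 2) p -> f ^~ p @ \oo --> (modulus (g (pt p)) ^+ 2)%:E}.
  exact: aeW.
have aeb : {ae (mu \x mu)%E, forall p, forall K, sqdisc (r ^+ 2) p -> (`|f K p| <= cst (B ^+ 2)%:E p)%E}.
  apply: aeW => p K Dp; rewrite /f /= ger0_norm ?sqr_ge0// lee_fin.
  by rewrite ler_sqr ?nnegrE ?modulus_ge0 ?bf// (le_trans (modulus_ge0 _) (bf K p Dp)).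
have [_ _] := dominated_convergence mD mf mlim aecv intB aeb.
rewrite (_ : [sequence _]_K = (fun K => (\sum_(j < K) modulus (d j) ^+ 2 * (pi * (r ^+ 2) ^+ j.+1 / j.+1%:R))%:E))//.
by apply/funext => K; exact: integral_sqdisc_poly.
Qed.

Lemma area_SE f r : 0 <= r ->
  area_S f r = (\int[(mu \x mu)%E]_(p in sqdisc (r ^+ 2)) (modulus (derive1 f (pt p)) ^+ 2)%:E)%E.
Proof.
move=> r0; rewrite /area_S; congr (integral _ _ _); apply/seteqP; split => p;
  by rewrite /sqdisc /= -modulus_pt ltr_sqr ?nnegrE ?modulus_ge0.
Qed.

End AreaFormula.

(** * The upper bound *)

Section UpperBound.
Variable R : realType.
Implicit Types (z w : cplx R) (f : cplx R -> cplx R).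

Local Notation rho := (bohr_radius R).
Local Notation lam := (bohr_lambda R).

Lemma bohr_radius_eq : 2 * rho ^+ 2 + 3 * rho = 1.
Proof.
have : Num.sqrt 17 ^+ 2 = 17 :> R by rewrite sqr_sqrtr.
rewrite /bohr_radius; set s := Num.sqrt 17 => s2.
transitivity ((s ^+ 2 - 9) / 8); first by field.
by rewrite s2; lra.
Qed.

(** The upper bound is chosen below [29 / 103], the zero of the last coefficient of the cubic in
    [bohr_real_inequality_at_radius]. *)
Lemma bohr_radius_bounds : 28 / 100 < rho < 281 / 1000.
Proof.
have E := bohr_radius_eq.
have r0 : 0 <= rho.
  rewrite /bohr_radius divr_ge0// subr_ge0 -(@ger0_norm R 3)// -sqrtr_sqr ler_wsqrtr//; lra.
by apply/andP; split; rewrite ltNge; apply/negP => H; nra.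
Qed.

(** Since [sqrt 17 = 4 rho + 3], the radius becomes the only irrational quantity, and its quadratic
    equation reduces every power of it to degree one. *)
Lemma bohr_lambdaE : lam = (23 - 43 * rho) / 16.
Proof. by rewrite /bohr_lambda /bohr_radius; field. Qed.

Lemma bohr_lambda_ge0 : 0 <= lam.
Proof. by rewrite bohr_lambdaE; have := bohr_radius_bounds => /andP[? ?]; lra. Qed.

Lemma nneseries_cvg (u : nat -> R) k : (forall n, 0 <= u n) ->
  (fun N => (\sum_(k <= n < N) u n)%:E) @ \oo --> (\sum_(k <= n <oo) (u n)%:E)%E.
Proof.
move=> u0; rewrite (_ : (fun N => _) = (fun N => \sum_(k <= n < N) (u n)%:E)%E).
  by apply: is_cvg_nneseries => n _ _; rewrite lee_fin.
by apply/funext => N; rewrite sumEFin.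
Qed.

Lemma sum_linear_geometric (x : R) K :
  (\sum_(j < K) j.+1%:R * x ^+ j) * (1 - x) ^+ 2 = 1 - x ^+ K * (1 + K%:R * (1 - x)).
Proof.
elim: K => [|K IH]; first by rewrite big_ord0 mul0r expr0 mul0r addr0 mulr1 subrr.
by rewrite big_ord_recr mulrDl IH /= [x ^+ K.+1]exprS -natr1; ring.
Qed.

Lemma area_S_cvg f a r : 0 <= r < 1 -> has_ps f 0 1 a ->
  (fun K => (\sum_(j < K) pi * (j.+1%:R * modulus (a j.+1) ^+ 2 * (r ^+ 2) ^+ j.+1))%:E) @ \oo --> area_S f r.
Proof.
move=> r01 fa; rewrite area_SE; last by case/andP: r01.
have := integral_sqdisc_ps r01 (has_ps_derive fa).
rewrite (_ : (fun K => _) = (fun K => (\sum_(j < K) pi * (j.+1%:R * modulus (a j.+1) ^+ 2 * (r ^+ 2) ^+ j.+1))%:E))//.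
apply/funext => K; congr EFin; apply: eq_bigr => j _.
rewrite modulusM -(rmorph_nat (@cofr R)) modulus_cofr ger0_norm//.
by field; rewrite addrC natr1 pnatr_eq0.
Qed.

Lemma area_S_le f a r (A : R) : 0 <= r < 1 -> has_ps f 0 1 a ->
  (forall n, modulus (a n.+1) <= A) ->
  (area_S f r * (pi^-1)%:E <= (A ^+ 2 * r ^+ 2 / (1 - r ^+ 2) ^+ 2)%:E)%E.
Proof.
move=> r01 fa aA; have [r0 r1] := andP r01.
have A0 : 0 <= A by apply: le_trans (aA 0%N); exact: modulus_ge0.
have x0 : 0 <= r ^+ 2 by rewrite exprn_ge0.
have x1 : r ^+ 2 < 1 by rewrite expr_lt1.
have H := cvgeZr (y := (pi^-1)%:E) isT (area_S_cvg r01 fa).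
apply: cvge_le H; apply: nearW => K; rewrite -EFinM lee_fin.
have p0 : (pi : R) != 0 by rewrite gt_eqF// pi_gt0.
rewrite -mulr_sumr mulrAC mulfV// mul1r ler_pdivlMr ?exprn_gt0 ?subr_gt0//.
apply: (@le_trans _ _ (A ^+ 2 * r ^+ 2 * ((\sum_(j < K) j.+1%:R * (r ^+ 2) ^+ j) * (1 - r ^+ 2) ^+ 2))).
  rewrite [leRHS]mulrA ler_wpM2r ?sqr_ge0// mulr_sumr; apply: ler_sum => j _.
  rewrite [X in _ <= X](_ : _ = j.+1%:R * A ^+ 2 * (r ^+ 2) ^+ j.+1); last by rewrite [_ ^+ j.+1]exprS; ring.
  by rewrite ler_wpM2r ?exprn_ge0// ler_wpM2l// ler_sqr ?nnegrE ?modulus_ge0.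
rewrite sum_linear_geometric ler_piMr ?mulr_ge0 ?sqr_ge0// gerBl.
by rewrite mulr_ge0 ?exprn_ge0// addr_ge0// mulr_ge0// subr_ge0 ltW.
Qed.

(** The bound on the functional after subtracting [1] and dividing by [1 - A]. At [A = 1] the two
    sides agree by the equation of [rho], and their derivatives in [A] agree by the value of [lam];
    hence the factor [(1 - A) ^+ 2] below. *)
Lemma bohr_real_inequality_at_radius (A : R) : 0 <= A <= 1 ->
  rho * (1 + A) / (1 + A * rho) ^+ 2 + (1 + A) * rho ^+ 2 / (1 - rho)
   + lam * (1 - A) * (1 + A) ^+ 2 * (rho ^+ 2 / (1 - rho ^+ 2) ^+ 2) <= (1 - rho) / (1 + A * rho).
Proof.
move=> /andP[A0 A1]; rewrite bohr_lambdaE.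
have E := bohr_radius_eq; have /andP[r1 r2] := bohr_radius_bounds.
move: E r1 r2; set r := rho => E r1 r2.
(* The quadratic equation turns both rational functions of [r] into linear ones; in [k2] this
   depends on the value of [lam]. *)
have k1 : r ^+ 2 / (1 - r) = (1 - 2 * r) / 4.
  apply/eqP; rewrite eqr_div ?pnatr_eq0//; last by rewrite subr_eq0 gt_eqF//; lra.
  by apply/eqP; lra.
have k2 : (23 - 43 * r) / 16 * (r ^+ 2 / (1 - r ^+ 2) ^+ 2) = (5 - 16 * r) / 8.
  have d : 1 - r ^+ 2 != 0 by rewrite gt_eqF//; nra.
  have e2 : r ^+ 2 = (1 - 3 * r) / 2 by lra.
  apply: (mulIf (expf_neq0 2 d)).
  have -> : (23 - 43 * r) / 16 * (r ^+ 2 / (1 - r ^+ 2) ^+ 2) * (1 - r ^+ 2) ^+ 2 = (23 - 43 * r) / 16 * r ^+ 2 by field.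
  rewrite e2; have : r * r = (1 - 3 * r) / 2 by rewrite -expr2 e2.
  have : r * r * r = r * ((1 - 3 * r) / 2) by rewrite -e2 expr2; ring.
  move=> ? ?; lra.
have -> : (1 + A) * r ^+ 2 / (1 - r) = (1 + A) * ((1 - 2 * r) / 4) by rewrite -k1 mulrA.
have -> : (23 - 43 * r) / 16 * (1 - A) * (1 + A) ^+ 2 * (r ^+ 2 / (1 - r ^+ 2) ^+ 2) =
   (1 - A) * (1 + A) ^+ 2 * ((5 - 16 * r) / 8) by rewrite -k2; ring.
have Ar : 0 < 1 + A * r by rewrite ltr_pwDl// mulr_ge0//; lra.
rewrite -subr_ge0.
have -> : (1 - r) / (1 + A * r) - (r * (1 + A) / (1 + A * r) ^+ 2 + (1 + A) * ((1 - 2 * r) / 4) +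
    (1 - A) * (1 + A) ^+ 2 * ((5 - 16 * r) / 8)) =
  ((1 - r) * (1 + A * r) - r * (1 + A) - (1 + A * r) ^+ 2 * ((1 + A) * ((1 - 2 * r) / 4) +
    (1 - A) * (1 + A) ^+ 2 * ((5 - 16 * r) / 8))) / (1 + A * r) ^+ 2 by field; rewrite gt_eqF.
apply: divr_ge0; last exact: sqr_ge0.
have -> : (1 - r) * (1 + A * r) - r * (1 + A) - (1 + A * r) ^+ 2 * ((1 + A) * ((1 - 2 * r) / 4) +
    (1 - A) * (1 + A) ^+ 2 * ((5 - 16 * r) / 8)) =
  (1 - A) ^+ 2 * ((1 / 8 + r / 2) + (11 / 8 - 17 / 4 * r) * A + (55 / 16 - 193 / 16 * r) * A ^+ 2
     + (29 / 16 - 103 / 16 * r) * A ^+ 3).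
  have e2 : r ^+ 2 = (1 - 3 * r) / 2 by lra.
  have e3 : r ^+ 3 = (11 * r - 3) / 4 by rewrite exprS e2; have := e2; rewrite expr2; lra.
  transitivity (1 - r - r + A * (r - r ^+ 2 - r) - (1 + 2 * A * r + A ^+ 2 * r ^+ 2) * (1 + A) / 4 *
       (1 - 2 * r) - (1 + A - A ^+ 2 - A ^+ 3) * ((5 - 16 * r) + 2 * A * (5 * r - 16 * r ^+ 2)
        + A ^+ 2 * (5 * r ^+ 2 - 16 * r ^+ 3)) / 8); first by field.
  have -> : (1 + 2 * A * r + A ^+ 2 * r ^+ 2) * (1 + A) / 4 * (1 - 2 * r) =
     ((1 - 2 * r) + 2 * A * (r - 2 * r ^+ 2) + A ^+ 2 * (r ^+ 2 - 2 * r ^+ 3)) * (1 + A) / 4 by field.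
  by rewrite e3 e2; field.
(* Within the bounds on [r], each coefficient of the cubic in [A] is nonnegative. *)
apply: mulr_ge0; first exact: sqr_ge0.
apply: addr_ge0; last by apply: mulr_ge0; [lra|exact: exprn_ge0].
apply: addr_ge0; last by apply: mulr_ge0; [lra|exact: exprn_ge0].
by apply: addr_ge0; [lra|apply: mulr_ge0; [lra|exact: A0]].
Qed.

(** Each term on the left grows with [r] while the right side decreases, so the case [r = rho]
    decides. *)
Lemma bohr_real_inequality (A r : R) : 0 <= A <= 1 -> 0 <= r <= rho ->
  r * (1 + A) / (1 + A * r) ^+ 2 + (1 + A) * r ^+ 2 / (1 - r)
   + lam * (1 - A) * (1 + A) ^+ 2 * (r ^+ 2 / (1 - r ^+ 2) ^+ 2) <= (1 - r) / (1 + A * r).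
Proof.
move=> A01 /andP[r0 rr]; have /andP[A0 A1] := A01.
have /andP[_ p1] := bohr_radius_bounds; have L0 := bohr_lambda_ge0.
have base := bohr_real_inequality_at_radius A01.
move: rr p1 L0 base; move: lam rho => L p rr p1 L0 base.
have Ar : 0 < 1 + A * r by rewrite ltr_pwDl// mulr_ge0//; lra.
have Ap : 0 < 1 + A * p by rewrite ltr_pwDl// mulr_ge0//; lra.
have r2 : r ^+ 2 <= p ^+ 2 by rewrite ler_sqr ?nnegrE//; lra.
have pp1 : p ^+ 2 < 1 by rewrite expr_lt1//; lra.
apply: (@le_trans _ _ ((1 - p) / (1 + A * p))); last first.
  rewrite ler_pdivrMr// mulrAC ler_pdivlMr//.
  have : 0 <= (p - r) * (1 + A) by rewrite mulr_ge0//; lra.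
  lra.
apply: le_trans base.
apply: lerD; first apply: lerD.
- rewrite ler_pdivrMr ?exprn_gt0// mulrAC ler_pdivlMr ?exprn_gt0//.
  have : 0 <= (1 + A) * ((p - r) * (1 - A ^+ 2 * (r * p))).
    rewrite mulr_ge0//; first lra.
    rewrite mulr_ge0//; first lra.
    have rr1 : r * p <= 1 by rewrite mulr_ile1//; lra.
    have rr0 : 0 <= r * p by rewrite mulr_ge0//; lra.
    by rewrite subr_ge0 mulr_ile1 ?sqr_ge0 ?exprn_ile1.
  lra.
- rewrite -[leLHS]mulrA -[leRHS]mulrA ler_wpM2l//; first lra.
  have q1 : 0 < 1 - r by lra.
  have q2 : 0 < 1 - p by lra.
  apply: ler_pM; [by rewrite exprn_ge0|by rewrite invr_ge0 ltW|by []|].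
  by rewrite lef_pV2 ?posrE//; lra.
- apply: ler_wpM2l; first by rewrite !mulr_ge0 ?sqr_ge0 ?L0//; lra.
  apply: ler_pM; [by rewrite exprn_ge0|by rewrite invr_ge0 sqr_ge0|by []|].
  rewrite lef_pV2 ?posrE ?exprn_gt0 ?subr_gt0//; last by apply: le_lt_trans pp1.
  by rewrite ler_sqr ?nnegrE ?subr_ge0 ?(ltW pp1)//; lra.
Qed.

Lemma bohr_upper f z : bounded_class f -> modulus z <= rho -> (bohr_G lam f z <= 1)%E.
Proof.
move=> fB zr; have [a fa] := bounded_class_has_ps fB; have [_ f1] := fB.
have /andP[_ rho1] := bohr_radius_bounds.
have E := bohr_radius_eq.
rewrite /bohr_G; set r := modulus z in zr *.
have r0 : 0 <= r := modulus_ge0 z.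
have r1 : r < 1 by lra.
have r01 : 0 <= r < 1 by rewrite r0.
have -> : taylor_coef f = a by apply/funext => n; exact: taylor_coefE ltr01 fa.
pose x n := modulus (a n).
have x0 n : 0 <= x n := modulus_ge0 _.
have contr q K := contraction q K fa f1.
have xo l := carlson_odd l contr.
have xe l l0 := @carlson_even _ a l l0 contr.
have csum M N := coef_sum_le x0 r01 xo xe M N.
have cle n := coef_le_onem x0 xo xe (ltn0Sn n).
set S2 := (\sum_(2 <= n <oo) _)%E; set S1 := (\sum_(1 <= n <oo) _)%E.
set kap := (1 + modulus (a 0%N))^-1 + r / (1 - r).
pose A := x 0%N.
have A1 : A <= 1 by rewrite /A /x -(has_ps_at ltr01 fa); apply: f1; rewrite /unit_disc /mkset modulus0.
have A0 : 0 <= A := x0 0%N.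
have HS : (S2 + kap%:E * S1 <= ((1 - A ^+ 2) * r ^+ 2 / (1 - r))%:E)%E.
  have c2 : (fun N => (\sum_(2 <= n < N) x n * r ^+ n)%:E) @ \oo --> S2.
    by apply: nneseries_cvg => n; rewrite mulr_ge0 ?exprn_ge0.
  have c1 : (fun N => (\sum_(1 <= n < N) x n ^+ 2 * r ^+ (2 * n))%:E) @ \oo --> S1.
    by apply: nneseries_cvg => n; rewrite mulr_ge0 ?exprn_ge0.
  have c1' := cvgeZl (y := kap%:E) isT c1.
  have S20 : (0 <= S2)%E by apply: nneseries_ge0 => n _ _; rewrite lee_fin mulr_ge0 ?exprn_ge0 ?modulus_ge0.
  have S10 : (0 <= kap%:E * S1)%E.
    apply: mule_ge0; first by rewrite lee_fin addr_ge0 ?invr_ge0 ?addr_ge0// divr_ge0// subr_ge0 ltW.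
    by apply: nneseries_ge0 => n _ _; rewrite lee_fin mulr_ge0 ?exprn_ge0 ?modulus_ge0.
  have c : (fun N => (\sum_(2 <= n < N) x n * r ^+ n)%:E +
      kap%:E * (\sum_(1 <= n < N) x n ^+ 2 * r ^+ (2 * n))%:E)%E @ \oo --> (S2 + kap%:E * S1)%E.
    exact: (cvgeD (ge0_adde_def S20 S10) c2 c1').
  apply: (cvge_to_le c); apply: nearW => N.
  by rewrite -EFinM -EFinD lee_fin; exact: csum.
have Ha := area_S_le r01 fa cle.
have Sv := schwarz_pick_value fa f1 r1.
have Sd := schwarz_pick_deriv fa f1 r1.
rewrite -/r in Sd; rewrite -/r -[modulus (a 0%N)]/A in Sv.
have Fz1 : modulus (f z) <= 1 by apply: f1; rewrite /unit_disc /mkset.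
have Fz0 := modulus_ge0 (f z).
set X := modulus (f z) in Sv Sd Fz1 Fz0 *; set D := modulus (derive1 f z) in Sd *.
rewrite -/A in Ha.
apply: (@le_trans _ _ ((X + D * r) + (1 - A ^+ 2) * r ^+ 2 / (1 - r)
  + lam * ((1 - A ^+ 2) ^+ 2 * r ^+ 2 / (1 - r ^+ 2) ^+ 2))%:E).
  rewrite -!EFinD -(addeA _ S2).
  rewrite [leRHS](_ : _ = ((X + D * r)%:E + ((1 - A ^+ 2) * r ^+ 2 / (1 - r))%:E
    + lam%:E * ((1 - A ^+ 2) ^+ 2 * r ^+ 2 / (1 - r ^+ 2) ^+ 2)%:E)%E)//.
  apply: leeD; first by apply: leeD.
  by apply: lee_wpmul2l => //; rewrite lee_fin bohr_lambda_ge0.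
rewrite lee_fin.
have r2 : 0 < 1 - r ^+ 2 by rewrite subr_gt0 expr_lt1.
have Ar : 0 < 1 + A * r by rewrite ltr_pwDl// mulr_ge0//; lra.
pose Y := (r + A) / (1 + A * r).
have DE : D * r <= r * (1 - X ^+ 2) / (1 - r ^+ 2).
  by rewrite ler_pdivlMr// mulrAC mulrC ler_wpM2l.
(* The map sending [x] to [x + r (1 - x^2) / (1 - r^2)] increases on [[0, 1]] once [2 r <= 1 - r^2],
   which holds up to [rho]. Hence the Schwarz-Pick bound [Y] may replace [X] in both terms at
   once. *)
have XY : X + r * (1 - X ^+ 2) / (1 - r ^+ 2) <= Y + r * (1 - Y ^+ 2) / (1 - r ^+ 2).
  have Y1 : Y <= 1.
    rewrite /Y ler_pdivrMr// mul1r; have : 0 <= (1 - r) * (1 - A) by rewrite mulr_ge0//; lra.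
    lra.
  rewrite -subr_ge0.
  have -> : Y + r * (1 - Y ^+ 2) / (1 - r ^+ 2) - (X + r * (1 - X ^+ 2) / (1 - r ^+ 2)) =
    (Y - X) * (((1 - r ^+ 2) - r * (X + Y)) / (1 - r ^+ 2)) by field; rewrite gt_eqF.
  rewrite mulr_ge0 ?divr_ge0 ?(ltW r2)//; first by rewrite subr_ge0.
  have : r * (X + Y) <= r * 2 by rewrite ler_wpM2l//; lra.
  have : r ^+ 2 <= rho ^+ 2 by rewrite ler_sqr ?nnegrE//; lra.
  lra.
have YE : Y + r * (1 - Y ^+ 2) / (1 - r ^+ 2) = 1 - (1 - A) * ((1 - r) / (1 + A * r) - r * (1 + A) / (1 + A * r) ^+ 2).
  by rewrite /Y; field; rewrite !gt_eqF.
have := @bohr_real_inequality A r; rewrite A0 A1 r0 zr => /(_ isT isT) H.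
have A1' : 0 <= 1 - A by lra.
have := ler_wpM2l A1' H.
have E1 : (1 - A ^+ 2) * r ^+ 2 / (1 - r) = (1 - A) * ((1 + A) * r ^+ 2 / (1 - r)) by ring.
have E2 : lam * ((1 - A ^+ 2) ^+ 2 * r ^+ 2 / (1 - r ^+ 2) ^+ 2) =
  (1 - A) * (lam * (1 - A) * (1 + A) ^+ 2 * (r ^+ 2 / (1 - r ^+ 2) ^+ 2)) by ring.
rewrite E1 E2; move: DE XY; rewrite YE.
set U := (1 - r) / _; set V := r * (1 + A) / _; set W := (1 + A) * _ / _.
set Z := lam * _ * _ * _; set D' := r * (1 - X ^+ 2) / _.
by move=> DE XY; rewrite mulrDr mulrDr; move: XY; rewrite mulrBr; lra.
Qed.

End UpperBound.

(** * Sharpness *)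

Section Blaschke.
Variable R : realType.
Implicit Types (z w : cplx R) (f : cplx R -> cplx R).

Local Notation rho := (bohr_radius R).
Local Notation lam := (bohr_lambda R).

(** Taylor coefficients in [h] of [p - k * h / (1 - e * h)], the shape of a Moebius map around a
    chosen centre. *)
Definition mobius_coef (p k e : cplx R) n : cplx R := if n is m.+1 then - k * e ^+ m else p.

Lemma has_ps_mobius f w s (p k e : cplx R) :
  (forall h, modulus h < s -> modulus (e * h) < 1 /\ f (w + h) = p - k * h / (1 - e * h)) ->
  has_ps f w s (mobius_coef p k e).
Proof.
move=> H h hs; have [eh fE] := H h hs; rewrite fE -cvg_shiftS.
rewrite (_ : [sequence _]_n = (fun n => p - k * h * series (fun m => (e * h) ^+ m) n)).
  apply: ccvgB (ccvg_cst _) _; apply: ccvgM (ccvg_cst _) _.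
  exact: cvg_geometric_cplx.
apply/funext => n; rewrite /series /= big_nat_recl//= expr0 mulr1; congr (_ + _).
by rewrite mulr_sumr -sumrN; apply: eq_bigr => i _; rewrite exprMn exprS; ring.
Qed.

Lemma modulus_cofrM (a : R) z : 0 <= a -> modulus (cofr a * z) = a * modulus z.
Proof. by move=> a0; rewrite modulusM modulus_cofr ger0_norm. Qed.

Lemma blaschke_den_ge (a : R) z : 0 <= a -> 1 - a * modulus z <= modulus (1 - cofr a * z).
Proof.
move=> a0; have := ge_modulusB 1 (cofr a * z).
by rewrite modulus1 modulus_cofrM//; apply: le_trans; rewrite ler_norm.
Qed.

Lemma blaschke_den_neq0 (a : R) z : 0 <= a < 1 -> modulus z < 1 -> 1 - cofr a * z != 0.
Proof.
move=> /andP[a0 a1] z1; rewrite -modulus_eq0 gt_eqF//.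
apply: lt_le_trans (blaschke_den_ge z a0); rewrite subr_gt0.
by have := modulus_ge0 z; nra.
Qed.

(** This one expansion yields analyticity at every point, the derivative at [- r] and the Taylor
    coefficients at [0]. Its radius is the distance to the unit circle, which keeps [w + h] in the
    disc. *)
Lemma blaschke_has_ps (a : R) w : 0 <= a < 1 -> modulus w < 1 ->
  has_ps (blaschke a) w (1 - modulus w)
   (mobius_coef (blaschke a w) (cofr (1 - a ^+ 2) / (1 - cofr a * w) ^+ 2) (cofr a / (1 - cofr a * w))).
Proof.
move=> a01 w1; have [a0 a1] := andP a01; have D := blaschke_den_neq0 a01 w1.
apply: has_ps_mobius => h hs.
have wh : modulus (w + h) < 1 by apply: le_lt_trans (modulusD _ _) _; lra.
have D2 := blaschke_den_neq0 a01 wh.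
have Dm : 0 < modulus (1 - cofr a * w) by rewrite lt_neqAle modulus_ge0 andbT eq_sym modulus_eq0.
split.
  rewrite mulrAC !modulusM modulusV modulus_cofr (ger0_norm a0) ltr_pdivrMr// mul1r.
  apply: lt_le_trans (blaschke_den_ge w a0).
  by have := modulus_ge0 h; have := modulus_ge0 w; nra.
rewrite /blaschke -![(a%:C)%C]/(cofr a) rmorphB rmorphXn rmorph1 /=.
have E : 1 - cofr a / (1 - cofr a * w) * h = (1 - cofr a * (w + h)) / (1 - cofr a * w) by field.
by rewrite E; field; rewrite D D2.
Qed.

Lemma blaschke_bounded (a : R) : 0 <= a < 1 -> bounded_class (blaschke a).
Proof.
move=> a01; have [a0 a1] := andP a01; split => z z1.
  apply: has_ps_analytic (blaschke_has_ps a01 z1); rewrite subr_gt0; exact: z1.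
rewrite /blaschke -![(a%:C)%C]/(cofr a) modulusM modulusV.
have D : 0 < modulus (1 - cofr a * z).
  by rewrite lt_neqAle modulus_ge0 andbT eq_sym modulus_eq0 blaschke_den_neq0.
rewrite ler_pdivrMr// mul1r -ler_sqr ?nnegrE ?modulus_ge0//.
have cja : cj (cofr a) = cofr a by exact: conjc_real.
have := modulus_pick (cofr a) z; rewrite cja => ->; rewrite lerDl mulr_ge0// subr_ge0 exprn_ile1 ?modulus_ge0//.
  by rewrite modulus_cofr ger0_norm// ltW.
exact: ltW.
Qed.

(** From [1 - |f_a|^2 = (1 - a^2) (1 - |z|^2) / |1 - a z|^2] and [|f_a|^2 <= |f_a|]. *)
Lemma blaschke_value_lower (a : R) z : 0 <= a < 1 -> modulus z < 1 ->
  1 - (1 - a ^+ 2) / (1 - modulus z) ^+ 2 <= modulus (blaschke a z).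
Proof.
move=> a01 z1; have [a0 a1] := andP a01; have [_ b1] := blaschke_bounded a01.
have B1 := b1 z z1; have B0 := modulus_ge0 (blaschke a z).
apply: (@le_trans _ _ (modulus (blaschke a z) ^+ 2)); last by rewrite expr2 ler_piMr.
have r0 := modulus_ge0 z; set r := modulus z in z1 r0 *.
have D : 0 < 1 - r by rewrite subr_gt0.
have D2 : 1 - r <= modulus (1 - cofr a * z).
  by apply: le_trans (blaschke_den_ge z a0); rewrite -/r; nra.
have cja : cj (cofr a) = cofr a by exact: conjc_real.
have := modulus_pick (cofr a) z; rewrite cja modulus_cofr (ger0_norm a0) -/r => E.
rewrite /blaschke -![(a%:C)%C]/(cofr a) modulusM modulusV exprMn exprVn.
have d0 : 0 < modulus (1 - cofr a * z) ^+ 2 by rewrite exprn_gt0// (lt_le_trans D).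
have -> : modulus (cofr a - z) ^+ 2 = modulus (1 - cofr a * z) ^+ 2 - (1 - a ^+ 2) * (1 - r ^+ 2) by rewrite E; ring.
rewrite [leRHS]mulrBl mulfV ?gt_eqF// lerD2l lerN2.
have a2 : 0 <= 1 - a ^+ 2 by rewrite subr_ge0 exprn_ile1// ltW.
rewrite -mulrA ler_wpM2l//; apply: (@le_trans _ _ (modulus (1 - cofr a * z) ^+ 2)^-1).
  by rewrite ler_piMl ?invr_ge0 ?(ltW d0)// lerBlDr lerDl sqr_ge0.
have sq : (1 - r) ^+ 2 <= modulus (1 - cofr a * z) ^+ 2 by rewrite ler_sqr ?nnegrE ?modulus_ge0 ?(ltW D).
have sq0 : 0 < (1 - r) ^+ 2 by rewrite exprn_gt0.
by rewrite lef_pV2 ?posrE.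
Qed.

Lemma bohr_G_ge_value f z (l : R) : 0 <= l -> modulus z < 1 ->
  ((modulus (f z))%:E <= bohr_G l f z)%E.
Proof.
move=> l0 z1; rewrite /bohr_G; have r0 := modulus_ge0 z.
rewrite -!addeA leeDl//; apply: adde_ge0; first by rewrite lee_fin mulr_ge0 ?modulus_ge0.
apply: adde_ge0; first by apply: nneseries_ge0 => n _ _; rewrite lee_fin mulr_ge0 ?exprn_ge0 ?modulus_ge0.
apply: adde_ge0; apply: mule_ge0.
- by rewrite lee_fin addr_ge0 ?invr_ge0 ?addr_ge0 ?modulus_ge0// divr_ge0// subr_ge0 ltW.
- by apply: nneseries_ge0 => n _ _; rewrite lee_fin mulr_ge0 ?exprn_ge0 ?modulus_ge0.
- by rewrite lee_fin.
- apply: mule_ge0; last by rewrite lee_fin invr_ge0 pi_ge0.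
  by apply: integral_ge0 => p _; rewrite lee_fin sqr_ge0.
Qed.

Lemma near_left1 : \forall a \near (1 : R)^'-, 0 <= a < 1.
Proof.
near=> a; apply/andP; split; first by near: a; exact: nbhs_left_ge.
by near: a; exact: nbhs_left_lt.
Unshelve. all: by end_near. Qed.

(** The functional is squeezed between its first term, which tends to [1], and the upper bound
    [1]. *)
Lemma blaschke_limit z : modulus z <= rho ->
  bohr_G lam (blaschke a) z @[a --> (1 : R)^'-] --> 1%E.
Proof.
move=> zr; have /andP[_ rho1] := bohr_radius_bounds R.
have z1 : modulus z < 1 by lra.
apply: (@squeeze_cvge _ _ _ _ (fun a : R => (1 - (1 - a ^+ 2) / (1 - modulus z) ^+ 2)%:E) _ (fun=> 1%E)).
- apply: filterS near_left1 => a a01; apply/andP; split; last first.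
    by apply: bohr_upper => //; exact: blaschke_bounded.
  apply: le_trans (bohr_G_ge_value _ (bohr_lambda_ge0 R) z1).
  by rewrite lee_fin blaschke_value_lower.
- apply: cvg_EFin; first exact: nearW.
  have H : (fun a : R => (1 - (1 - a ^+ 2) / (1 - modulus z) ^+ 2)) @ (1 : R)^'- -->
      (1 - (1 - 1 ^+ 2) / (1 - modulus z) ^+ 2 : R).
    apply: rcvg1B; apply: rcvgM; last exact: rcvg_cst.
    apply: rcvg1B; apply: rcvgX2; apply: cvg_at_left_filter; exact: cvg_id.
  by move: H; rewrite expr1n subrr mul0r subr0.
- exact: cvg_cst.
Qed.

Lemma poly_pos_left1 (p : {poly R}) : 0 < p.[1] -> exists a : R, 0 <= a < 1 /\ 0 < p.[a].
Proof.
move=> p1; have c : horner p @ (1 : R)^'- --> p.[1].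
  by apply: cvg_at_left_filter; exact: continuous_horner.
have H : \forall a \near (1 : R)^'-, 0 < p.[a] by exact: (cvgr_gt _ c _ p1).
by have [a [a01 pa]] := filter_ex (filterI near_left1 H); exists a.
Qed.

(** The two sides are in fact equal: the coefficients have modulus [(1 - a^2) a^j], and
    [sum_linear_geometric] sums the series. *)
Lemma blaschke_area_lower (a r : R) : 0 <= a < 1 -> 0 <= r < 1 ->
  (((1 - a ^+ 2) ^+ 2 * r ^+ 2 / (1 - a ^+ 2 * r ^+ 2) ^+ 2)%:E <= area_S (blaschke a) r * (pi^-1)%:E)%E.
Proof.
move=> a01 r01; have [a0 a1] := andP a01; have [r0 r1] := andP r01.
have mod0 : modulus (0 : cplx R) < 1 by rewrite modulus0.
have := blaschke_has_ps a01 mod0; rewrite modulus0 mulr0 !subr0 expr1n !divr1 => fa.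
have a2 : 0 <= 1 - a ^+ 2 by rewrite subr_ge0 exprn_ile1// ltW.
have H := cvgeZr (y := (pi^-1)%:E) isT (area_S_cvg r01 fa).
set x := a ^+ 2 * r ^+ 2.
have x0 : 0 <= x by rewrite mulr_ge0 ?sqr_ge0.
have x1 : x < 1 by rewrite /x -exprMn expr_lt1 ?mulr_ge0//; nra.
have x01 : 0 <= x < 1 by rewrite x0.
have p0 : (pi : R) != 0 by rewrite gt_eqF// pi_gt0.
have d0 : (1 - x) ^+ 2 != 0 by rewrite expf_neq0// gt_eqF// subr_gt0.
have sumE K :
   \sum_(j < K) pi * (j.+1%:R * modulus (mobius_coef (blaschke a 0) (cofr (1 - a ^+ 2)) (cofr a) j.+1) ^+ 2 * (r ^+ 2) ^+ j.+1)
   = pi * ((1 - a ^+ 2) ^+ 2 * r ^+ 2 / (1 - x) ^+ 2 * (1 - x ^+ K * (1 + K%:R * (1 - x)))).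
  rewrite -mulr_sumr; congr (_ * _); rewrite -sum_linear_geometric.
  set S := \sum_(j < K) j.+1%:R * x ^+ j.
  have -> : (1 - a ^+ 2) ^+ 2 * r ^+ 2 / (1 - x) ^+ 2 * (S * (1 - x) ^+ 2) = (1 - a ^+ 2) ^+ 2 * r ^+ 2 * S.
    by rewrite [S * _]mulrC mulrA divfK.
  rewrite /S mulr_sumr; apply: eq_bigr => j _.
  rewrite /= modulusM modulusN modulusX !modulus_cofr (ger0_norm a0) (ger0_norm a2) /x.
  by rewrite [_ ^+ j.+1]exprS [(a ^+ 2 * r ^+ 2) ^+ j]exprMn [(_ * a ^+ j) ^+ 2]exprMn
     -[(a ^+ j) ^+ 2]exprM -[(a ^+ 2) ^+ j]exprM [(j * 2)%N]mulnC; ring.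
have lim0 : (fun K => x ^+ K * (1 + K%:R * (1 - x))) @ \oo --> (0 : R).
  have [M [q [q01 HM]]] := linear_geometric x01.
  have lim1 := cvg_geo0 M q01.
  apply: (squeeze_cvgr _ (@cvg_cst _ (0 : R) _ _ _) lim1); apply: nearW => K; apply/andP; split.
    by rewrite mulr_ge0 ?exprn_ge0// addr_ge0// mulr_ge0// subr_ge0 ltW.
  apply: le_trans (HM K); rewrite mulrC ler_wpM2r ?exprn_ge0// -natr1 addrC lerD2r.
  by rewrite ler_piMr// lerBlDr lerDl.
have lim : (fun K => ((1 - a ^+ 2) ^+ 2 * r ^+ 2 / (1 - x) ^+ 2 * (1 - x ^+ K * (1 + K%:R * (1 - x))))%:E) @ \oo -->
    ((1 - a ^+ 2) ^+ 2 * r ^+ 2 / (1 - x) ^+ 2)%:E.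
  apply: cvg_EFin; first exact: nearW.
  rewrite -[X in _ --> X]mulr1; apply: rcvgM; first exact: rcvg_cst.
  by rewrite -[X in _ --> X](subr0 1); apply: rcvg1B.
have E : (fun n => ((\sum_(j < n)
      pi * (j.+1%:R * modulus (mobius_coef (blaschke a 0) (cofr (1 - a ^+ 2)) (cofr a) j.+1) ^+ 2
        * (r ^+ 2) ^+ j.+1))%:E * (pi^-1)%:E)%E)
  = (fun K => ((1 - a ^+ 2) ^+ 2 * r ^+ 2 / (1 - x) ^+ 2 * (1 - x ^+ K * (1 + K%:R * (1 - x))))%:E).
  by apply/funext => K; rewrite sumE -EFinM mulrAC mulfV// mul1r.
rewrite E in H.
by rewrite -(cvg_unique (@ereal_hausdorff R) lim H).
Qed.

End Blaschke.

(** * Evaluation at [z = - r] and optimality of the two constants *)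

Section Sharpness.
Variable R : realType.
Implicit Types (z w : cplx R) (f : cplx R -> cplx R).

Local Notation rho := (bohr_radius R).
Local Notation lam := (bohr_lambda R).

Lemma nneseries_geometric (u : nat -> R) k (c q : R) : 0 <= q < 1 -> (forall n, 0 <= u n) ->
  (forall j, u (j + k)%N = c * q ^+ j) -> (\sum_(k <= n <oo) (u n)%:E)%E = (c / (1 - q))%:E.
Proof.
move=> /andP[q0 q1] u0 uE.
have H := nneseries_cvg (k := k) u0; rewrite -(cvg_shiftn k) in H.
have L : (fun N => (series (geometric c q) N)%:E) @ \oo --> (c / (1 - q))%:E.
  apply: cvg_EFin; first exact: nearW.
  by apply: cvg_geometric_series; rewrite ger0_norm.
have E : [sequence (\sum_(k <= n < N + k) u n)%:E]_N = (fun N => (series (geometric c q) N)%:E).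
  apply/funext => N; rewrite /series /= -{1}(add0n k) big_addn addnK; congr EFin.
  by apply: eq_bigr => i _; rewrite uE.
rewrite E in H; exact: (cvg_unique (@ereal_hausdorff R) H L).
Qed.

(** At [- r] the Schwarz-Pick bounds for the value and the derivative are attained, and the two
    series add up to [(1 - a^2) r^2 / (1 - r)], which is the bound of [coef_sum_le]. *)
Lemma blaschke_G_lower (a r l : R) : 0 <= a < 1 -> 0 <= r < 1 -> 0 <= l ->
  (((a + r) / (1 + a * r) + (1 - a ^+ 2) * r / (1 + a * r) ^+ 2 + (1 - a ^+ 2) * r ^+ 2 / (1 - r)
    + l * ((1 - a ^+ 2) ^+ 2 * r ^+ 2 / (1 - a ^+ 2 * r ^+ 2) ^+ 2))%:E
   <= bohr_G l (blaschke a) (cofr (- r)))%E.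
Proof.
move=> a01 r01 l0; have [a0 a1] := andP a01; have [r0 r1] := andP r01.
have zm : modulus (cofr (- r)) = r by rewrite modulus_cofr normrN ger0_norm.
have z1 : modulus (cofr (- r)) < 1 by rewrite zm.
have ar0 : 0 <= a * r by rewrite mulr_ge0.
have ar1 : a * r < 1 by nra.
have Ar : 0 < 1 + a * r by lra.
have a2 : 0 <= 1 - a ^+ 2 by rewrite subr_ge0 exprn_ile1// ltW.
have denE : 1 - cofr a * cofr (- r) = cofr (1 + a * r).
  by rewrite -rmorphM -(rmorph1 (@cofr R)) -rmorphB mulrN opprK.
have valE : modulus (blaschke a (cofr (- r))) = (a + r) / (1 + a * r).
  rewrite /blaschke -![(a%:C)%C]/(cofr a) denE -rmorphB opprK modulusM modulusV !modulus_cofr.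
  by rewrite !ger0_norm ?addr_ge0 ?(ltW Ar).
have derE : modulus (derive1 (blaschke a) (cofr (- r))) = (1 - a ^+ 2) / (1 + a * r) ^+ 2.
  have s0 : 0 < 1 - modulus (cofr (- r)) by rewrite subr_gt0.
  rewrite (has_ps_derive1 s0 (blaschke_has_ps a01 z1)) /mobius_coef ?expr0 mulr1 modulusN denE.
  by rewrite modulusM modulusV modulusX !modulus_cofr !ger0_norm// ltW.
have mod0 : modulus (0 : cplx R) < 1 by rewrite modulus0.
have := blaschke_has_ps a01 mod0; rewrite modulus0 mulr0 !subr0 expr1n !divr1 => fa.
have coef0 : modulus (taylor_coef (blaschke a) 0) = a.
  rewrite (taylor_coefE _ ltr01 fa) /mobius_coef /blaschke -![(a%:C)%C]/(cofr a) mulr0 !subr0 divr1.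
  by rewrite modulus_cofr ger0_norm.
have coefS n : modulus (taylor_coef (blaschke a) n.+1) = (1 - a ^+ 2) * a ^+ n.
  rewrite (taylor_coefE _ ltr01 fa) /mobius_coef modulusM modulusN modulusX !modulus_cofr.
  by rewrite (ger0_norm a0) ger0_norm.
rewrite /bohr_G zm valE derE coef0.
have c2 : 0 <= a ^+ 2 * r ^+ 2 < 1.
  by rewrite -exprMn exprn_ge0//= expr_lt1.
have c1 : 0 <= a * r < 1 by rewrite ar0.
rewrite (@nneseries_geometric _ 2 ((1 - a ^+ 2) * a * r ^+ 2) (a * r) c1); last 2 first.
- by move=> n; rewrite mulr_ge0 ?modulus_ge0 ?exprn_ge0.
- by move=> j; rewrite addn2 coefS [r ^+ j.+2]exprSr [r ^+ j.+1]exprSr [a ^+ j.+1]exprS exprMn; ring.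
rewrite (@nneseries_geometric _ 1 ((1 - a ^+ 2) ^+ 2 * r ^+ 2) (a ^+ 2 * r ^+ 2) c2); last 2 first.
- by move=> n; rewrite mulr_ge0 ?modulus_ge0 ?exprn_ge0 ?modulus_ge0.
- move=> j; rewrite addn1 coefS mulnS exprD exprMn -[(a ^+ j) ^+ 2]exprM mulnC.
  by rewrite [(a ^+ 2 * r ^+ 2) ^+ j]exprMn -!exprM [(2 * j)%N]mulnC; ring.
apply: (@le_trans _ _ (((a + r) / (1 + a * r))%:E + ((1 - a ^+ 2) / (1 + a * r) ^+ 2 * r)%:E +
   ((1 - a ^+ 2) * a * r ^+ 2 / (1 - a * r))%:E + ((1 + a)^-1 + r / (1 - r))%:E *
   ((1 - a ^+ 2) ^+ 2 * r ^+ 2 / (1 - a ^+ 2 * r ^+ 2))%:E +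
   l%:E * ((1 - a ^+ 2) ^+ 2 * r ^+ 2 / (1 - a ^+ 2 * r ^+ 2) ^+ 2)%:E)%E); last first.
  apply: leeD => //; apply: lee_wpmul2l; first by rewrite lee_fin.
  exact: blaschke_area_lower.
rewrite -!EFinM -!EFinD lee_fin lerD2r le_eqVlt; apply/orP; left; apply/eqP.
have E2 : 1 - a ^+ 2 * r ^+ 2 = (1 - a * r) * (1 + a * r) by ring.
rewrite E2; field.
by rewrite !gt_eqF//; lra.
Qed.

(** Everything but the [lambda] term, expanded around its value [1] at [a = 1]; the bracket carries
    the first order in [1 - a]. *)
Lemma blaschke_excess (a r : R) : 0 <= a < 1 -> 0 <= r < 1 ->
  (a + r) / (1 + a * r) + (1 - a ^+ 2) * r / (1 + a * r) ^+ 2 + (1 - a ^+ 2) * r ^+ 2 / (1 - r) =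
  1 + (1 - a) * (- (1 - r) * (1 + r * a) + r * (1 + a) + (1 + a) * (1 + r * a) ^+ 2 * (r ^+ 2 / (1 - r))) / (1 + a * r) ^+ 2.
Proof.
move=> /andP[a0 a1] /andP[r0 r1]; field; rewrite !gt_eqF//; first lra.
by rewrite ltr_pwDl// mulr_ge0.
Qed.

Lemma radius_sharp (r0 : R) : rho < r0 -> exists a z,
  [/\ 0 <= a < 1, modulus z < 1, modulus z <= r0 & (1 < bohr_G lam (blaschke a) z)%E].
Proof.
move=> rr0; have /andP[rho1 rho2] := bohr_radius_bounds R; have E := bohr_radius_eq R.
(* The minimum keeps [r] below [1] when [r0] is large, and still above [rho]. *)
pose r := Num.min r0 (1 / 2).
have r_le : r <= r0 by rewrite /r ge_min lexx.
have r_half : r <= 1 / 2 by rewrite /r ge_min lexx orbT.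
have rho_r : rho < r by rewrite lt_min rr0 /=; lra.
clearbody r.
have r01 : 0 <= r < 1 by apply/andP; split; lra.
have [rge0 r1] := andP r01.
have Dr : 0 < 1 - r by lra.
pose p : {poly R} := - (1 - r)%:P * (1 + r%:P * 'X) + r%:P * (1 + 'X)
   + (1 + 'X) * (1 + r%:P * 'X) ^+ 2 * (r ^+ 2 / (1 - r))%:P.
have pE a : p.[a] = - (1 - r) * (1 + r * a) + r * (1 + a) + (1 + a) * (1 + r * a) ^+ 2 * (r ^+ 2 / (1 - r)).
  by rewrite /p !hornerE.
(* [p] is the bracket of [blaschke_excess]. At [a = 1] its factor [2 * r ^+ 2 + 3 * r - 1] vanishes
   for [r = rho] and is positive beyond. *)
have p1 : 0 < p.[1].
  rewrite pE; have -> : - (1 - r) * (1 + r * 1) + r * (1 + 1) + (1 + 1) * (1 + r * 1) ^+ 2 * (r ^+ 2 / (1 - r)) =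
    (2 * r ^+ 2 + 3 * r - 1) * (r ^+ 2 + 1) / (1 - r) by field; rewrite gt_eqF.
  rewrite divr_gt0// mulr_gt0//; last by rewrite ltr_wpDl ?sqr_ge0.
  have : rho ^+ 2 <= r ^+ 2 by rewrite ler_sqr ?nnegrE//; lra.
  by move: E; lra.
have [a [a01 pa]] := poly_pos_left1 p1; have [a0 a1] := andP a01.
have zm : modulus (cofr (- r)) = r by rewrite modulus_cofr normrN ger0_norm.
exists a, (cofr (- r)); rewrite zm; split => //.
apply: lt_le_trans (blaschke_G_lower a01 r01 (bohr_lambda_ge0 R)).
rewrite blaschke_excess// -pE lte_fin -addrA ltrDl ltr_wpDr//.
  rewrite mulr_ge0 ?bohr_lambda_ge0// divr_ge0 ?sqr_ge0// mulr_ge0 ?sqr_ge0//.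
by rewrite divr_gt0 ?mulr_gt0 ?subr_gt0 ?exprn_gt0// ltr_pwDl// mulr_ge0.
Qed.

(** At [r = rho] the bracket of [blaschke_excess] vanishes for [a = 1], so the comparison with [1]
    is decided at order [(1 - a)^2], where [l] enters. *)
Lemma lambda_sharp (l : R) : lam < l -> exists a z,
  [/\ 0 <= a < 1, modulus z <= rho & (1 < bohr_G l (blaschke a) z)%E].
Proof.
move=> ll; have /andP[rho1 rho2] := bohr_radius_bounds R; have E := bohr_radius_eq R.
have L0 := bohr_lambda_ge0 R.
have lE := bohr_lambdaE R.
move: E rho1 rho2; set r := rho => E rho1 rho2.
have r01 : 0 <= r < 1 by apply/andP; split; lra.
have [r0 r1] := andP r01.
have l0 : 0 <= l by lra.
have Dr : 0 < 1 - r by lra.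
pose c := (1 - 2 * r) / 4.
have k1 : r ^+ 2 / (1 - r) = c.
  apply/eqP; rewrite eqr_div ?pnatr_eq0//; last by rewrite gt_eqF.
  by apply/eqP; lra.
(* [- (1 - a) * q a] is the bracket of [blaschke_excess] at [r = rho], and [p] is the numerator left
   once [(1 - a) ^+ 2] is taken out of the whole excess. *)
pose q (a : R) := (r ^+ 2 + c * (1 + 2 * r)) + c * (2 * r + r ^+ 2) * (1 + a) + c * r ^+ 2 * (1 + a + a ^+ 2).
pose p : {poly R} := l%:P * (1 + 'X) ^+ 2 * (r ^+ 2)%:P -
  ((r ^+ 2 + c * (1 + 2 * r))%:P + (c * (2 * r + r ^+ 2))%:P * (1 + 'X) + (c * r ^+ 2)%:P * (1 + 'X + 'X ^+ 2))
   * (1 - r%:P * 'X) ^+ 2.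
have pE a : p.[a] = l * (1 + a) ^+ 2 * r ^+ 2 - q a * (1 - r * a) ^+ 2.
  by rewrite /p /q !hornerE.
have e2 : r ^+ 2 = (1 - 3 * r) / 2 by lra.
have p1 : 0 < p.[1].
  (* This is the origin of [lam]: it is the value of [l] for which [p] vanishes at [1]. *)
  have base : lam * (1 + 1) ^+ 2 * r ^+ 2 = q 1 * (1 - r * 1) ^+ 2.
    have e3 : r ^+ 3 = (11 * r - 3) / 4 by rewrite exprS e2; have := e2; rewrite expr2; lra.
    have e4 : r ^+ 4 = (11 - 39 * r) / 8 by rewrite exprS e3; have := e2; rewrite expr2; lra.
    have e5 : r ^+ 5 = (139 * r - 39) / 16 by rewrite exprS e4; have := e2; rewrite expr2; lra.
    rewrite lE /q /c -/r; lra.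
  rewrite pE -base; suff : 0 < (l - lam) * ((1 + 1) ^+ 2 * r ^+ 2) by lra.
  apply: mulr_gt0; first by rewrite subr_gt0.
  by rewrite mulr_gt0 ?exprn_gt0//; lra.
have [a [a01 pa]] := poly_pos_left1 p1; have [a0 a1] := andP a01.
have zm : modulus (cofr (- r)) = r by rewrite modulus_cofr normrN ger0_norm.
exists a, (cofr (- r)); rewrite zm; split => //.
apply: lt_le_trans (blaschke_G_lower a01 r01 l0).
have ar0 : 0 <= a * r by rewrite mulr_ge0.
have ar1 : a * r < 1 by nra.
rewrite blaschke_excess// k1 lte_fin.
have P1 : - (1 - r) * (1 + r * 1) + r * (1 + 1) + (1 + 1) * (1 + r * 1) ^+ 2 * c = 0.
  have e3 : r ^+ 3 = (11 * r - 3) / 4 by rewrite exprS e2; have := e2; rewrite expr2; lra.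
  rewrite /c; lra.
have PE : - (1 - r) * (1 + r * a) + r * (1 + a) + (1 + a) * (1 + r * a) ^+ 2 * c = - (1 - a) * q a.
  by rewrite -[LHS]subr0 -P1 /q; ring.
rewrite PE -addrA ltrDl.
have -> : (1 - a) * (- (1 - a) * q a) / (1 + a * r) ^+ 2 +
  l * ((1 - a ^+ 2) ^+ 2 * r ^+ 2 / (1 - a ^+ 2 * r ^+ 2) ^+ 2) =
  (1 - a) ^+ 2 * p.[a] / ((1 + a * r) ^+ 2 * (1 - a * r) ^+ 2).
  rewrite pE; have -> : 1 - a ^+ 2 * r ^+ 2 = (1 - a * r) * (1 + a * r) by ring.
  by field; rewrite !gt_eqF//; lra.
by rewrite divr_gt0 ?mulr_gt0 ?exprn_gt0 ?subr_gt0//; lra.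
Qed.

End Sharpness.

Theorem theorem2p12 (R : realType) :
  [/\ forall f : cplx R -> cplx R, bounded_class f ->
        forall z : cplx R, modulus z <= bohr_radius R ->
          (bohr_G (bohr_lambda R) f z <= 1)%E,
      forall rho : R, bohr_radius R < rho ->
        ~ bohr_inequality (bohr_lambda R) rho,
      forall lambda : R, bohr_lambda R < lambda ->
        ~ bohr_inequality lambda (bohr_radius R)
    & [/\ forall a : R, 0 <= a < 1 -> bounded_class (blaschke a),
          forall z : cplx R, modulus z <= bohr_radius R ->
            bohr_G (bohr_lambda R) (blaschke a) z @[a --> 1^'-] --> 1%E,
          forall rho : R, bohr_radius R < rho ->
            exists a : R, exists z : cplx R,
              [/\ 0 <= a < 1, modulus z < 1, modulus z <= rho
                & (1 < bohr_G (bohr_lambda R) (blaschke a) z)%E]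
        & forall lambda : R, bohr_lambda R < lambda ->
            exists a : R, exists z : cplx R,
              [/\ 0 <= a < 1, modulus z <= bohr_radius R
                & (1 < bohr_G lambda (blaschke a) z)%E]]].
Proof.
split.
- by move=> f fB z; exact: bohr_upper.
- move=> rho /radius_sharp[a [z [a01 z1 zr G1]]] H.
  by have := H _ (blaschke_bounded a01) z z1 zr; rewrite leNgt G1.
- move=> l /lambda_sharp[a [z [a01 zr G1]]] H.
  have z1 : modulus z < 1 by have /andP[_ ?] := bohr_radius_bounds R; lra.
  by have := H _ (blaschke_bounded a01) z z1 zr; rewrite leNgt G1.
split.
- exact: blaschke_bounded.
- exact: blaschke_limit.
- exact: radius_sharp.
- exact: lambda_sharp.
Qed.
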